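(* Let $p$ be a prime, $h\ge 1$ an integer, and $q=p^h$ with $q\ge 19$. Let $c$ be a non-zero codeword of $\mathcal C_{1,1}(3,q)$ of weight at most $q^3+2q^2+q+1$. Then either (1) $c$ has weight $q^3+q^2+q+1$ and $c$ is the characteristic vector of the set of absolute lines of a symplectic polar space $W(3,q)$ in $\mathrm{PG}(3,q)$, or (2) $c$ has weight $q^3+2q^2+q+1$ and $c$ is a scalar multiple of the characteristic vector $\chi_\ell^{(1)}$ of a line $\ell$ of $\mathrm{PG}(3,q)$. Moreover, (1) occurs (i.e. there are codewords of $\mathcal C_{1,1}(3,q)$ as described in (1)) if and only if $q$ is even.
   Context: $\mathrm{PG}(n,q)$ is the projective space of the vector space $\mathbb F_q^{n+1}$; all dimensions are projective. Let $\mathcal G_1(3,q)$ be the set of lines of $\mathrm{PG}(3,q)$. For a set $S$ of lines of $\mathrm{PG}(3,q)$, its characteristic vector is the function $\chi_S:\mathcal G_1(3,q)\to\mathbb F_p$ equal to $1$ on $S$ and $0$ elsewhere. For a line $\ell$, the characteristic vector of $\ell$, denoted $\chi_\ell^{(1)}$, is the characteristic vector of the set of all lines of $\mathrm{PG}(3,q)$ having non-empty intersection with $\ell$ (including $\ell$ itself). The code $\mathcal C_{1,1}(3,q)$ is the $\mathbb F_p$-span of $\{\chi_\ell^{(1)} : \ell\in\mathcal G_1(3,q)\}$ inside $\mathbb F_p^{\mathcal G_1(3,q)}$. The weight of a vector is the number of positions in which it is non-zero. A symplectic polar space $W(3,q)$ in $\mathrm{PG}(3,q)$ is the set of absolute subspaces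 of a polarity $\perp$ coming from a non-degenerate alternating bilinear form $b$ on $\mathbb F_q^4$, where $\pi^\perp=\{y : b(x,y)=0 \ \forall x\in\pi\}$ and a subspace $\pi$ is absolute if $\pi\subseteq\pi^\perp$. *)

(* Defs.v *)
From HB Require Import structures.
From mathcomp Require Import all_boot all_order all_algebra.

Set Implicit Arguments.
Unset Strict Implicit.
Unset Printing Implicit Defensive.

Import GRing.Theory.
Local Open Scope ring_scope.

Section FiniteVspace.
Variables (F : finFieldType) (vT : vectType F).

HB.instance Definition _ :=
  Countable.copy {vspace vT} (can_type (@VectorInternalTheory.vs2mxK F vT)).
HB.instance Definition _ : isFinite {vspace vT} :=
  CanIsFinite (@VectorInternalTheory.vs2mxK F vT).

End FiniteVspace.

(* Projective lines of PG(3, F) are the vector subspaces of rank 2 of F^4. *)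
Definition line (F : finFieldType) : finType :=
  {U : {vspace 'rV[F]_4} | \dim U == 2%N}.

(* Projective subspaces have a common point iff the underlying vector spaces
   meet non-trivially. *)
Definition meets (F : finFieldType) (l m : line F) : bool :=
  (val l :&: val m)%VS != 0%VS.

(* ('F_p)^o is 'F_p seen as a vector space over itself; this makes the finite
   functions a vectType over 'F_p. *)
Definition word (p : nat) (F : finFieldType) := {ffun line F -> ('F_p)^o}.

Definition charvec (p : nat) (F : finFieldType) (S : {set line F}) :
  word p F := [ffun l => (l \in S)%:R].

Definition line_charvec (p : nat) (F : finFieldType) (l : line F) :
  word p F := charvec p [set m | meets l m].

Definition code11 (p : nat) (F : finFieldType) :
  {vspace {ffun line F -> ('F_p)^o}} :=
  <<[seq line_charvec p l | l : line F]>>%VS.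

Definition weight (p : nat) (F : finFieldType) (c : word p F) : nat :=
  #|[set l | c l != 0]|.

Definition alternating (F : finFieldType) (b : {biscalar 'rV[F]_4}) : Prop :=
  forall x, b x x = 0.

Definition nondegenerate (F : finFieldType) (b : {biscalar 'rV[F]_4}) : Prop :=
  forall x, (forall y, b x y = 0) -> x = 0.

Definition perp (F : finFieldType) (b : {biscalar 'rV[F]_4})
  (U : {vspace 'rV[F]_4}) : {set 'rV[F]_4} :=
  [set y | [forall x in U, b x y == 0]].

(* The absolute subspaces of the polarity defined by b. *)
Definition polar_space (F : finFieldType) (b : {biscalar 'rV[F]_4}) :
  {set {vspace 'rV[F]_4}} :=
  [set U : {vspace 'rV[F]_4} | [forall x in U, x \in perp b U]].

Definition symplectic_polar_space (F : finFieldType)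
  (W : {set {vspace 'rV[F]_4}}) : Prop :=
  exists b : {biscalar 'rV[F]_4},
    [/\ alternating b, nondegenerate b & W = polar_space b].

Definition lines_of (F : finFieldType) (W : {set {vspace 'rV[F]_4}}) :
  {set line F} := [set l | val l \in W].

Definition symplectic_word (p : nat) (F : finFieldType) (c : word p F) :
  Prop :=
  let q := #|F| in
  weight c = (q ^ 3 + q ^ 2 + q + 1)%N /\
  exists W : {set {vspace 'rV[F]_4}},
    symplectic_polar_space W /\ c = charvec p (lines_of W).

Definition line_word (p : nat) (F : finFieldType) (c : word p F) : Prop :=
  let q := #|F| in
  weight c = (q ^ 3 + 2 * q ^ 2 + q + 1)%N /\
  exists (a : 'F_p) (l : line F), c = a *: line_charvec p l.

(* Main.v *)
(* Via the Klein correspondence, a codeword is a function on the lines that is a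
   combination of hyperplane sections of the Klein quadric; tangent hyperplanes
   are the lines of PG(3,q) and the other ones are the W(3,q). The lines through a
   point, and the lines in a plane, form planes of the quadric, on which a
   codeword [sum_i a_i [w_i . z = 0]] is a polynomial function of degree at most
   [q - 1], since [[s = 0] = 1 - s^(q-1)]. Let [sigma = sum_i a_i].

   If [sigma = 0], a nonzero restriction to such a plane has weight at least [2q].
   So a word of small weight vanishes around almost half of the points, but each
   plane with a nonzero restriction contains about [2/3 q^2] points with a nonzero
   restriction; this contradicts the expansion of the point-plane incidence.

   If [sigma = 1], the restriction to each plane of the quadric is a single line
   or has weight at least [2q - 1], so almost every point is the centre of a
   pencil, and almost every plane contains a pencil, of lines with value one. Three
   such points determine a hyperplane agreeing with the word around most points,
   and the case [sigma = 0] applies to the difference.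

   For [q] odd, the difference of the two reguli of a hyperbolic quadric is a dual
   codeword that does not vanish on a suitably placed W(3,q); for [q] even, the
   lines of a regulus sum up to a W(3,q).

   Points and planes are represented by nonzero vectors, so that they are counted
   with a factor [q - 1]. *)

Require Import Defs.
From HB Require Import structures.
From mathcomp Require Import all_boot all_order all_algebra.
From mathcomp Require Import finfield mxabelem.
From mathcomp Require Import zify ring.

Set Implicit Arguments.
Unset Strict Implicit.
Unset Printing Implicit Defensive.

Import GRing.Theory.
Local Open Scope ring_scope.

(** * Words of the plane code as polynomial functions *)

(** The weight bound controls only an average over all points. So every local statement is a
    dichotomy for the lines through one point, and the bound serves to count the exceptional points.
    [dual] turns lines into lines of the dual space, so each statement on points is used again for
    planes. The values are moved from ['F_p] to [F], because the polynomials need coefficients and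
    arguments in one field. For sum one, agreement with a hyperplane section is not proved around
    every point, since the reconstruction fails at exceptional points and planes. Agreement outside
    about [7 q^3] of the [q^4] vectors is enough, because the difference has sum zero. The
    bottleneck is the choice of the points that determine the hyperplane: up to terms of order
    [q^3], half of all vectors may have to be avoided. A point is unsuitable if too many exceptional
    planes pass through it and the first chosen point, and this is only controlled on average. *)

Lemma column_nonzeros (F : finFieldType) (r : nat) (g : nat -> {poly F})
    (f : F -> F -> F) (x0 : F) :
  (r < #|F|)%N ->
  (forall j, (j <= r)%N -> (size (g j) <= r.+1 - j)%N) ->
  (forall x y, f x y = \sum_(j < r.+1) (g j).[x] * y ^+ j) ->
  (exists y, f x0 y != 0) ->
  (#|F| + #|[set x | [forall y, f x y == 0%R]]| <= #|[set y | f x0 y != 0%R]| + r)%N.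
Proof.
move=> ltrq szg fE [y0 fy0]; set Z := [set x | _].
pose h x := \poly_(j < r.+1) (g j).[x].
have hE x y : (h x).[y] = f x y by rewrite horner_poly fE.
(* A vanishing column is a polynomial in [y] of degree at most [r < q] with [q] roots. *)
have gZ j x : (j <= r)%N -> x \in Z -> (g j).[x] = 0.
  rewrite inE => ler /forallP fx0.
  suff h0 : h x = 0.
    by move/polyP/(_ j): h0; rewrite coef_poly coef0 ltnS ler.
  apply: (@roots_geq_poly_eq0 _ _ (enum F)); last 1 first.
  - by rewrite -cardE; apply: leq_trans (size_poly _ _) _.
  - by apply/allP=> y _; rewrite rootE hE.
  - exact: enum_uniq.
(* [g j] has degree at most [r - j], so each vanishing column lowers the degree in [y] of all the
   other columns by one. *)
have g0 j : (j <= r)%N -> (r.+1 - j <= #|Z|)%N -> g j = 0.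
  move=> ler lek; apply: (@roots_geq_poly_eq0 _ _ (enum Z)).
  - by apply/allP=> x; rewrite mem_enum => xZ; rewrite rootE gZ.
  - exact: enum_uniq.
  - by rewrite -cardE; apply: leq_trans (szg _ ler) lek.
have szh : (size (h x0) <= r.+1 - #|Z|)%N.
  apply/leq_sizeP => j lej; rewrite coef_poly; case: ltnP => // ltj.
  by rewrite g0 ?horner0 //; lia.
have hn0 : h x0 != 0 by apply/eqP=> h0; move: fy0; rewrite -hE h0 horner0 eqxx.
have := max_poly_roots (rs := enum [set y | f x0 y == 0]) hn0.
rewrite enum_uniq -cardE => /(_ _ isT) ltz.
have {}ltz : (#|[set y | f x0 y == 0%R]| < size (h x0))%N.
  by apply: ltz; apply/allP=> y; rewrite mem_enum inE rootE hE.
have cF : (#|[set y | f x0 y == 0%R]| + #|[set y | f x0 y != 0%R]| = #|F|)%N.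
  by rewrite -(cardsC [set y | f x0 y == 0]); congr (_ + _)%N; apply: eq_card => y; rewrite !inE.
by move: ltz szh; rewrite -cF; lia.
Qed.

Lemma size_linear_exp (F : fieldType) (a b : F) n :
  (size ((a%:P + b *: 'X) ^+ n)%R <= n.+1)%N.
Proof.
apply: leq_trans (size_exp_leq _ _) _.
have s2 : (size (a%:P + b *: 'X)%R <= 2)%N.
  rewrite (leq_trans (size_polyD _ _)) // geq_max (leq_trans (size_polyC_leq1 _)) //.
  by rewrite (leq_trans (size_scale_leq _ _)) // size_polyX.
rewrite ltnS -[leqRHS]mul1n leq_mul2r; apply/orP; right; lia.
Qed.

(** * The pairing of points with planes *)

Section Dot.
Variables (F : fieldType) (n : nat).
Implicit Types x y z : 'rV[F]_n.

Definition dot x y : F := (x *m y^T) 0 0.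

Lemma dotE x y : dot x y = \sum_i x 0 i * y 0 i.
Proof. by rewrite /dot mxE; apply: eq_bigr => i _; rewrite mxE. Qed.
Lemma dotC x y : dot x y = dot y x.
Proof. by rewrite !dotE; apply: eq_bigr => i _; rewrite mulrC. Qed.
Lemma dotDl x y z : dot (x + y) z = dot x z + dot y z.
Proof. by rewrite /dot mulmxDl mxE. Qed.
Lemma dotDr x y z : dot z (x + y) = dot z x + dot z y.
Proof. by rewrite dotC dotDl !(dotC z). Qed.
Lemma dotZl a x y : dot (a *: x) y = a * dot x y.
Proof. by rewrite /dot -scalemxAl mxE. Qed.
Lemma dotZr a x y : dot x (a *: y) = a * dot x y.
Proof. by rewrite dotC dotZl dotC. Qed.
Lemma dot0l x : dot 0 x = 0. Proof. by rewrite /dot mul0mx mxE. Qed.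
Lemma dot0r x : dot x 0 = 0. Proof. by rewrite dotC dot0l. Qed.
Lemma dotNl x y : dot (- x) y = - dot x y.
Proof. by rewrite /dot mulNmx mxE. Qed.
Lemma dotNr x y : dot x (- y) = - dot x y.
Proof. by rewrite dotC dotNl dotC. Qed.
Lemma dot_eq0_all x : (forall y, dot x y = 0) -> x = 0.
Proof.
move=> H; apply/rowP => i; have := H (delta_mx 0 i); rewrite dotE (bigD1 i) //= big1.
  by rewrite !mxE !eqxx mulr1 addr0.
by move=> j ji; rewrite !mxE (negPf ji) andbF mulr0.
Qed.

Definition dot_lin := (dotDl, dotDr, dotZl, dotZr, dotNl, dotNr, dot0l, dot0r).
End Dot.

Section PlaneWord.
Variables (F : finFieldType) (I : finType) (a : I -> F) (w : I -> 'rV[F]_3).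
Let q := #|F|.

(** A combination of characteristic functions of lines of [PG(2,q)]; [w i = 0] is allowed and gives
    the constant one. *)
Definition plane_word (z : 'rV[F]_3) : F :=
  \sum_i a i * (dot (w i) z == 0)%:R.
Local Notation D := plane_word.
Local Notation sigma := (\sum_i a i).

Lemma card_gt1 : (1 < q)%N. Proof. exact: finNzRing_gt1. Qed.

Lemma card_natr0 : q%:R = 0 :> F.
Proof.
have E : \sum_(x : F) x = \sum_(x : F) x + q%:R.
  rewrite {1}(reindex_inj (addIr 1)) /= big_split /=; congr (_ + _).
  by rewrite sumr_const; congr (_ *+ _); apply: eq_card => x; rewrite !inE.
by apply/(addrI (\sum_(x : F) x)); rewrite -E addr0.
Qed.

Lemma eq0_natrE (s : F) : (s == 0)%:R = 1 - s ^+ q.-1 :> F.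
Proof.
have q1 := card_gt1.
case: (eqVneq s 0) => [->|sn0].
  by rewrite expr0n; move: q1; case: q => [|[|?]] //= _; rewrite subr0.
suff -> : s ^+ q.-1 = 1 by rewrite subrr.
apply: (mulfI sn0); rewrite -exprS mulr1 prednK ?expf_card //.
by apply: leq_trans q1.
Qed.

Section Columns.
Variables h1 h2 h3 : 'rV[F]_3.
(** Affine coordinates with [<h1, h2>] as line at infinity; a column is an affine line through the
    point [h2]. *)
Let f x y := D (h3 + x *: h1 + y *: h2).
Let al i := dot (w i) h3.
Let be i := dot (w i) h1.
Let ga i := dot (w i) h2.
(** For [sigma = 0], these are up to sign both the coefficients of the part of degree [q - 1] and
    those of the restriction to the line at infinity. *)
Let top j := \sum_i a i * ('C(q.-1, j)%:R * ga i ^+ j * be i ^+ (q.-1 - j)).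
Let g j : {poly F} := (sigma *+ (j == 0))%:P -
  \sum_i (a i * ('C(q.-1, j)%:R * ga i ^+ j)) *: ((al i)%:P + be i *: 'X) ^+ (q.-1 - j).

Let gE x y : f x y = \sum_(j < q) (g j).[x] * y ^+ j.
Proof.
rewrite /f /D.
have qS : q = q.-1.+1 by rewrite prednK // (leq_trans _ card_gt1).
under eq_bigr => i _ do rewrite eq0_natrE mulrBr mulr1.
rewrite sumrB.
have -> : \sum_(j < q) (g j).[x] * y ^+ j =
   \sum_(j < q) sigma *+ (nat_of_ord j == 0%N) * y ^+ j - \sum_(j < q) \sum_i
     a i * ('C(q.-1, j)%:R * ga i ^+ j) * (al i + x * be i) ^+ (q.-1 - j) * y ^+ j.
  rewrite -sumrB; apply: eq_bigr => j _.
  rewrite /g hornerD hornerN hornerC horner_sum mulrBl; congr (_ - _).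
  rewrite mulr_suml; apply: eq_bigr => i _.
  by rewrite hornerZ horner_exp hornerD hornerC hornerZ hornerX (mulrC x).
congr (_ - _).
  rewrite qS big_ord_recl /= expr0 mulr1 mulr1n [X in _ + X]big1 ?addr0 //.
  by move=> i _; rewrite mulr0n mul0r.
rewrite exchange_big /=; apply: eq_bigr => i _.
rewrite !dot_lin -/(al i) -/(be i) -/(ga i) exprDn mulr_sumr -qS.
apply: eq_bigr => j _; rewrite exprMn.
rewrite -mulr_natl; ring.
Qed.

Lemma columns_word x0 : (exists y, f x0 y != 0) ->
  (#|F| + #|[set x | [forall y, f x y == 0%R]]| <= #|[set y | f x0 y != 0%R]| + q.-1)%N.
Proof.
have q1 := card_gt1.
apply: (@column_nonzeros _ q.-1 g) => [||x y].
- by rewrite -/q; lia.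
- move=> j lej; rewrite (leq_trans (size_polyD _ _)) // size_polyN geq_max; apply/andP; split.
    by apply: leq_trans (size_polyC_leq1 _) _; lia.
  apply: leq_trans (size_sum _ _ _) _; apply/bigmax_leqP => i _.
  apply: leq_trans (size_scale_leq _ _) _.
  by apply: leq_trans (size_linear_exp _ _ _) _; lia.
- by rewrite gE prednK //; lia.
Qed.

(** A word of sum zero that vanishes at infinity has no part of degree [q - 1]; the degree drops to
    [q - 2], and the bound gains one. *)
Lemma columns_word0 x0 : sigma = 0 -> (forall y, D (h1 + y *: h2) = 0) ->
  (exists y, f x0 y != 0) ->
  (#|F| + #|[set x | [forall y, f x y == 0%R]]| <= #|[set y | f x0 y != 0%R]| + q.-2)%N.
Proof.
move=> s0 inf0; have q1 := card_gt1.
have top0 j : (j < q)%N -> top j = 0.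
  have : \poly_(j < q) top j = 0.
    apply: (@roots_geq_poly_eq0 _ _ (enum F)); last 1 first.
    - by rewrite -cardE size_poly.
    - apply/allP => y _; rewrite rootE horner_poly.
      have := inf0 y; rewrite /D.
      under eq_bigr => i _ do rewrite eq0_natrE mulrBr mulr1.
      rewrite sumrB s0 add0r => /eqP; rewrite oppr_eq0 => /eqP inf.
      apply/eqP; rewrite -[RHS]inf.
      under eq_bigr => k _ do rewrite mulr_suml.
      rewrite exchange_big; apply: eq_bigr => i _.
      rewrite !dot_lin -/(be i) -/(ga i) exprDn mulr_sumr.
      rewrite prednK ?(leq_trans _ q1) //; apply: eq_bigr => k _.
      rewrite exprMn -mulr_natl; ring.
    - exact: enum_uniq.
  by move=> /polyP/(_ j); rewrite coef_poly coef0 => + ltj; rewrite ltj.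
have szg j : (j < q)%N -> (size (g j) <= q.-1 - j)%N.
  move=> ltj; apply/leq_sizeP => k lek.
  rewrite /g s0 mul0rn polyC0 add0r coefN coef_sum.
  have cf i : (((al i)%:P + be i *: 'X) ^+ (q.-1 - j))`_k =
     be i ^+ (q.-1 - j) *+ (k == (q.-1 - j)%N) :> F.
    move: lek; move: (q.-1 - j)%N => n lek.
    rewrite exprDn coef_sum big_ord_recr /= big1 => [|l _].
      by rewrite add0r subnn binn mulr1n expr0 mul1r exprZn coefZ coefXn mulr_natr.
    rewrite coefMn exprZn -polyC_exp coefCM coefZ coefXn.
    by rewrite gtn_eqF ?mulr0 ?mul0rn // (leq_trans _ lek).
  under eq_bigr => i _ do rewrite coefZ cf.
  case: eqP => _; last by rewrite big1 ?oppr0 // => i _; rewrite mulr0n mulr0.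
  apply/eqP; rewrite oppr_eq0; apply/eqP; rewrite -[RHS](top0 _ ltj); apply: eq_bigr => i _.
  by rewrite mulr1n !mulrA.
apply: (@column_nonzeros _ q.-2 g) => [||x y].
- by rewrite -/q; lia.
- by move=> j lej; apply: leq_trans (szg _ _) _; lia.
- rewrite gE; have -> : q = q.-2.+2 by lia.
  rewrite big_ord_recr /= [X in _ + X](_ : _ = 0) ?addr0 //.
  have : (size (g q.-1) <= 0)%N by apply: leq_trans (szg _ _) _; lia.
  by rewrite leqn0 size_poly_eq0 (_ : q.-2.+1 = q.-1) ?prednK; [move=> /eqP ->; rewrite horner0 mul0r | lia..].
Qed.

End Columns.
End PlaneWord.

(** * Orthogonal vectors and frames *)

Lemma exists_orthogonal (F : fieldType) (n k : nat) (M : 'M[F]_(k, n)) :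
  (k < n)%N -> exists2 w : 'rV[F]_n, w != 0 & w *m M^T = 0.
Proof.
move=> ltkn; have : kermx M^T != 0.
  by rewrite -mxrank_eq0 mxrank_ker mxrank_tr; have := rank_leq_row M; lia.
case/rowV0Pn => w /sub_kermxP wM wn0; by exists w.
Qed.

Lemma exists_orthogonal2 (F : fieldType) (n : nat) (x y : 'rV[F]_n) :
  (2 < n)%N -> exists w : 'rV[F]_n, [/\ w != 0, dot w x = 0 & dot w y = 0].
Proof.
move=> /(@exists_orthogonal _ _ _ (col_mx x y)) [w wn0 E]; exists w.
have [Ex Ey] : w *m x^T = 0 /\ w *m y^T = 0.
  by apply: eq_row_mx; rewrite -mul_mx_row -tr_col_mx E row_mx0.
by split=> //; rewrite /dot ?Ex ?Ey mxE.
Qed.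

Lemma exists_notin_image (T S : finType) (f : T -> S) :
  (#|T| < #|S|)%N -> exists s, forall t, s != f t.
Proof.
move=> lt; case: (pickP [pred s | s \notin codom f]) => [s /= sn|h].
  by exists s => t; apply: contraNneq sn => ->; apply: codom_f.
have := leq_image_card f T; rewrite leqNgt => /negP[].
apply: leq_trans lt _; rewrite leq_eqVlt; apply/orP; left; apply/eqP.
by apply: eq_card => s; rewrite !inE; have := h s; rewrite /= => /negbFE ->.
Qed.

Lemma card_rV (F : finFieldType) n : #|{: 'rV[F]_n}| = (#|F| ^ n)%N.
Proof. by rewrite card_mx mul1n. Qed.

Lemma ltn_card_rV1 (F : finFieldType) n : (1 < n)%N -> (#|F| < #|{: 'rV[F]_n}|)%N.
Proof. by move=> n1; rewrite card_rV -{1}(expn1 #|F|) ltn_exp2l // card_gt1. Qed.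

Lemma ltn_card_rV2 (F : finFieldType) n :
  (2 < n)%N -> (#|{: F * F}| < #|{: 'rV[F]_n}|)%N.
Proof. by move=> n1; rewrite card_prod card_rV mulnn ltn_exp2l // card_gt1. Qed.

Section Frames.
Variables (F : finFieldType).
Implicit Types h : 'rV[F]_3.

Definition free2 n (h1 h2 : 'rV[F]_n) : bool :=
  [forall a, [forall b, (a *: h1 + b *: h2 == 0) ==> (a == 0) && (b == 0)]].

Lemma free2P n (h1 h2 : 'rV[F]_n) :
  reflect (forall a b, a *: h1 + b *: h2 = 0 -> a = 0 /\ b = 0) (free2 h1 h2).
Proof.
apply: (iffP forallP) => [H a b E|H a].
  by have /forallP/(_ b) := H a; rewrite E eqxx => /andP[/eqP-> /eqP->].
by apply/forallP => b; apply/implyP => /eqP /H[-> ->]; rewrite eqxx.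
Qed.

Definition free3 h1 h2 h3 := forall a b c, a *: h1 + b *: h2 + c *: h3 = 0 ->
  [/\ a = 0, b = 0 & c = 0].

Lemma exists_free2 h2 : h2 != 0 -> exists h1, free2 h1 h2.
Proof.
move=> n0; case: (@exists_notin_image F 'rV[F]_3 (fun a => a *: h2)) => [|h1 h].
  exact: ltn_card_rV1.
exists h1; apply/free2P => a b E.
have a0 : a = 0.
  apply/eqP; apply: contraT => an0; have /eqP[] := h (- (b / a)).
  apply: (scalerI an0); rewrite scalerA mulrN mulrC divfK // scaleNr.
  by apply/eqP; rewrite -addr_eq0 E.
move: E; rewrite a0 scale0r add0r => /eqP; rewrite scaler_eq0 (negPf n0) orbF.
by move=> /eqP.
Qed.

Lemma exists_free3 h1 h2 : free2 h1 h2 -> exists h3, free3 h1 h2 h3.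
Proof.
move=> /free2P f2.
case: (@exists_notin_image (F * F)%type 'rV[F]_3 (fun a => a.1 *: h1 + a.2 *: h2)) => [|h3 h].
  exact: ltn_card_rV2.
exists h3 => a b c E.
have c0 : c = 0.
  apply/eqP; apply: contraT => cn0; have /eqP[] := h (- (a / c), - (b / c)).
  apply: (scalerI cn0); rewrite scalerDr !scalerA !mulrN ![c * _]mulrC !divfK // !scaleNr.
  by apply/eqP; rewrite -opprD -addr_eq0 addrC E.
by move: E; rewrite c0 scale0r addr0 => /f2 [-> ->].
Qed.

Lemma free3_bij h1 h2 h3 : free3 h1 h2 h3 ->
  bijective (fun t : F * F * F => t.1.1 *: h1 + t.1.2 *: h2 + t.2 *: h3).
Proof.
move=> f; apply: inj_card_bij; last first.
  by rewrite !card_prod card_mx mul1n !expnS expn0 muln1 mulnA.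
move=> [[a b] c] [[a' b'] c'] /= E.
case: (f (a - a') (b - b') (c - c')) => [|/eqP + /eqP + /eqP].
  by rewrite !scalerBl [X in X + _]addrACA -opprD addrACA -opprD E subrr.
by rewrite !subr_eq0 => /eqP-> /eqP-> /eqP->.
Qed.

Lemma free3_coord h1 h2 h3 z : free3 h1 h2 h3 ->
  exists a b c, z = a *: h1 + b *: h2 + c *: h3.
Proof.
move=> /free3_bij [g _ gK]; case E : (g z) => [[a b] c]; exists a, b, c.
by rewrite -[LHS]gK E.
Qed.

End Frames.

Section PlaneWordTheory.
Variables (F : finFieldType) (I : finType) (a : I -> F) (w : I -> 'rV[F]_3).
Let q := #|F|.
Local Notation D := (plane_word a w).
Local Notation sigma := (\sum_i a i).
Implicit Types h z : 'rV[F]_3.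

Definition supp := [set z | (z != 0) && (D z != 0)].

Lemma plane_wordZ (l : F) z : l != 0 -> D (l *: z) = D z.
Proof.
move=> ln0; apply: eq_bigr => i _.
by rewrite dotZr mulf_eq0 (negPf ln0).
Qed.

Lemma sum_cst (t : F) : \sum_(y : F) t = 0.
Proof.
rewrite sumr_const -[t]mulr1 -mulrnAr.
have -> : 1 *+ #|F| = 0 :> F by exact: card_natr0.
by rewrite mulr0.
Qed.

(** The line [w] meets another line in one point or in all [q + 1], and [q + 1 = 1] in [F]. The
    summand [c == 0] is the point at infinity. *)
Lemma line_sum1 (b c : F) :
  \sum_y ((b + y * c == 0)%:R : F) + (c == 0)%:R = 1.
Proof.
case: (eqVneq c 0) => [->|cn0].
  rewrite (eq_bigr (fun _ => (b == 0)%:R)) => [|y _]; last by rewrite mulr0 addr0.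
  by rewrite sum_cst add0r.
rewrite addr0 (bigD1 (- (b / c))) //= mulNr divfK // subrr eqxx big1 ?addr0 // => y yn.
case: eqP => // E; case/eqP: yn; apply: (mulIf cn0).
by rewrite mulNr divfK //; apply/eqP; rewrite -addr_eq0 addrC E.
Qed.

Lemma plane_line_sum h1 h2 : \sum_y D (h1 + y *: h2) + D h2 = sigma.
Proof.
rewrite exchange_big -big_split /=; apply: eq_bigr => i _.
rewrite -mulr_sumr -mulrDr -[RHS]mulr1; congr (_ * _).
rewrite -[RHS](line_sum1 (dot (w i) h1) (dot (w i) h2)); congr (_ + _).
by apply: eq_bigr => y _; rewrite !dot_lin.
Qed.

Definition column_weight h1 h2 h3 x := #|[set y | D (h3 + x *: h1 + y *: h2) != 0]|.
(** The projective weight from normalized representatives: affine points by columns, then the points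
    at infinity, with [h2] last. *)
Definition frame_weight h1 h2 h3 :=
  (\sum_x column_weight h1 h2 h3 x + #|[set y | D (h1 + y *: h2) != 0%R]| + (D h2 != 0%R))%N.

Let G z : nat := (z != 0) && (D z != 0).
Let GZ l z : l != 0 -> G (l *: z) = G z.
Proof. by move=> ln0; rewrite /G plane_wordZ // scaler_eq0 (negPf ln0). Qed.

Lemma sum_nz (f : F -> nat) (c : nat) : (forall x, x != 0 -> f x = c) ->
  (\sum_x f x = (q - 1) * c + f 0%R)%N.
Proof.
move=> H; rewrite (bigD1 0) //= addnC; congr (_ + _)%N.
rewrite (eq_bigr (fun _ => c)); last by move=> i /H.
by rewrite sum_nat_const; congr (_ * _)%N; rewrite cardC1 subn1.
Qed.

Lemma card_supp_frame h1 h2 h3 : free3 h1 h2 h3 ->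
  #|supp| = ((q - 1) * frame_weight h1 h2 h3)%N.
Proof.
move=> f3; have bij := free3_bij f3.
have n0 x y c : ((x, y, c) != 0 :> (F * F * F)) -> x *: h1 + y *: h2 + c *: h3 != 0.
  by move=> t0; apply: contra_neq t0 => /f3 [-> -> ->].
rewrite -sum1_card big_mkcond /=.
rewrite (eq_bigr G) => [|z _]; last by rewrite /G inE; case: ifP.
rewrite (reindex _ (onW_bij _ bij)) /=.
rewrite -(pair_bigA _ (fun p c => G (p.1 *: h1 + p.2 *: h2 + c *: h3))) exchange_big /=.
rewrite (@sum_nz _ (\sum_x column_weight h1 h2 h3 x)) => [|c cn0]; last first.
  rewrite -(pair_bigA _ (fun x y => G (x *: h1 + y *: h2 + c *: h3))) /=.
  rewrite (reindex_inj (mulfI cn0)) /=; apply: eq_bigr => x _.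
  rewrite (reindex_inj (mulfI cn0)) /= /column_weight -sum1_card [RHS]big_mkcond /=.
  apply: eq_bigr => y _; rewrite -!scalerA -!scalerDr GZ // /G inE.
  rewrite addrC addrA; case: (D _ != 0); rewrite ?andbF ?andbT //.
  have := n0 x y 1; rewrite scale1r [_ + h3]addrC addrA => -> //.
  by apply/eqP => -[_ _ /eqP]; rewrite oner_eq0.
rewrite /frame_weight -addnA mulnDr; congr (_ + _)%N.
rewrite -(pair_bigA _ (fun x y => G (x *: h1 + y *: h2 + 0 *: h3))) /=.
rewrite (@sum_nz _ #|[set y | D (h1 + y *: h2) != 0]|) => [|x xn0]; last first.
  rewrite (reindex_inj (mulfI xn0)) /= -sum1_card [RHS]big_mkcond /=.
  apply: eq_bigr => y _; rewrite scale0r addr0 -scalerA -scalerDr GZ // /G inE.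
  case: (D _ != 0); rewrite ?andbF ?andbT //.
  have := n0 1 y 0; rewrite scale1r scale0r addr0 => -> //.
  by apply/eqP => -[/eqP]; rewrite oner_eq0.
rewrite mulnDr; congr (_ + _)%N.
rewrite (@sum_nz _ (D h2 != 0)%R) => [|y yn0].
  by rewrite !scale0r !addr0 /G eqxx addn0.
rewrite !scale0r addr0 add0r GZ // /G.
have := n0 0 1 0; rewrite scale1r !scale0r add0r addr0 => -> //.
by apply/eqP => -[/eqP]; rewrite oner_eq0.
Qed.

(** The values on a line add up to [sigma = 0], which a single nonzero value cannot do. *)
Lemma two_on_line h1 h2 : sigma = 0 ->
  (exists y, D (h1 + y *: h2) != 0) \/ D h2 != 0 ->
  (2 <= #|[set y | D (h1 + y *: h2) != 0%R]| + (D h2 != 0%R))%N.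
Proof.
move=> s0 ne; have := plane_line_sum h1 h2; rewrite s0 => E.
case: (eqVneq (D h2) 0) => [D2|D2] /=; last first.
  rewrite addn1 ltnS card_gt0; apply/set0Pn; apply/existsP; apply: contraNT D2.
  rewrite negb_exists => /forallP H; move: E; rewrite big1 ?add0r => [->//|y _].
  by have := H y; rewrite inE negbK => /eqP.
move: E; rewrite D2 addr0 addn0 => E; case: ne => [[y0 Dy0]|]; last by rewrite D2 eqxx.
rewrite (cardsD1 y0) inE Dy0 add1n ltnS card_gt0; apply/set0Pn; apply/existsP.
apply: contraNT Dy0; rewrite negb_exists => /forallP H.
move: E; rewrite (bigD1 y0) //= big1 ?addr0 => [->//|y yn].
by have := H y; rewrite !inE yn /= negbK => /eqP.
Qed.

End PlaneWordTheory.

(** * Small weights in the plane code *)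

Section PlaneWordWeights.
Variables (F : finFieldType) (I : finType) (a : I -> F) (w : I -> 'rV[F]_3).
Let q := #|F|.
Local Notation D := (plane_word a w).
Local Notation sigma := (\sum_i a i).
Local Notation supp := (supp a w).
Local Notation column_weight := (column_weight a w).
Implicit Types h z : 'rV[F]_3.

Definition zero_cols h1 h2 h3 :=
  [set x | [forall y, D (h3 + x *: h1 + y *: h2) == 0]].

Lemma zero_colsN h1 h2 h3 x :
  x \notin zero_cols h1 h2 h3 -> exists y, D (h3 + x *: h1 + y *: h2) != 0.
Proof. by rewrite inE negb_forall => /existsP. Qed.

Lemma sum_col_ge h1 h2 h3 c :
  (forall x, x \notin zero_cols h1 h2 h3 -> (c <= column_weight h1 h2 h3 x)%N) ->
  ((q - #|zero_cols h1 h2 h3|) * c <= \sum_x column_weight h1 h2 h3 x)%N.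
Proof.
move=> H; set Z := zero_cols _ _ _.
rewrite (bigID [pred x | x \in Z]) /=; apply: leq_trans (leq_addl _ _).
have -> : ((q - #|Z|) * c = \sum_(x | x \notin Z) c)%N.
  rewrite sum_nat_const; congr (_ * _)%N.
  have E : (#|Z| + #|[pred x | x \notin Z]| = q)%N := cardC (mem Z).
  by rewrite -E addKn.
by apply: leq_sum => x /H.
Qed.

Lemma card_zero_cols h1 h2 h3 : (#|zero_cols h1 h2 h3| <= q)%N.
Proof. exact: max_card. Qed.

Lemma column_weight_le h1 h2 h3 x : (column_weight h1 h2 h3 x <= q)%N.
Proof. exact: max_card. Qed.

(** If the word vanishes on a line, that line is put at infinity: [k] vanishing columns leave
    [q - k] columns of weight at least [k + 2]. Otherwise each of the [q + 1] lines through a zero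
    has two points of the support; if there is no zero, the support is the whole plane. *)
Lemma card_supp_sum0 z : sigma = 0 -> z != 0 -> D z != 0 ->
  ((q - 1) * (2 * q) <= #|supp|)%N.
Proof.
move=> s0 zn0 Dz; have q1 : (1 < q)%N := card_gt1 F.
case: (boolP [exists h1, [exists h2, [&& free2 h1 h2, D h2 == 0
  & [forall y, D (h1 + y *: h2) == 0]]]]) => [|noline].
  case/existsP => h1 /existsP[h2 /and3P[f2 /eqP D2 /forallP D1]].
  have {}D1 y : D (h1 + y *: h2) = 0 by apply/eqP/D1.
  have [h3 f3] := exists_free3 f2; rewrite (card_supp_frame _ _ f3).
  rewrite leq_mul2l; apply/orP; right.
  apply: leq_trans (leq_addr _ _); apply: leq_trans (leq_addr _ _).
  set Z := zero_cols h1 h2 h3.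
  have colZ x : x \notin Z -> (#|Z| + 2 <= column_weight h1 h2 h3 x)%N.
    move=> /zero_colsN /(columns_word0 s0 D1).
    rewrite -[#|[set x | _]|]/#|Z| -[#|[set y | _]|]/(column_weight h1 h2 h3 x) -/q; lia.
  have [x xZ] : exists x, x \notin Z.
    have [b1 [b2 [b3 zE]]] := free3_coord z f3.
    have b3n0 : b3 != 0.
      apply: contraNneq Dz => b30; move: zn0; rewrite zE b30 scale0r addr0 => zn0.
      case: (eqVneq b1 0) zn0 => [->|b1n0 _]; last first.
        rewrite (_ : _ + _ = b1 *: (h1 + (b2 / b1) *: h2)) ?plane_wordZ ?D1 //.
        by rewrite scalerDr scalerA mulrC divfK.
      rewrite scale0r add0r scaler_eq0 negb_or => /andP[b2n0 _].
      by rewrite plane_wordZ // D2.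
    exists (b1 / b3); rewrite inE negb_forall; apply/existsP; exists (b2 / b3).
    apply: contraNneq Dz => D0; rewrite zE.
    rewrite (_ : _ + _ = b3 *: (h3 + (b1 / b3) *: h1 + (b2 / b3) *: h2)) ?plane_wordZ ?D0 //.
    by rewrite !scalerDr !scalerA ![b3 * _]mulrC !divfK // addrC addrA.
  (* A column has at most [q] points, hence [k + 2 <= q], and then
     [(q - k)(k + 2) = 2 q + k (q - 2 - k)] is at least [2 q]. *)
  apply: leq_trans (sum_col_ge colZ); have := colZ _ xZ; have := column_weight_le h1 h2 h3 x.
  rewrite -/Z; move: #|Z| => k h1' h2'; have {h1' h2'} : (k + 2 <= q)%N by lia.
  move: q => n; nia.
have two h1 h2 : free2 h1 h2 ->
    (2 <= #|[set y | D (h1 + y *: h2) != 0%R]| + (D h2 != 0%R))%N.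
  move=> f2; apply: two_on_line => //.
  move: noline; rewrite negb_exists => /forallP/(_ h1).
  rewrite negb_exists => /forallP/(_ h2); rewrite f2 /= negb_and => /orP[-> | +]; first by right.
  by rewrite negb_forall => /existsP; left.
case: (boolP [exists z, (z != 0) && (D z == 0)]) => [/existsP[h2 /andP[h2n0 /eqP D2]]|alln].
  have [h1 f2] := exists_free2 h2n0; have [h3 f3] := exists_free3 f2.
  rewrite (card_supp_frame _ _ f3) leq_mul2l; apply/orP; right.
  rewrite /frame_weight D2 eqxx addn0.
  have t1 := two _ _ f2; rewrite D2 eqxx addn0 in t1.
  have t2 x : (2 <= column_weight h1 h2 h3 x)%N.
    have := two (h3 + x *: h1) h2; rewrite D2 eqxx addn0; apply.
    apply/free2P => b c E; case: (f3 (b * x) c b) => [|_ -> ->] //.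
    by rewrite -[RHS]E scalerDr scalerA -[RHS]addrA [RHS]addrC.
  have : (\sum_(x : F) 2 <= \sum_x column_weight h1 h2 h3 x)%N by apply: leq_sum.
  rewrite sum_nat_const (_ : #|_| = q)%N; [lia | exact: eq_card].
have -> : supp = [set~ 0].
  apply/setP => h; rewrite !inE; case: (eqVneq h 0) => //= hn0.
  by move: alln; rewrite negb_exists => /forallP/(_ h); rewrite hn0.
have := cardsC1 (0 : 'rV[F]_3); rewrite card_rV -/q => ->.
move: q1; move: q => n; rewrite !expnS expn0; nia.
Qed.

(* A projective point of the support on two tangent lines, [<h1, h2>] and
   [<h2, h3>]: the vanishing column of the second one makes the bound of
   [columns_word] quadratic. *)
Lemma two_tangents h1 h2 h3 : sigma = 1 -> free3 h1 h2 h3 ->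
  (frame_weight a w h1 h2 h3 < 2 * q - 1)%N -> D h2 != 0 ->
  (forall y, D (h1 + y *: h2) = 0) -> (forall y, D (h3 + y *: h2) = 0) ->
  exists2 u, u != 0 & forall z, z != 0 -> D z = (dot u z == 0)%:R.
Proof.
move=> s1 f3 wt D2 D1 D3; have q1 : (1 < q)%N := card_gt1 F.
set Z := zero_cols h1 h2 h3.
have Z0 : 0 \in Z.
  by rewrite inE; apply/forallP => y; rewrite scale0r addr0 D3.
have k1 : (0 < #|Z|)%N by rewrite (cardsD1 0) Z0.
have kq := card_zero_cols h1 h2 h3; rewrite -/Z in kq.
have colZ x : x \notin Z -> (#|Z|.+1 <= column_weight h1 h2 h3 x)%N.
  move=> /zero_colsN /(columns_word).
  rewrite -[#|[set x | _]|]/#|Z| -[#|[set y | _]|]/(column_weight h1 h2 h3 x) -/q; lia.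
have := sum_col_ge colZ; rewrite -/Z.
move: wt; rewrite /frame_weight D2 => wt le.
(* For [1 <= k <= q - 2] the product [(q - k)(k + 1)] is at least [2 q - 2]; so at most one column
   is nonzero. *)
have kge : (q - 1 <= #|Z|)%N.
  have {wt} : ((q - #|Z|) * #|Z|.+1 < 2 * q - 2)%N.
    apply: leq_ltn_trans le _; move: wt; move: (\sum_x _)%N #|_| => m1 m2; lia.
  case: (ltnP #|Z| (q - 1)) => // lt; rewrite ltnNge => /negP[].
  move: #|Z| k1 lt => k; move: q q1 => n; nia.
have Dcol x y : x \in Z -> D (h3 + x *: h1 + y *: h2) = 0.
  by rewrite inE => /forallP/(_ y)/eqP.
have D1' : D h1 = 0 by have := D1 0; rewrite scale0r addr0.
(* The values on the line [<h3, h1>] add up to one, so some column is nonzero. *)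
have [x1 x1Z] : exists x, x \notin Z.
  apply/existsP; rewrite -negb_forall; apply/negP => /forallP allZ.
  have := plane_line_sum a w h3 h1; rewrite D1' addr0 s1 big1 => [/esym/eqP|x _].
    by rewrite oner_eq0.
  by have := Dcol x 0 (allZ x); rewrite scale0r addr0.
have x1n0 : x1 != 0 by apply: contraNneq x1Z => ->.
have ZE x : (x \in Z) = (x != x1).
  have /eqP E : [set x1] == ~: Z.
    have E : (#|Z| + #|~: Z| = q)%N := cardsC Z.
    rewrite eqEcard cards1 sub1set in_setC x1Z /=.
    have -> : (#|~: Z| = q - #|Z|)%N by rewrite -E addKn.
    by rewrite leq_subLR addn1 -ltnS; move: kge; lia.
  by have /setP/(_ x) := E; rewrite in_set1 in_setC => /(congr1 negb); rewrite negbK => <-.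
(* On the line joining this point to [h1], every other point is [h1] or lies in a vanishing column,
   so the one remaining value is [sigma]. *)
have Dx1 y : D (h3 + x1 *: h1 + y *: h2) = 1.
  set z := h3 + _ + _; have := plane_line_sum a w h1 z.
  rewrite s1 big1 ?add0r // => t _.
  case: (eqVneq t 0) => [->|tn0]; first by rewrite scale0r addr0.
  have -> : h1 + t *: z = t *: (h3 + (x1 + t^-1) *: h1 + y *: h2).
    have -> : h3 + (x1 + t^-1) *: h1 + y *: h2 = z + t^-1 *: h1.
      by rewrite /z scalerDl addrA [LHS]addrAC.
    by rewrite [RHS]scalerDr scalerA divff // scale1r addrC.
  rewrite plane_wordZ // Dcol // ZE -subr_eq0 addrAC subrr add0r invr_eq0 //.
have Dh2 : D h2 = 1.
  by have := plane_line_sum a w h1 h2; rewrite s1 big1 ?add0r // => y _.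
(* The support is the line [<h2, h3 + x1 h1>], and [u] is its equation. *)
have [u [un0 u2 u3]] := exists_orthogonal2 h2 (h3 + x1 *: h1) (isT : 2 < 3)%N.
have u3' : dot u h3 = - x1 * dot u h1.
  by move: u3; rewrite !dot_lin => /eqP; rewrite addr_eq0 mulNr => /eqP.
have u1 : dot u h1 != 0.
  apply: contra_neq un0 => u1.
  apply: dot_eq0_all => z; have [b1 [b2 [b3 ->]]] := free3_coord z f3.
  by rewrite !dot_lin u3' u2 u1 !mulr0 !addr0.
exists u => // z zn0; have [b1 [b2 [b3 zE]]] := free3_coord z f3.
have -> : dot u z = (b1 - b3 * x1) * dot u h1.
  by rewrite zE !dot_lin u3' u2; ring.
rewrite mulf_eq0 (negPf u1) orbF subr_eq0.
case: (eqVneq b3 0) => [b30|b3n0]; last first.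
  have -> : z = b3 *: (h3 + (b1 / b3) *: h1 + (b2 / b3) *: h2).
    by rewrite !scalerDr !scalerA ![b3 * _]mulrC !divfK // zE addrC addrA.
  rewrite plane_wordZ // -[b1 == _](inj_eq (mulIf (invr_neq0 b3n0))) mulrAC divff // mul1r.
  by case: eqVneq => [->|ne]; rewrite ?Dx1 // Dcol // ZE.
rewrite b30 mul0r; move: zn0; rewrite zE b30 scale0r addr0.
case: (eqVneq b1 0) => [->|b1n0 _].
  rewrite scale0r add0r scaler_eq0 negb_or => /andP[b2n0 _].
  by rewrite plane_wordZ.
rewrite (_ : _ + _ = b1 *: (h1 + (b2 / b1) *: h2)) ?plane_wordZ ?D1 //.
by rewrite scalerDr scalerA mulrC divfK.
Qed.

End PlaneWordWeights.

Lemma card_pairs (S T : finType) (A : {set S * T}) :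
  (#|A| = \sum_x #|[set y | (x, y) \in A]|)%N.
Proof.
rewrite -sum1_card big_mkcond /= (eq_bigr (fun t => ((t.1, t.2) \in A : nat))); last first.
  by move=> [x y] _; case: ifP.
rewrite -(pair_bigA _ (fun x y => ((x, y) \in A : nat))) /=; apply: eq_bigr => x _.
by rewrite -sum1_card [RHS]big_mkcond /=; apply: eq_bigr => y _; rewrite inE; case: ifP.
Qed.

Ltac row_ring := apply/rowP => ?; rewrite !mxE; ring.
Ltac row_field := apply/rowP => ?; rewrite !mxE; field.

Section PlaneWordDichotomy.
Variables (F : finFieldType) (I : finType) (a : I -> F) (w : I -> 'rV[F]_3).
Let q := #|F|.
Local Notation D := (plane_word a w).
Local Notation sigma := (\sum_i a i).
Local Notation supp := (supp a w).
Implicit Types h g v z : 'rV[F]_3.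

Lemma card1_uniq (f : F -> F) : (#|[set y | f y != 0%R]| <= 1)%N ->
  forall y y', f y != 0 -> f y' != 0 -> y = y'.
Proof. by move=> /card_le1_eqP H y y' fy fy'; apply: H; rewrite inE. Qed.

(** The same tangent parametrized from its touching point, as [two_tangents] expects it. *)
Lemma tangent_flip g h y0 : D g = 0 ->
  (#|[set y | D (h + y *: g) != 0%R]| <= 1)%N -> D (h + y0 *: g) != 0 ->
  forall t, D (g + t *: (h + y0 *: g)) = 0.
Proof.
move=> Dg /card1_uniq H D0 t; case: (eqVneq t 0) => [->|tn0].
  by rewrite scale0r addr0.
have -> : g + t *: (h + y0 *: g) = t *: (h + (y0 + t^-1) *: g).
  by row_field.
rewrite plane_wordZ //; apply/eqP/negPn/negP => /(H _ _ D0)/eqP.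
by rewrite addrC -subr_eq subrr eq_sym invr_eq0 (negPf tn0).
Qed.

Lemma card_line_ge1 h g : sigma = 1 -> D g = 0 ->
  (1 <= #|[set y | D (h + y *: g) != 0%R]|)%N.
Proof.
move=> s1 Dg; rewrite card_gt0; apply/negP => /eqP/setP E.
have := plane_line_sum a w h g; rewrite s1 Dg addr0 big1 => [/esym/eqP|y _].
  by rewrite oner_eq0.
by have := E y; rewrite !inE => /negbFE/eqP.
Qed.

(* If every point of the support were on one tangent only, the at least [3 q]
   affine tangents would touch at distinct points, which are fewer than [2 q]. *)
Lemma card_supp_dichotomy : sigma = 1 -> (#|supp| < (q - 1) * (2 * q - 1))%N ->
  exists2 u, u != 0 & forall z, z != 0 -> D z = (dot u z == 0)%:R.
Proof.
move=> s1 wt; have q1 : (1 < q)%N := card_gt1 F.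
have fw h1 h2 h3 : free3 h1 h2 h3 -> (frame_weight a w h1 h2 h3 < 2 * q - 1)%N.
  move=> f3; move: wt; rewrite (card_supp_frame _ _ f3) ltn_mul2l => /andP[_] //.
have [h2 h2n0 D2] : exists2 z, z != 0 & D z = 0.
  case: (pickP [pred z | (z != 0) && (D z == 0)]) => [z /andP[z0 /eqP Dz]|alln]; first by exists z.
  move: wt; have -> : supp = [set~ 0].
    apply/setP => h; rewrite !inE; case: (eqVneq h 0) => //= hn0.
    by have /= := alln h; rewrite hn0 /= => ->.
  have := cardsC1 (0 : 'rV[F]_3); rewrite card_rV -/q => ->.
  move: q1; move: (q) => n; rewrite !expnS expn0; nia.
(* If all lines through the zero [h2] had two points of the support, the weight would be at least
   [2 q]. So one of them is a tangent, and [g2] is its touching point. *)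
have [g2 [g1 [Dg2 Dg1 f2]]] : exists g2 g1, [/\ D g2 != 0, forall y, D (g1 + y *: g2) = 0 & free2 g1 g2].
  have [h1 f2] := exists_free2 h2n0; have [h3 f3] := exists_free3 f2.
  have [h [fh ch]] : exists h, free2 h h2 /\ (#|[set y | D (h + y *: h2) != 0%R]| <= 1)%N.
    case: (leqP #|[set y | D (h1 + y *: h2) != 0%R]| 1) => [le1|gt1]; first by exists h1.
    case: (pickP [pred x | (column_weight a w h1 h2 h3 x <= 1)%N]) => [x /= cx|all2].
      exists (h3 + x *: h1); split=> //; apply/free2P => b c E.
      case: (f3 (b * x) c b) => [|_ -> ->] //.
      by rewrite -[RHS]E scalerDr scalerA -[RHS]addrA [RHS]addrC.
    have := fw _ _ _ f3; rewrite /frame_weight D2 eqxx addn0.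
    have : (\sum_(x : F) 2 <= \sum_x column_weight a w h1 h2 h3 x)%N.
      by apply: leq_sum => x _; have /= := all2 x; rewrite leqNgt => /negbFE.
    rewrite sum_nat_const (_ : #|_| = q)%N; [lia | exact: eq_card].
  have := card_line_ge1 h s1 D2; rewrite card_gt0 => /set0Pn[y0]; rewrite inE => Dy0.
  exists (h + y0 *: h2), h2; split=> //; first exact: tangent_flip.
  apply/free2P => b c E.
  have /free2P/(_ c (b + c * y0)) := fh; case => [|c0]; last by rewrite c0 mul0r addr0.
  by rewrite -[RHS]E; row_ring.
have [g3 f3] := exists_free3 f2.
(* A vanishing column through [g2] is a second tangent at [g2]. *)
case: (pickP [pred x | x \in zero_cols a w g1 g2 g3]) => [x /=|Z0].
  rewrite inE => /forallP Zx; set g3' := g3 + x *: g1.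
  have f3' : free3 g1 g2 g3'.
    move=> b c d E; case: (f3 (b + d * x) c d) => [|+ -> d0].
      by rewrite -[RHS]E /g3'; row_ring.
    by rewrite d0 mul0r addr0 => ->.
  apply: (two_tangents s1 f3' (fw _ _ _ f3') Dg2 Dg1) => y.
  exact/eqP.
pose n y b := #|[set x | D (g3 + b *: g2 + x *: (g1 + y *: g2)) != 0]|.
have n1 y b : (1 <= n y b)%N by apply: card_line_ge1.
pose P := [set t : F * F | n t.1 t.2 == 1]%N.
(* Each of the [q] affine lines through the zero [g1 + y g2] at infinity has a point of the support.
   Together they have fewer than [2 q - 2], as [g2] is also in the support; so at least three have
   exactly one. *)
have cP y : (3 <= #|[set b | n y b == 1%N]|)%N.
  have f3' : free3 g2 (g1 + y *: g2) g3.
    move=> b c d E; case: (f3 c (b + c * y) d) => [|-> + ->].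
      by rewrite -[RHS]E; row_ring.
    by rewrite mul0r addr0 => ->.
  have := fw _ _ _ f3'; rewrite /frame_weight Dg1 eqxx addn0.
  have : (1 <= #|[set t | D (g2 + t *: (g1 + y *: g2)) != 0%R]|)%N.
    by rewrite card_gt0; apply/set0Pn; exists 0; rewrite inE scale0r addr0.
  have : (2 * q <= \sum_b column_weight a w g2 (g1 + y *: g2) g3 b + #|[set b | n y b == 1%N]|)%N.
    rewrite -sum1_card [X in (_ + X)%N]big_mkcond -big_split /=.
    have -> : (2 * q = \sum_(b : F) 2)%N by rewrite sum_nat_const (_ : #|_| = q)%N; [lia | exact: eq_card].
    apply: leq_sum => b _; rewrite inE; have := n1 y b; rewrite /n /column_weight.
    by case: eqP => [->|] //; lia.
  move: (\sum_b _)%N #|_| #|_| => m1 m2 m3; lia.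
pose A := [set t : F * F | D (g3 + t.1 *: g1 + t.2 *: g2) != 0].
have cA : (#|A| < 2 * q - 2)%N.
  have := fw _ _ _ f3; rewrite /frame_weight Dg2.
  suff -> : (\sum_x column_weight a w g1 g2 g3 x = #|A|)%N by lia.
  rewrite card_pairs; apply: eq_bigr => x _; apply: eq_card => y.
  by rewrite !inE.
have cPq : (3 * q <= #|P|)%N.
  rewrite card_pairs.
  have -> : (3 * q = \sum_(b : F) 3)%N by rewrite sum_nat_const (_ : #|_| = q)%N; [lia | exact: eq_card].
  apply: leq_sum => y _; apply: leq_trans (cP y) _.
  by rewrite leq_eqVlt; apply/orP; left; apply/eqP/eq_card => b; rewrite !inE.
(* A support point on the line [t], the touching point if [t] is a tangent; the default is never
   taken, since [n] is positive. *)
pose x0 (t : F * F) := odflt 0 [pick x | D (g3 + t.2 *: g2 + x *: (g1 + t.1 *: g2)) != 0].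
pose f (t : F * F) := (x0 t, t.2 + x0 t * t.1).
have fE t : g3 + (f t).1 *: g1 + (f t).2 *: g2 = g3 + t.2 *: g2 + x0 t *: (g1 + t.1 *: g2).
  by rewrite /f /=; row_ring.
have Df t : D (g3 + t.2 *: g2 + x0 t *: (g1 + t.1 *: g2)) != 0.
  rewrite /x0; case: pickP => //= all0; have := n1 t.1 t.2; rewrite card_gt0 => /set0Pn[x].
  by rewrite inE => Dx; have := all0 x; rewrite /= Dx.
have ninj : ~~ dinjectiveb f (mem P).
  apply/negP => /dinjectiveP inj.
  have E : #|f @: P| = #|P| := card_in_imset inj.
  have : f @: P \subset A.
    by apply/subsetP => _ /imsetP[t _ ->]; rewrite inE fE.
  move=> /subset_leq_card => L.
  have := leq_ltn_trans (leq_trans (leq_trans cPq (eq_leq (esym E))) L) cA; lia.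
have /dinjectivePn[t tP [t' /andP[tt' t'P] ft]] := ninj.
(* Parallel tangents through a common affine point coincide. *)
have yy' : t.1 != t'.1.
  apply: contraNneq tt' => y_eq; move: ft; rewrite /f => -[-> ]; rewrite y_eq => /addIr b_eq.
  by apply/eqP; case: t' {t'P} y_eq b_eq => y b /= y_eq b_eq; case: t {tP} y_eq b_eq => y' b' /= -> ->.
set p := g3 + t.2 *: g2 + x0 t *: (g1 + t.1 *: g2).
have pE' : p = g3 + t'.2 *: g2 + x0 t' *: (g1 + t'.1 *: g2) by rewrite -fE -ft fE.
have T1 := @tangent_flip (g1 + t.1 *: g2) (g3 + t.2 *: g2) (x0 t) (Dg1 _) _ (Df t).
have T2 := @tangent_flip (g1 + t'.1 *: g2) (g3 + t'.2 *: g2) (x0 t') (Dg1 _) _ (Df t').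
rewrite -/p in T1; rewrite -pE' in T2.
have f3' : free3 (g1 + t.1 *: g2) p (g1 + t'.1 *: g2).
  move=> b c d E.
  have := f3 (b + c * (f t).1 + d) (b * t.1 + c * (f t).2 + d * t'.1) c.
  case=> [|E1 E2 c0].
    by rewrite -[RHS]E /p -fE; row_ring.
  move: E1 E2; rewrite c0 !mul0r !addr0 => E1 E2.
  have : b * (t.1 - t'.1) = 0.
    rewrite mulrBr -E2; have -> : d = - b by apply/eqP; rewrite -addr_eq0 addrC E1.
    ring.
  move/eqP; rewrite mulf_eq0 subr_eq0 (negPf yy') orbF => /eqP b0.
  by move: E1; rewrite b0 add0r.
apply: (two_tangents s1 f3' (fw _ _ _ f3') (Df t)) => [y|y].
  by apply: T1; move: tP; rewrite inE => /eqP E; rewrite -[leqLHS]/(n t.1 t.2) E.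
by apply: T2; move: t'P; rewrite inE => /eqP E; rewrite -[leqLHS]/(n t'.1 t'.2) E.
Qed.

End PlaneWordDichotomy.

(** * Lines and duality *)

Section OrthogonalCounts.
Variables (F : finFieldType) (n : nat).
Implicit Types u v w x : 'rV[F]_n.

Lemma card_kernel k (M : 'M[F]_(n, k)) :
  #|[set x : 'rV_n | x *m M == 0]| = (#|F| ^ (n - \rank M))%N.
Proof.
rewrite -mxrank_ker -card_rowg; apply: eq_card => x; rewrite inE in_set.
by apply/eqP/sub_kermxP.
Qed.

Lemma mulmx_tr_eq0 x u : (x *m u^T == 0) = (dot x u == 0).
Proof.
apply/eqP/eqP => [E|E]; first by rewrite /dot E mxE.
by apply/matrixP => i j; rewrite !ord1 [RHS]mxE.
Qed.

Lemma card_orthogonal1 u : u != 0 ->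
  #|[set x : 'rV_n | dot x u == 0]| = (#|F| ^ n.-1)%N.
Proof.
move=> un0; have <- : (n - \rank u^T)%N = n.-1 by rewrite mxrank_tr rank_rV un0 subn1.
by rewrite -card_kernel; apply: eq_card => x; rewrite !inE mulmx_tr_eq0.
Qed.

Lemma rank_ker0 k (M : 'M[F]_(k, n)) :
  (forall w : 'rV_k, w *m M = 0 -> w = 0) -> \rank M = k.
Proof.
move=> H; apply/eqP; rewrite -[_ == _]/(row_free M) -kermx_eq0.
by apply/rowV0P => w /sub_kermxP /H.
Qed.

Lemma card_orthogonal2 u v : free2 u v ->
  #|[set x : 'rV_n | (dot x u == 0) && (dot x v == 0)]| = (#|F| ^ (n - 2))%N.
Proof.
move=> /free2P f2; have <- : \rank (col_mx u v)^T = 2%N.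
  rewrite mxrank_tr; apply: rank_ker0 => w; rewrite -[w]hsubmxK mul_row_col => E.
  have [|E1 E2] := f2 (lsubmx w 0 0) (rsubmx w 0 0).
    by rewrite -!mul_scalar_mx -!mx11_scalar.
  by rewrite [lsubmx w]mx11_scalar [rsubmx w]mx11_scalar E1 E2 raddf0 row_mx0.
rewrite -card_kernel; apply: eq_card => x; rewrite !inE.
by rewrite tr_col_mx mul_mx_row row_mx_eq0 !mulmx_tr_eq0.
Qed.

Lemma card_orthogonal3 u v t :
  (forall a b c, a *: u + b *: v + c *: t = 0 -> [/\ a = 0, b = 0 & c = 0]) ->
  #|[set x : 'rV_n | [&& dot x u == 0, dot x v == 0 & dot x t == 0]]| = (#|F| ^ (n - 3))%N.
Proof.
move=> f3; have <- : \rank (col_mx (col_mx u v) t)^T = 3%N.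
  rewrite mxrank_tr; apply: rank_ker0 => w.
  rewrite -[w]hsubmxK mul_row_col -[lsubmx w]hsubmxK mul_row_col => E.
  have [|E1 E2 E3] := f3 (lsubmx (lsubmx w) 0 0) (rsubmx (lsubmx w) 0 0) (rsubmx w 0 0).
    by rewrite -!mul_scalar_mx -!mx11_scalar.
  rewrite [lsubmx (lsubmx w)]mx11_scalar [rsubmx (lsubmx w)]mx11_scalar [rsubmx w]mx11_scalar.
  by rewrite E1 E2 E3 raddf0 !row_mx0.
rewrite -card_kernel; apply: eq_card => x; rewrite !inE.
by rewrite !tr_col_mx !mul_mx_row !row_mx_eq0 !mulmx_tr_eq0 andbA.
Qed.

End OrthogonalCounts.

Section Lines.
Variable F : finFieldType.
Let q := #|F|.
Implicit Types (u v w x y : 'rV[F]_4) (l m : line F).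

Lemma free2_neq0l n (u v : 'rV[F]_n) : free2 u v -> u != 0.
Proof.
move=> /free2P f; apply/eqP => u0; have [|/eqP] := f 1 0; first by rewrite u0 scaler0 scale0r addr0.
by rewrite oner_eq0.
Qed.

Lemma free2C n (u v : 'rV[F]_n) : free2 u v -> free2 v u.
Proof. by move=> /free2P f; apply/free2P => a b; rewrite addrC => /f[]. Qed.

Lemma free2_neq0r n (u v : 'rV[F]_n) : free2 u v -> v != 0.
Proof. by move/free2C/free2_neq0l. Qed.

Lemma free2E u v : free2 u v = free [:: u; v].
Proof.
rewrite free_cons span_seq1 seq1_free; apply/idP/andP => [f|[uv vn0]].
  split; last exact: free2_neq0r f.
  apply/vlineP => -[k E]; move/free2P/(_ 1 (- k)): f.
  by case=> [|/eqP]; rewrite ?oner_eq0 // E scale1r scaleNr subrr.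
apply/free2P => a b E.
have a0 : a = 0.
  apply/eqP; apply: contraNT uv => an0; apply/vlineP; exists (- (b / a)).
  apply: (scalerI an0); rewrite scalerA mulrN mulrC divfK // scaleNr.
  by apply/eqP; rewrite -addr_eq0 E.
move: E; rewrite a0 scale0r add0r => /eqP; rewrite scaler_eq0 (negPf vn0) orbF.
by move=> /eqP.
Qed.

Lemma free2PnE u v : u != 0 -> ~~ free2 u v -> exists a, v = a *: u.
Proof.
move=> un0 nf; have : ~~ free2 v u by apply: contra nf => /free2C.
rewrite free2E free_cons span_seq1 seq1_free un0 andbT negbK.
by move=> /vlineP.
Qed.

Lemma mem_span2 u v x : reflect (exists a b, x = a *: u + b *: v) (x \in <<[:: u; v]>>%VS).
Proof.
rewrite span_cons span_seq1; apply: (iffP memv_addP) => [[_ /vlineP[a ->] [_ /vlineP[b ->] ->]]|].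
  by exists a, b.
move=> [a [b ->]]; exists (a *: u); first by apply/vlineP; exists a.
by exists (b *: v) => //; apply/vlineP; exists b.
Qed.

Lemma dim_span2 u v : free2 u v -> \dim <<[:: u; v]>>%VS == 2%N.
Proof. by rewrite free2E => /eqP ->. Qed.

Lemma line_span l u v : free2 u v -> u \in val l -> v \in val l -> val l = <<[:: u; v]>>%VS.
Proof.
move=> f ul vl; apply/esym/eqP; rewrite eqEdim; apply/andP; split.
  by apply/span_subvP => x; rewrite !inE => /orP[] /eqP ->.
by rewrite (eqP (dim_span2 f)) (eqP (valP l)).
Qed.

Lemma mem_line l u v x : free2 u v -> u \in val l -> v \in val l ->
  reflect (exists a b, x = a *: u + b *: v) (x \in val l).
Proof. by move=> f ul vl; rewrite (line_span f ul vl); apply: mem_span2. Qed.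

Lemma line_uniq l m u v : free2 u v -> u \in val l -> v \in val l ->
  u \in val m -> v \in val m -> l = m.
Proof.
by move=> f ul vl um vm; apply: val_inj; rewrite (line_span f ul vl) (line_span f um vm).
Qed.

Lemma line_of u v : free2 u v -> exists l, u \in val l /\ v \in val l.
Proof.
move=> f; exists (exist _ <<[:: u; v]>>%VS (dim_span2 f)) => /=.
by split; apply: memv_span; rewrite !inE eqxx ?orbT.
Qed.

Lemma line_free2 l : exists u v, [/\ free2 u v, u \in val l & v \in val l].
Proof.
have b := vbasisP (val l).
have : size (tval (vbasis (val l))) = 2%N by rewrite size_tuple (eqP (valP l)).
move: (tval _) b => [|u [|v []]] //= b _.
exists u, v; split; first by rewrite free2E (basis_free b).
  by apply: (basis_mem b); rewrite inE eqxx.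
by apply: (basis_mem b); rewrite !inE eqxx orbT.
Qed.

Lemma line_free2_with l u : u != 0 -> u \in val l -> exists2 v, free2 u v & v \in val l.
Proof.
move=> un0 ul; have [a [b [f al bl]]] := line_free2 l.
case: (boolP (free2 u a)) => [fa|/(free2PnE un0)[k aE]]; first by exists a.
case: (boolP (free2 u b)) => [fb|/(free2PnE un0)[k' bE]]; first by exists b.
have /eqP[] := free2_neq0l f.
have /free2P/(_ k' (- k)) := f; rewrite {1}aE {1}bE !scalerA mulNr scaleNr mulrC subrr.
by case=> // _ /eqP; rewrite oppr_eq0 aE => /eqP ->; rewrite scale0r.
Qed.

Lemma card_line l : #|[set x | x \in val l]| = (q ^ 2)%N.
Proof.
have [u [v [f ul vl]]] := line_free2 l.
rewrite -mulnn -card_prod -(card_imset (f := fun t : F * F => t.1 *: u + t.2 *: v)); last first.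
  move=> [a b] [a' b'] /= E; have /free2P/(_ (a - a') (b - b')) := f.
  rewrite !scalerBl addrACA -opprD E subrr => -[] // /eqP + /eqP.
  by rewrite !subr_eq0 => /eqP-> /eqP->.
apply: eq_card => x; rewrite inE; apply/(mem_line x f ul vl)/imsetP => [[a [b ->]]|[[a b] _ ->]].
  by exists (a, b).
by exists a, b.
Qed.

Lemma card_line_neq0 l : #|[set x | (x != 0) && (x \in val l)]| = (q ^ 2 - 1)%N.
Proof.
rewrite -(card_line l) (cardsD1 0 [set x | x \in val l]) inE mem0v addKn.
by apply: eq_card => x; rewrite !inE.
Qed.

(** The orthogonal complement, found by search so that it has type [line]; [dualE] shows that the
    default is never taken. *)
Definition dual l : line F :=
  odflt l [pick m : line F | [forall x : 'rV[F]_4, (x \in val m) == [forall y in val l, dot x y == 0]]].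

Lemma dualE l x : (x \in val (dual l)) = [forall y in val l, dot x y == 0].
Proof.
suff [m H] : exists m : line F, forall x, (x \in val m) = [forall y in val l, dot x y == 0].
  rewrite /dual; case: pickP => [m' /forallP H'|/(_ m)/negP[]]; first exact/eqP/H'.
  by apply/forallP => y; rewrite H.
have [u [v [f ul vl]]] := line_free2 l.
have orthE t : [forall y in val l, dot t y == 0] = (dot t u == 0) && (dot t v == 0).
  apply/idP/andP => [/forall_inP H|[/eqP tu /eqP tv]]; first by split; apply: H.
  apply/forall_inP => y /(mem_line _ f ul vl)[a [b ->]].
  by rewrite !dot_lin tu tv !mulr0 addr0.
have [w1 w1n0 /eqP] := @exists_orthogonal _ _ _ (col_mx u v) (isT : 2 < 4)%N.
rewrite tr_col_mx mul_mx_row row_mx_eq0 !mulmx_tr_eq0 => /andP[w1u w1v].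
have [e w1e] : exists e, dot w1 e != 0.
  apply/existsP; apply: contraNT w1n0; rewrite negb_exists => /forallP H.
  by apply/eqP/dot_eq0_all => y; apply/eqP; have := H y; rewrite negbK.
(* Orthogonality to [e] makes [w2] independent of [w1]. *)
have [w2 w2n0 /eqP] := @exists_orthogonal _ _ _ (col_mx (col_mx u v) e) (isT : 3 < 4)%N.
rewrite !tr_col_mx !mul_mx_row !row_mx_eq0 !mulmx_tr_eq0 => /andP[/andP[w2u w2v] w2e].
have fw : free2 w1 w2.
  apply: contraT => /(free2PnE w1n0)[k E]; move: w2e w2n0.
  by rewrite E !dot_lin mulf_eq0 (negPf w1e) orbF => /eqP ->; rewrite scale0r eqxx.
have [m [w1m w2m]] := line_of fw; exists m => {}x; rewrite orthE.
have sub : [set x | x \in val m] \subset [set x | (dot x u == 0) && (dot x v == 0)].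
  apply/subsetP => y; rewrite !inE => /(mem_line _ fw w1m w2m)[a [b ->]].
  by rewrite !dot_lin (eqP w1u) (eqP w1v) (eqP w2u) (eqP w2v) !mulr0 addr0 eqxx.
have /eqP/setP/(_ x) : [set x | x \in val m] == [set x | (dot x u == 0) && (dot x v == 0)].
  by rewrite eqEcard sub card_line card_orthogonal2 ?leqnn.
by rewrite !inE.
Qed.

Lemma dualP l x : reflect (forall y, y \in val l -> dot x y = 0) (x \in val (dual l)).
Proof.
rewrite dualE; apply: (iffP forall_inP) => H y yl; first exact/eqP/H.
by rewrite H.
Qed.

Lemma dual_free2 l u v x : free2 u v -> u \in val l -> v \in val l ->
  (x \in val (dual l)) = (dot x u == 0) && (dot x v == 0).
Proof.
move=> f ul vl; apply/dualP/andP => [H|[/eqP xu /eqP xv] y].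
  by split; rewrite H.
by move=> /(mem_line _ f ul vl)[a [b ->]]; rewrite !dot_lin xu xv !mulr0 addr0.
Qed.

Lemma dualK : involutive dual.
Proof.
move=> l; have [u [v [f ul vl]]] := line_free2 l.
by apply: (line_uniq f) => //; apply/dualP => y /dualP H; rewrite dotC H.
Qed.

End Lines.

(** * Words on the lines through a point *)

Lemma double_count (S T : finType) (R : S -> T -> bool) :
  (\sum_x #|[set y | R x y]| = \sum_y #|[set x | R x y]|)%N.
Proof.
under eq_bigr => x _ do rewrite -sum1_card big_mkcond.
under [RHS]eq_bigr => x _ do rewrite -sum1_card big_mkcond.
by rewrite exchange_big; apply: eq_bigr => y _; apply: eq_bigr => x _; rewrite !inE.
Qed.

Lemma card_nonzero_scalars (F : finFieldType) : #|[set b : F | b != 0]| = (#|F| - 1)%N.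
Proof.
by rewrite subn1 -(cardC1 (0 : F)); apply: eq_card => b; rewrite !inE.
Qed.

Section Generators.
Variable F : finFieldType.
Let q := #|F|.
Implicit Types (u v w x y : 'rV[F]_4) (l m : line F) (M : 'M[F]_4).

(** The expression is the determinant of [x |-> (dot x t1, dot x t2)] restricted to the line. *)
Lemma line_meets_kernel l u v t1 t2 : free2 u v -> u \in val l -> v \in val l ->
  reflect (exists x, [/\ x != 0, x \in val l, dot x t1 = 0 & dot x t2 = 0])
    (dot u t1 * dot v t2 - dot u t2 * dot v t1 == 0).
Proof.
move=> f ul vl; apply: (iffP eqP) => [E|[x [xn0 /(mem_line x f ul vl)[a [b xE]]]]].
  have mk a b : (a != 0) || (b != 0) -> dot (a *: u + b *: v) t1 = 0 ->
      dot (a *: u + b *: v) t2 = 0 ->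
      exists x, [/\ x != 0, x \in val l, dot x t1 = 0 & dot x t2 = 0].
    move=> ab E1 E2; exists (a *: u + b *: v); split=> //.
      by apply: contraTneq ab => /(free2P _ _ f)[-> ->]; rewrite eqxx.
    by apply/(mem_line _ f ul vl); exists a, b.
  case: (eqVneq (dot u t1) 0) => [u1|u1].
    case: (eqVneq (dot u t2) 0) => [u2|u2].
      by apply: (mk 1 0); rewrite ?oner_eq0 // !dot_lin ?u1 ?u2; ring.
    apply: (mk (dot v t2) (- dot u t2)); rewrite ?oppr_eq0 ?u2 ?orbT // !dot_lin.
      by rewrite -[RHS]E; ring.
    by ring.
  apply: (mk (dot v t1) (- dot u t1)); rewrite ?oppr_eq0 ?u1 ?orbT // !dot_lin.
    by ring.
  by rewrite -[RHS]oppr0 -E; ring.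
rewrite xE !dot_lin => E1 E2; set d := _ - _.
have da : a * d = 0.
  rewrite (_ : a * d = dot v t2 * (a * dot u t1 + b * dot v t1) -
                       dot v t1 * (a * dot u t2 + b * dot v t2)); first by rewrite E1 E2; ring.
  by rewrite /d; ring.
have db : b * d = 0.
  rewrite (_ : b * d = dot u t1 * (a * dot u t2 + b * dot v t2) -
                       dot u t2 * (a * dot u t1 + b * dot v t1)); first by rewrite E1 E2; ring.
  by rewrite /d; ring.
apply/eqP; apply: contraNT xn0 => dn0; rewrite xE.
move/eqP: da; move/eqP: db; rewrite !mulf_eq0 (negPf dn0) !orbF => /eqP-> /eqP->.
by rewrite !scale0r addr0.
Qed.

Lemma meetsP l m : reflect (exists x, [/\ x != 0, x \in val l & x \in val m]) (meets l m).
Proof.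
apply: (iffP idP) => [n0|[x [xn0 xl xm]]].
  exists (vpick (val l :&: val m)%VS); rewrite vpick0; split=> //.
    by have := memv_pick (val l :&: val m)%VS; rewrite memv_cap => /andP[].
  by have := memv_pick (val l :&: val m)%VS; rewrite memv_cap => /andP[].
apply: contraNneq xn0 => E; rewrite -memv0 -[0%VS]E memv_cap xl.
exact: xm.
Qed.

Lemma meetsC l m : meets l m = meets m l.
Proof. by apply/meetsP/meetsP => -[x [xn0 x1 x2]]; exists x. Qed.

(** The bilinear form of the Klein quadric: a pairing of the Pluecker coordinates of [m] with those
    of [dual l]. *)
Lemma meets_det l m t1 t2 u v : free2 t1 t2 -> t1 \in val (dual l) -> t2 \in val (dual l) ->
  free2 u v -> u \in val m -> v \in val m ->
  meets l m = (dot u t1 * dot v t2 - dot u t2 * dot v t1 == 0).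
Proof.
move=> ft t1l t2l fu um vm.
apply/meetsP/(line_meets_kernel t1 t2 fu um vm) => -[x].
  move=> [xn0 xl xm]; exists x; split=> //; rewrite dotC.
    exact: (dualP _ _ t1l).
  exact: (dualP _ _ t2l).
move=> [xn0 xm x1 x2]; exists x; split=> //.
by rewrite -[l]dualK (dual_free2 x ft t1l t2l) x1 x2 eqxx.
Qed.

Lemma meets_dual l m : meets l (dual m) = meets (dual l) m.
Proof.
have [a [b [fab al bl]]] := line_free2 l.
have [u [v [fuv um vm]]] := line_free2 m.
rewrite meetsC (@meets_det _ _ u v a b) ?dualK // (@meets_det _ _ a b u v) ?dualK //.
by rewrite !(dotC a) !(dotC b) [_ * dot v b]mulrC [X in _ - X]mulrC [X in X - _]mulrC.
Qed.

Definition alternating_mx M := forall x, dot (x *m M) x = 0.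

Definition isotropic M l := [forall x in val l, forall y in val l, dot (x *m M) y == 0].

Lemma alternating_skew M : alternating_mx M -> forall x y, dot (x *m M) y = - dot (y *m M) x.
Proof.
move=> alt x y; apply/eqP; rewrite -addr_eq0; have := alt (x + y).
by rewrite mulmxDl !dot_lin !alt add0r addr0 addrC => ->.
Qed.

Lemma isotropic_det M l u v : alternating_mx M -> free2 u v -> u \in val l -> v \in val l ->
  isotropic M l = (dot (u *m M) v == 0).
Proof.
move=> alt f ul vl; apply/idP/eqP => [/forall_inP/(_ u ul)/forall_inP/(_ v vl)/eqP //|E].
apply/forall_inP => x /(mem_line x f ul vl)[a [b ->]].
apply/forall_inP => y /(mem_line y f ul vl)[c [d ->]].
rewrite mulmxDl -!scalemxAl !dot_lin !alt E (alternating_skew alt v u) E.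
by apply/eqP; ring.
Qed.

(** If [dual l] is isotropic, then [x |-> x *m M] sends it into the complement of [dual l], which is
    [l], and by dimension onto [l]. *)
Lemma isotropic_dual M l : alternating_mx M -> M \in unitmx ->
  isotropic M (dual l) -> isotropic (invmx M) l.
Proof.
move=> alt uM iso; have [u [v [f ul vl]]] := line_free2 (dual l).
have inj a b : a *: (u *m M) + b *: (v *m M) = (a *: u + b *: v) *m M.
  by rewrite mulmxDl !scalemxAl.
have f' : free2 (u *m M) (v *m M).
  apply/free2P => a b; rewrite inj => /(congr1 (mulmx^~ (invmx M))).
  by rewrite mulmxK // mul0mx => /(free2P _ _ f).
have inl x : x \in val (dual l) -> x *m M \in val l.
  move=> xl; rewrite -[l]dualK; apply/dualP => y yl.
  by have /forall_inP/(_ x xl)/forall_inP/(_ y yl)/eqP := iso.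
apply/forall_inP => x xl; apply/forall_inP => y yl; apply/eqP.
have /(mem_line _ f' (inl u ul) (inl v vl))[a [b]] := xl; rewrite inj => ->.
rewrite mulmxK //; apply: (dualP l _ _) yl; apply/(mem_line _ f ul vl).
by exists a, b.
Qed.

Lemma alternating_inv M : alternating_mx M -> M \in unitmx -> alternating_mx (invmx M).
Proof.
move=> alt uM x; rewrite -{2}[x](mulmxKV uM) dotC; exact: alt.
Qed.

Lemma isotropic_dualE M l : alternating_mx M -> M \in unitmx ->
  isotropic M (dual l) = isotropic (invmx M) l.
Proof.
move=> alt uM; apply/idP/idP; first exact: isotropic_dual.
rewrite -{1}[l]dualK => /isotropic_dual; rewrite invmxK; apply; last by rewrite unitmx_inv.
exact: alternating_inv.
Qed.

(* On the plane of the Klein quadric formed by the lines through a point, a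
   hyperplane section is a line or everything. *)
Definition pencilwise (G : line F -> bool) := forall u, u != 0 ->
  exists2 w, dot w u = 0 & forall l v, free2 u v -> u \in val l -> v \in val l ->
    G l = (dot w v == 0).

Lemma pencilwise_meets l : pencilwise (meets l).
Proof.
move=> u _; have [t1 [t2 [f t1l t2l]]] := line_free2 (dual l).
exists (dot u t1 *: t2 - dot u t2 *: t1).
  by rewrite !dot_lin !(dotC _ u); ring.
move=> m v fuv um vm; rewrite (meets_det f t1l t2l fuv um vm) !dot_lin.
by rewrite !(dotC _ v); congr (_ == 0); ring.
Qed.

Lemma pencilwise_isotropic M : alternating_mx M -> pencilwise (isotropic M).
Proof.
move=> alt u _; exists (u *m M) => [|l v f ul vl]; first exact: alt.
exact: isotropic_det.
Qed.

(** The two conditions correspond to the two families of planes on the Klein quadric: the lines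
    through a point and the lines in a plane. *)
Definition generator G := pencilwise G /\ pencilwise (fun l => G (dual l)).

Lemma generator_meets l : generator (meets l).
Proof.
split; first exact: pencilwise_meets.
move=> u /(pencilwise_meets (dual l))[w wu wE]; exists w => // m v f um vm.
by rewrite meets_dual (wE _ _ f).
Qed.

Lemma generator_isotropic M : alternating_mx M -> M \in unitmx -> generator (isotropic M).
Proof.
move=> alt uM; split; first exact: pencilwise_isotropic.
move=> u un0; have [w wu wE] := pencilwise_isotropic (alternating_inv alt uM) un0.
by exists w => // m v f um vm; rewrite isotropic_dualE // (wE _ _ f).
Qed.

(* Nondegenerate forms are allowed besides the lines: the extended code contains
   the characteristic vectors of all [W(3,q)], whether or not [code11] does. *)
Definition is_word (s : F) (c : line F -> F) :=
  exists (I : finType) (a : I -> F) (G : I -> line F -> bool),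
  [/\ forall i, generator (G i), \sum_i a i = s & forall l, c l = \sum_i a i * (G i l)%:R].

Lemma is_word_dual s c : is_word s c -> is_word s (fun l => c (dual l)).
Proof.
move=> [I [a [G [gG sa cE]]]]; exists I, a, (fun i l => G i (dual l)); split=> // i.
have [G1 G2] := gG i; split=> // u un0; have [w wu wE] := G1 u un0.
by exists w => // l v; rewrite dualK; apply: wE.
Qed.

Lemma is_word_scale s t c : is_word s c -> is_word (t * s) (fun l => t * c l).
Proof.
move=> [I [a [G [gG sa cE]]]]; exists I, (fun i => t * a i), G; split=> // [|l].
  by rewrite -mulr_sumr sa.
by rewrite cE mulr_sumr; apply: eq_bigr => i _; rewrite mulrA.
Qed.

Lemma is_word_sub s c G : is_word s c -> generator G -> is_word (s - 1) (fun l => c l - (G l)%:R).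
Proof.
move=> [I [a [H [gH sa cE]]]] gG.
exists (option I), (fun i => if i is Some j then a j else -1), (fun i => if i is Some j then H j else G).
have big_opt (f : option I -> F) : \sum_i f i = f None + \sum_i f (Some i).
  rewrite (bigD1 None) //=; congr (_ + _).
  rewrite (reindex_omap Some id) /=; last by case.
  by apply: eq_bigl => i; rewrite eqxx.
split=> [[i|] //||l]; first by rewrite big_opt sa addrC.
by rewrite big_opt cE mulN1r addrC.
Qed.

Definition through (c : line F -> F) u := [set l : line F | (u \in val l) && (c l != 0)].

Lemma exists_complement u : u != 0 ->
  exists E : 'M[F]_(3, 4), (col_mx u E : 'M_4) \in unitmx.
Proof.
move=> un0; pose B : 'M_(1 + 3, 4) := row_ebase u; exists (dsubmx B).
have : B \in unitmx by exact: row_ebase_unit.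
(* [u] is a multiple of the first row of [B], so the other three rows complete it to a basis. *)
have uE : u = col_ebase u 0 0 *: usubmx B.
  rewrite -{1}[u]mulmx_ebase rank_rV un0 -/B -[B in LHS]vsubmxK.
  rewrite -mulmxA (_ : pid_mx _ = row_mx 1%:M (0 : 'M_(1, 3))); last first.
    by rewrite pid_mx_row.
  rewrite (mul_row_col (1%:M : 'M_1) 0 (usubmx B) (dsubmx B)).
  by rewrite mul1mx mul0mx addr0 {1}[col_ebase u]mx11_scalar mul_scalar_mx.
have cn0 : col_ebase u 0 0 != 0.
  by apply: contraNneq un0 => c0; rewrite uE c0 scale0r.
move=> uB; rewrite -row_free_unit; apply/eqP/rank_ker0 => w'.
pose w : 'M_(1, 1 + 3) := w'; rewrite -[w']/w -[w]hsubmxK.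
rewrite (mul_row_col (lsubmx w) (rsubmx w) u (dsubmx B)) {1}uE.
rewrite [lsubmx w]mx11_scalar mul_scalar_mx scalerA -mul_scalar_mx.
move: (lsubmx w 0 0) (rsubmx w) => a z; rewrite -mul_row_col vsubmxK => /(congr1 (mulmx^~ (invmx B))).
rewrite mulmxK // mul0mx => E0.
have [/matrixP/(_ 0 0) + ->] : (a * col_ebase u 0 0)%:M = 0 :> 'M_1 /\ z = 0.
  by apply: eq_row_mx; rewrite row_mx0.
rewrite !mxE eqxx mulr1n => /eqP; rewrite mulf_eq0 (negPf cn0) orbF => /eqP ->.
by rewrite raddf0 row_mx0.
Qed.

(** Coordinates on the quotient by [u]: the lines through [u] become the points [z] of a projective
    plane, and an equation [w] there lifts to a vector [t] orthogonal to [u]. *)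
Lemma exists_complement_spec u : u != 0 -> exists E : 'M[F]_(3, 4),
  [/\ forall x, exists a z, x = a *: u + z *m E,
      forall a z, a *: u + z *m E = 0 -> a = 0 /\ z = 0 &
      forall w : 'rV[F]_3, exists t, dot t u = 0 /\ forall z, dot t (z *m E) = dot w z].
Proof.
move=> /exists_complement[E uE]; exists E.
have mulE (a : F) z : row_mx (a%:M : 'M_1) z *m (col_mx u E : 'M_4) = a *: u + z *m E.
  by rewrite (mul_row_col (a%:M : 'M_1) z u E) mul_scalar_mx.
split=> [x|a z|w].
- pose y : 'M_(1, 1 + 3) := x *m invmx (col_mx u E : 'M_4); exists (lsubmx y 0 0), (rsubmx y).
  by rewrite -mulE -mx11_scalar hsubmxK mulmxKV.
- rewrite -mulE => /(congr1 (mulmx^~ (invmx (col_mx u E : 'M_4)))).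
  rewrite mulmxK // mul0mx => Er.
  have [/matrixP/(_ 0 0) + ->] : a%:M = 0 :> 'M_1 /\ z = 0.
    by apply: eq_row_mx; rewrite row_mx0.
  by rewrite !mxE eqxx mulr1n.
- exists (row_mx (0 : 'M_1) w *m (invmx (col_mx u E : 'M_4))^T).
  have dE a z : dot (row_mx (0 : 'M_1) w *m (invmx (col_mx u E : 'M_4))^T) (a *: u + z *m E) = dot w z.
    rewrite -mulE /dot trmx_mul mulmxA -[_ *m _ *m (col_mx u E)^T]mulmxA -trmx_mul mulmxV // trmx1 mulmx1.
    by rewrite tr_row_mx (mul_row_col (0 : 'M_1) w) mul0mx add0r.
  split; first by have := dE 1 0; rewrite scale1r mul0mx addr0 dot0r.
  by move=> z; have := dE 0 z; rewrite scale0r add0r.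
Qed.

Lemma is_word_through s c u : is_word s c -> u != 0 ->
  exists (I : finType) (a : I -> F) (w : I -> 'rV[F]_4),
  [/\ \sum_i a i = s, forall i, dot (w i) u = 0 &
      forall l v, free2 u v -> u \in val l -> v \in val l ->
        c l = \sum_i a i * (dot (w i) v == 0)%:R].
Proof.
move=> [I [a [G [gG sa cE]]]] un0.
have H i : exists w, dot w u = 0 /\ forall l v, free2 u v -> u \in val l -> v \in val l ->
    G i l = (dot w v == 0).
  by have [/(_ u un0)[w wu wE] _] := gG i; exists w.
have [w wP] := fin_all_exists H; exists I, a, w; split=> // [i|l v f ul vl].
  by have [] := wP i.
by rewrite cE; apply: eq_bigr => i _; have [_ /(_ l v f ul vl) ->] := wP i.
Qed.

Lemma is_word_chart s c u : is_word s c -> u != 0 ->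
  exists (I : finType) (a : I -> F) (w : I -> 'rV[F]_3) (E : 'M[F]_(3, 4)),
  [/\ \sum_i a i = s,
    #|supp a w| = ((q - 1) * #|through c u|)%N,
    forall l, u \in val l -> exists z, [/\ z != 0, free2 u (z *m E), z *m E \in val l
       & c l = plane_word a w z] &
    forall w : 'rV[F]_3, exists t, dot t u = 0 /\ forall z, dot t (z *m E) = dot w z].
Proof.
move=> cw un0; have [I [a [w [sa wu cE]]]] := is_word_through cw un0.
have [E [Ex E0 Et]] := exists_complement_spec un0.
exists I, a, (fun i => w i *m E^T), E.
have dE i z : dot (w i *m E^T) z = dot (w i) (z *m E).
  by rewrite /dot trmx_mul mulmxA.
have fE z : z != 0 -> free2 u (z *m E).
  move=> zn0; apply/free2P => b c'; rewrite scalemxAl => /E0[-> /eqP].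
  by rewrite scaler_eq0 (negPf zn0) orbF => /eqP.
have cD l z : z != 0 -> u \in val l -> z *m E \in val l -> c l = plane_word a (fun i => w i *m E^T) z.
  move=> zn0 ul zl; rewrite (cE _ _ (fE z zn0) ul zl); apply: eq_bigr => i _.
  by rewrite dE.
have lz l : u \in val l -> exists2 z, z != 0 & z *m E \in val l.
  move=> ul; have [v f vl] := line_free2_with un0 ul; have [b [z vE]] := Ex v.
  exists z.
    by apply: contraTneq f => z0; rewrite vE z0 mul0mx addr0; apply/free2P => /(_ b (-1));
       rewrite scaleN1r subrr => -[] // _ /eqP; rewrite oppr_eq0 oner_eq0.
  have -> : z *m E = v - b *: u by rewrite vE addrC addKr.
  by rewrite memvB // memvZ.
split=> // [|l ul]; last first.
  by have [z zn0 zl] := lz l ul; exists z; split=> //; [exact: fE | exact: cD].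
(* Each nonzero [z] gives one line through [u], and each such line comes from the [q - 1] multiples
   of one [z]. *)
pose R z l := [&& z != 0, z *m E \in val l & l \in through c u].
have -> : #|supp a (fun i => w i *m E^T)| = (\sum_z #|[set l : line F | R z l]|)%N.
  rewrite -sum1_card big_mkcond; apply: eq_bigr => z _; rewrite inE.
  case: (eqVneq z 0) => [->|zn0] /=; first by rewrite (eq_card0) // => l; rewrite inE /R eqxx.
  have [l [ul zl]] := line_of (fE z zn0).
  rewrite -(cD l z zn0 ul zl); case: (eqVneq (c l) 0) => cl.
    rewrite eq_card0 // => m; rewrite !inE /R zn0 inE /=; apply/negP => /and3P[zm um].
    by rewrite (line_uniq (fE z zn0) um zm ul zl) cl eqxx.
  rewrite (_ : [set m : line F | _] = [set l]) ?cards1 //; apply/setP => m; rewrite !inE /R zn0 inE /=.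
  apply/and3P/eqP => [[zm um _]|->]; last by split.
  exact: line_uniq (fE z zn0) um zm ul zl.
rewrite double_count mulnC -sum_nat_const [RHS]big_mkcond; apply: eq_bigr => l _ /=.
case: ifP => lT; last by rewrite eq_card0 // => z; rewrite inE /R lT !andbF.
have ul : u \in val l by move: lT; rewrite inE => /andP[].
have [z zn0 zl] := lz l ul.
rewrite -card_nonzero_scalars.
rewrite -(card_imset (f := fun b : F => b *: z)); last first.
  by move=> b b' /eqP; rewrite -subr_eq0 -scalerBl scaler_eq0 (negPf zn0) orbF subr_eq0 => /eqP.
apply: eq_card => z'; rewrite inE /R lT andbT; apply/andP/imsetP => [[z'n0 z'l]|[b + ->]]; last first.
  by rewrite inE => bn0; rewrite scaler_eq0 (negPf bn0) (negPf zn0) -scalemxAl memvZ.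
have /(mem_line _ (fE z zn0) ul zl)[b [b' E1]] := z'l.
have [_ /eqP] : - b = 0 /\ z' - b' *: z = 0.
  apply: E0; rewrite mulmxBl E1 -scalemxAl scaleNr addrA; row_ring.
rewrite subr_eq0 => /eqP z'E; exists b' => //; rewrite inE.
by apply: contraNneq z'n0 => b'0; rewrite z'E b'0 scale0r.
Qed.

Lemma card_through0 c u l : is_word 0 c -> u != 0 -> u \in val l -> c l != 0 ->
  (2 * q <= #|through c u|)%N.
Proof.
move=> cw un0 ul cl; have [I [a [w [E [sa card lz _]]]]] := is_word_chart cw un0.
have [z [zn0 _ zl cE]] := lz l ul; have q1 := card_gt1 F.
have := card_supp_sum0 (w := w) sa zn0; rewrite -cE card leq_mul2l => /(_ cl) /orP[|//].
by rewrite subn_eq0 leqNgt q1.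
Qed.

Lemma card_through1 c u : is_word 1 c -> u != 0 ->
  (2 * q - 1 <= #|through c u|)%N \/
  exists t, [/\ t != 0, dot t u = 0 & forall l, u \in val l -> c l = (t \in val (dual l))%:R].
Proof.
move=> cw un0; have [I [a [w [E [sa card lz Et]]]]] := is_word_chart cw un0.
have q1 := card_gt1 F; rewrite -/q in q1.
case: leqP => [|lt]; [by left | right].
have [|t tn0 tE] := card_supp_dichotomy (w := w) sa.
  by rewrite card ltn_mul2l lt andbT subn_gt0.
have [s [su sE]] := Et t; exists s; split=> //.
  by apply: contra_neq tn0 => s0; apply: dot_eq0_all => z; rewrite -sE s0 dot0l.
move=> l ul; have [z [zn0 f zl ->]] := lz l ul.
by rewrite tE // -sE (dual_free2 s f ul zl) su eqxx.
Qed.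

End Generators.

(** * Words of coefficient sum zero *)

Lemma card_sum (T : finType) (P : pred T) : (#|[set x | P x]| = \sum_x P x)%N.
Proof.
by rewrite -sum1_card big_mkcond; apply: eq_bigr => x _; rewrite inE; case: (P x).
Qed.

Lemma second_moment (S T : finType) (R : S -> T -> bool) :
  (\sum_y #|[set x | R x y]| ^ 2 =
   \sum_x \sum_x' #|[set y | R x y && R x' y]|)%N.
Proof.
under eq_bigr => y _ do rewrite card_sum -mulnn big_distrlr /=.
rewrite exchange_big; apply: eq_bigr => x _; rewrite exchange_big.
by apply: eq_bigr => x' _; rewrite card_sum; apply: eq_bigr => y _; rewrite mulnb.
Qed.

(** Cauchy-Schwarz against the indicator of the support. *)
Lemma cauchy_support (T : finType) (y : T -> nat) :
  ((\sum_i y i) ^ 2 <= #|[set i | y i != 0]| * \sum_i y i ^ 2)%N.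
Proof.
have E (f : nat -> nat) : f 0 = 0 -> (\sum_i f (y i) = \sum_(i | y i != 0) f (y i))%N.
  move=> f0; rewrite [RHS]big_mkcond; apply: eq_bigr => i _.
  by case: eqP => // ->.
rewrite (E id) // (E (fun n => n ^ 2))%N // cardsE -mulnn -(leq_pmul2l (isT : 0 < 2)%N).
set K := [pred i | y i != 0].
have H : (\sum_(i in K) \sum_(j in K) 2 * (y i * y j) <= \sum_(i in K) \sum_(j in K) (y i ^ 2 + y j ^ 2))%N.
  by apply: leq_sum => i _; apply: leq_sum => j _; apply: nat_Cauchy.
rewrite big_distrlr big_distrr /=; under eq_bigr => i _ do rewrite big_distrr.
apply: leq_trans H _.
under eq_bigr => i _ do rewrite big_split /= sum_nat_const.
by rewrite big_split /= sum_nat_const -big_distrr /= mul2n -addnn.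
Qed.

Section Hull.
Variable F : finFieldType.
Let q := #|F|.
Implicit Types (u v w x t : 'rV[F]_4) (l m : line F) (c : line F -> F).

Definition active c := [set u | (u != 0) && (through c u != set0)].

Lemma activeZ c k u : k != 0 -> (k *: u \in active c) = (u \in active c).
Proof.
move=> kn0; rewrite !inE scaler_eq0 (negPf kn0) /=; congr (_ && (_ != _)).
apply/setP => l; rewrite !inE; congr (_ && _).
apply/idP/idP => [ul|]; last exact: memvZ.
by rewrite -[u]scale1r -(mulVf kn0) -scalerA memvZ.
Qed.

Lemma card_dual_two l m u : u != 0 -> u \in val l -> u \in val m -> l != m ->
  #|[set t | (t != 0) && ((t \in val (dual l)) && (t \in val (dual m)))]| = (q - 1)%N.
Proof.
move=> un0 ul um lm.
have [v f vl] := line_free2_with un0 ul; have [w g wm] := line_free2_with un0 um.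
have f3 a b d : a *: u + b *: v + d *: w = 0 -> [/\ a = 0, b = 0 & d = 0].
  move=> E; have d0 : d = 0.
    apply/eqP; apply: contraNT lm => dn0; apply/eqP; apply: (line_uniq g ul _ um wm).
    apply/(mem_line _ f ul vl); exists (- (a / d)), (- (b / d)).
    apply: (scalerI dn0); apply/eqP; rewrite -subr_eq0 -E; apply/eqP; by row_field.
  by move: E; rewrite d0 scale0r addr0 => /(free2P _ _ f)[-> ->].
rewrite -[RHS](_ : #|[set t | [&& dot t u == 0%R, dot t v == 0%R & dot t w == 0%R]]| - 1 = _)%N; last first.
  by rewrite card_orthogonal3 // expn1.
rewrite [in RHS](cardsD1 0) inE !dot0l eqxx addKn.
apply: eq_card => t; rewrite !inE (dual_free2 t f ul vl) (dual_free2 t g um wm).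
by case: (t != 0) => //=; case: (dot t u == 0); rewrite ?andbF.
Qed.

(** Two lines through [u] span one plane. So for [n] lines of the support through [u], the second
    moment and Cauchy-Schwarz give at least [(q - 1)(q + 1)^2 n / (n + q)] vectors [t], and
    [n >= 2 q] makes [n / (n + q)] at least [2/3]. *)
Lemma card_planes_covered c u : is_word 0 c -> u \in active c ->
  (2 * ((q - 1) * (q + 1) ^ 2) <=
   3 * #|[set t : 'rV[F]_4 | (t != 0%R) && [exists l in through c u, t \in val (dual l)]]|)%N.
Proof.
move=> cw; rewrite inE => /andP[un0 /set0Pn[l0]]; rewrite inE => /andP[ul0 cl0].
have T2q := card_through0 cw un0 ul0 cl0; rewrite -/q in T2q; set T := through c u in T2q *.
have q1 : (1 < q)%N := card_gt1 F.
pose R l t := [&& l \in T, t != 0 & t \in val (dual l)].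
have := cauchy_support (fun t => #|[set l | R l t]|).
rewrite second_moment -(double_count R).
have -> : (\sum_l #|[set t | R l t]| = #|T| * (q ^ 2 - 1))%N.
  rewrite -sum_nat_const [RHS]big_mkcond; apply: eq_bigr => l _.
  case: ifP => lT; last by rewrite eq_card0 // => t; rewrite inE /R lT.
  by rewrite -(card_line_neq0 (dual l)); apply: eq_card => t; rewrite !inE /R lT.
have -> : (\sum_l \sum_m #|[set t | R l t && R m t]| =
    #|T| * ((q ^ 2 - 1) + (#|T| - 1) * (q - 1)))%N.
  rewrite -sum_nat_const [RHS]big_mkcond; apply: eq_bigr => l _.
  case: ifP => lT; last first.
    by rewrite big1 // => m _; rewrite eq_card0 // => t; rewrite inE /R lT.
  rewrite (bigD1 l) //=; congr (_ + _)%N.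
    by rewrite -(card_line_neq0 (dual l)); apply: eq_card => t; rewrite !inE /R lT andbb.
  have -> : (#|T| - 1 = #|T :\ l|)%N by rewrite (cardsD1 l T) lT addKn.
  rewrite -sum_nat_const big_mkcond [RHS]big_mkcond; apply: eq_bigr => m _.
  rewrite !inE; case: eqVneq => //= ml; case: ifP => mT; last first.
    by rewrite eq_card0 // => t; rewrite !inE /R !inE mT /= andbF.
  move: (lT) (mT); rewrite !inE => /andP[ul _] /andP[um _].
  rewrite -(card_dual_two un0 ul um); last by rewrite eq_sym.
  apply: eq_card => t; rewrite !inE /R lT {1}/T inE mT /=.
  by case: (t != 0).
set K := [set t | _ && _].
have -> : [set t | #|[set l | R l t]| != 0]%N = K.
  apply/setP => t; rewrite !inE cards_eq0; apply/set0Pn/andP => [[l]|[tn0 /exists_inP[l lT tl]]].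
    by rewrite inE => /and3P[lT -> tl]; split=> //; apply/exists_inP; exists l.
  by exists l; rewrite inE /R lT tn0.
move: #|T| #|K| T2q => n k; move: (q) q1 => p p1 n2p.
have -> : (p ^ 2 - 1 = (p - 1) * (p + 1))%N by nia.
have -> : ((p - 1) * (p + 1) + (n - 1) * (p - 1) = (p - 1) * (p + n))%N.
  by rewrite [((n - 1) * _)%N]mulnC -mulnDr; congr (_ * _)%N; lia.
have n0 : (0 < n)%N by lia.
have p0 : (0 < p - 1)%N by lia.
move: (p - 1)%N (p + 1)%N p0 => A B A0 H.
have {}H : (n * (A * B ^ 2) <= k * (p + n))%N.
  have pos : (0 < n * A)%N by rewrite muln_gt0 n0.
  rewrite -(leq_pmul2l pos).
  have -> : (n * A * (n * (A * B ^ 2)) = (n * (A * B)) ^ 2)%N by ring.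
  by have -> : (n * A * (k * (p + n)) = k * (n * (A * (p + n))))%N by ring.
move: H; move: (A * _)%N => X H.
have : (n * (2 * X) <= n * (3 * k))%N by nia.
by rewrite leq_pmul2l.
Qed.
Lemma active_dualK c : active (fun l => c (dual (dual l))) = active c.
Proof.
apply/setP => u; rewrite !inE; congr (_ && (_ != _)).
by apply/setP => l; rewrite !inE dualK.
Qed.

Lemma card_active_planes c u : is_word 0 c -> u \in active c ->
  (2 * ((q - 1) * (q + 1) ^ 2) <=
   3 * #|[set t | (t \in active (fun l => c (dual l))) && (dot u t == 0%R)]|)%N.
Proof.
move=> cw uA; apply: leq_trans (card_planes_covered cw uA) _.
rewrite leq_mul2l /=; apply/subset_leq_card/subsetP => t.
rewrite !inE => /andP[-> /exists_inP[l]]; rewrite inE => /andP[ul cl] tl /=.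
rewrite dotC (dualP _ _ tl u ul) eqxx andbT.
by apply/set0Pn; exists (dual l); rewrite inE tl dualK.
Qed.

Lemma card_active_points c t : is_word 0 c -> t \in active (fun l => c (dual l)) ->
  (2 * ((q - 1) * (q + 1) ^ 2) <= 3 * #|[set u | (u \in active c) && (dot u t == 0%R)]|)%N.
Proof.
move=> cw tB; apply: leq_trans (card_active_planes (is_word_dual cw) tB) _.
rewrite active_dualK leq_mul2l /= leq_eqVlt; apply/orP; left; apply/eqP.
by apply: eq_card => u; rewrite !inE dotC.
Qed.

Lemma card_multiples u : u != 0 -> #|[set k *: u | k in [set k : F | k != 0]]| = (q - 1)%N.
Proof.
move=> un0; rewrite card_imset; last first.
  by move=> b b' /eqP; rewrite -subr_eq0 -scalerBl scaler_eq0 (negPf un0) orbF subr_eq0 => /eqP.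
exact: card_nonzero_scalars.
Qed.

Lemma incidence_moment1 (A : {set 'rV[F]_4}) : 0 \notin A ->
  (\sum_t #|[set u | (u \in A) && (dot u t == 0%R)]| = #|A| * q ^ 3)%N.
Proof.
move=> A0; rewrite -(double_count (fun u t => (u \in A) && (dot u t == 0))) -sum_nat_const [RHS]big_mkcond; apply: eq_bigr => u _.
case: ifP => uA; last by rewrite eq_card0 // => t; rewrite inE.
rewrite -[RHS](card_orthogonal1 (u := u)); last by apply: contraNneq A0 => <-.
by apply: eq_card => t; rewrite !inE dotC.
Qed.

(** Proportional vectors are both orthogonal to [q^3] vectors [t], independent ones to [q^2]. *)
Lemma incidence_moment2 (A : {set 'rV[F]_4}) : 0 \notin A ->
  (forall k u, k != 0 -> (k *: u \in A) = (u \in A)) ->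
  (\sum_t #|[set u | (u \in A) && (dot u t == 0%R)]| ^ 2 =
   #|A| * ((q - 1) * q ^ 3 + (#|A| - (q - 1)) * q ^ 2))%N.
Proof.
move=> A0 AZ; rewrite second_moment -sum_nat_const [RHS]big_mkcond; apply: eq_bigr => u _.
case: ifP => uA; last first.
  by rewrite big1 // => u' _; rewrite eq_card0 // => t; rewrite inE.
have un0 : u != 0 by apply: contraNneq A0 => <-.
pose Z := [set k *: u | k in [set k : F | k != 0]].
have cZ : #|Z| = (q - 1)%N by exact: card_multiples.
have ZA : Z \subset A.
  by apply/subsetP => _ /imsetP[k + ->]; rewrite inE => kn0; rewrite AZ.
rewrite (bigID [in Z]) /= -cZ -sum_nat_const; congr (_ + _)%N.
  apply: eq_bigr => u' /imsetP[k + ->]; rewrite inE => kn0.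
  rewrite -[RHS](card_orthogonal1 un0); apply: eq_card => t.
  by rewrite !inE AZ // uA dotZl mulf_eq0 (negPf kn0) /= andbb dotC.
have -> : (#|A| - #|Z| = #|A :\: Z|)%N.
  by rewrite cardsD (setIidPr ZA).
rewrite -sum_nat_const big_mkcond [RHS]big_mkcond; apply: eq_bigr => u' _.
rewrite inE; case: (boolP (u' \in Z)) => //= u'Z; case: ifP => u'A; last first.
  by rewrite eq_card0 // => t; rewrite inE andbF.
rewrite -[RHS](card_orthogonal2 (u := u) (v := u')).
  by apply: eq_card => t; rewrite !inE /= !(dotC t).
apply: contraT => /(free2PnE un0)[k u'E]; case/negP: u'Z.
apply/imsetP; exists k => //; rewrite inE; apply: contraNneq A0 => k0.
by move: u'A; rewrite u'E k0 scale0r => ->.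
Qed.

(** [n] counts active vectors and [a] those in an active plane. Over all [t], the mean of [p * a] is
    [n]. The excess [2 p^2 (p - 1)] is large enough for [hull_arith3] to conclude that active planes
    are at most a quarter as many as active points. *)
Lemma hull_arith1 (p n a : nat) : (19 <= p)%N ->
  (n * (2 * p) <= (p ^ 2 - 1) * (p ^ 3 + 2 * p ^ 2 + p + 1))%N ->
  (2 * ((p - 1) * (p + 1) ^ 2) <= 3 * a)%N -> (n + 2 * p ^ 2 * (p - 1) <= p * a)%N.
Proof.
move=> p19 nle ale.
have E2 : (p ^ 2 - 1 = (p - 1) * (p + 1))%N by clear; nia.
rewrite E2 in nle.
have [k pE] : exists k, p = (k + 19)%N by exists (p - 19)%N; clear -p19; lia.
have E1 : (p - 1 = k + 18)%N by clear -pE; lia.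
rewrite E1 in ale nle *; clear p19 E1 E2.
have pos : (0 < 6 * p)%N by clear -pE; lia.
rewrite -(leq_pmul2l pos).
have {}ale : (2 * p ^ 2 * (2 * ((k + 18) * (p + 1) ^ 2)) <= 2 * p ^ 2 * (3 * a))%N by rewrite leq_mul2l ale orbT.
have -> : (6 * p * (n + 2 * p ^ 2 * (k + 18)) = 3 * (n * (2 * p)) + 12 * p ^ 3 * (k + 18))%N by ring.
have -> : (6 * p * (p * a) = 2 * p ^ 2 * (3 * a))%N by ring.
apply: leq_trans ale.
apply: (leq_trans (n := 3 * ((k + 18) * (p + 1) * (p ^ 3 + 2 * p ^ 2 + p + 1)) + 12 * p ^ 3 * (k + 18))).
  by rewrite leq_add2r leq_mul2l nle.
clear n a nle pos; rewrite pE; clear p pE.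
(* Expanded around [19], the difference of the two sides has only positive coefficients. *)
have -> : (2 * (k + 19) ^ 2 * (2 * ((k + 18) * (k + 19 + 1) ^ 2)) =
  3 * ((k + 18) * (k + 19 + 1) * ((k + 19) ^ 3 + 2 * (k + 19) ^ 2 + (k + 19) + 1)) + 12 * (k + 19) ^ 3 * (k + 18) 
  + (k+18) * (k ^ 4+ 63 * k ^ 3 + 1420 * k ^ 2 + 13161* k + 39232))%N by ring.
exact: leq_addr.
Qed.

(** This is [x^2 <= (p a - n)^2] without subtraction. *)
Lemma hull_arith2 (p n a x : nat) : (n + x <= p * a)%N ->
  (2 * p * a * n + x ^ 2 <= p ^ 2 * a ^ 2 + n ^ 2)%N.
Proof.
move=> le; have [d dE] : exists d, (p * a = n + x + d)%N by exists (p * a - (n + x))%N; lia.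
rewrite -expnMn -[(2 * p * a)%N]mulnA dE.
have -> : ((n + x + d) ^ 2 + n ^ 2 = 2 * (n + x + d) * n + x ^ 2 + (2 * x * d + d ^ 2))%N by ring.
exact: leq_addr.
Qed.

(** For [n] active points and [m] active planes, the moment inequality reduces to [4 m <= n] and the
    incidence count to [2 n (p + 1)^2 <= 3 m (p^2 + p + 1)]; together they force [8 n <= 3 n]. *)
Lemma hull_arith3 (p n m : nat) : (1 < p)%N -> (p - 1 <= n)%N ->
  (2 * p * (n * p ^ 3) * n + m * (2 * p ^ 2 * (p - 1)) ^ 2 <=
     p ^ 2 * (n * ((p - 1) * p ^ 3 + (n - (p - 1)) * p ^ 2)) + p ^ 4 * n ^ 2)%N ->
  (n * (2 * ((p - 1) * (p + 1) ^ 2)) <= 3 * (m * (p ^ 3 - 1)))%N -> n = 0%N.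
Proof.
move=> p1 pn; have [r pE] : exists r, p = r.+1 by exists p.-1; lia.
have [e nE] : exists e, (n = e + r)%N by exists (n - r)%N; lia.
have -> : (p - 1 = r)%N by lia.
have -> : (n - r = e)%N by lia.
have -> : (p ^ 3 - 1 = r * (p ^ 2 + p + 1))%N.
  by rewrite pE (_ : r.+1 ^ 3 = r * (r.+1 ^ 2 + r.+1 + 1) + 1)%N ?addnK // -addn1; ring.
have r0 : (0 < r)%N by lia.
have p4 : (0 < p ^ 4 * r ^ 2)%N by rewrite muln_gt0 !expn_gt0 r0 pE.
move=> H1 H2.
have {}H1 : (p ^ 4 * r ^ 2 * (4 * m) <= p ^ 4 * r ^ 2 * n)%N.
  have E1 : (2 * p * (n * p ^ 3) * n + m * (2 * p ^ 2 * r) ^ 2 =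
     2 * p ^ 4 * n ^ 2 + p ^ 4 * r ^ 2 * (4 * m))%N by ring.
  have E2 : (p ^ 2 * (n * (r * p ^ 3 + e * p ^ 2)) + p ^ 4 * n ^ 2 =
     2 * p ^ 4 * n ^ 2 + p ^ 4 * r ^ 2 * n)%N by rewrite nE pE -addn1; ring.
  by move: H1; rewrite E1 E2 leq_add2l.
rewrite leq_pmul2l // in H1.
have {}H2 : (r * (2 * n * (p + 1) ^ 2) <= r * (3 * m * (p ^ 2 + p + 1)))%N.
  have E1 : (n * (2 * (r * (p + 1) ^ 2)) = r * (2 * n * (p + 1) ^ 2))%N by ring.
  have E2 : (3 * (m * (r * (p ^ 2 + p + 1))) = r * (3 * m * (p ^ 2 + p + 1)))%N by ring.
  by rewrite -E1 -E2.
rewrite leq_pmul2l // in H2; apply/eqP; rewrite -leqn0 leqNgt; apply/negP => n0.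
have : (8 * n * (p ^ 2 + p + 1) <= 3 * n * (p ^ 2 + p + 1))%N.
  apply: leq_trans (_ : 4 * (3 * m * (p ^ 2 + p + 1)) <= _)%N; last first.
    have -> : (4 * (3 * m * (p ^ 2 + p + 1)) = 4 * m * (3 * (p ^ 2 + p + 1)))%N by ring.
    have -> : (3 * n * (p ^ 2 + p + 1) = n * (3 * (p ^ 2 + p + 1)))%N by ring.
    by rewrite leq_mul2r H1 orbT.
  apply: leq_trans (_ : 4 * (2 * n * (p + 1) ^ 2) <= _)%N; last by rewrite leq_mul2l H2.
  have -> : (4 * (2 * n * (p + 1) ^ 2) = 8 * n * (p ^ 2 + p + 1) + 8 * n * p)%N by ring.
  exact: leq_addr.
by rewrite leq_mul2r addn1 /=; lia.
Qed.

(* The active planes contain many active points, but the second moment of the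
   number of active points in a plane leaves room for few such planes. *)
Lemma hull_zero c : is_word 0 c -> (19 <= q)%N ->
  (#|active c| * (2 * q) <= (q ^ 2 - 1) * (q ^ 3 + 2 * q ^ 2 + q + 1))%N -> forall l, c l = 0.
Proof.
move=> cw q19 nle; set A := active c in nle; pose B := active (fun l => c (dual l)).
pose a t := #|[set u | (u \in A) && (dot u t == 0)]|.
have A0 : 0 \notin A by rewrite !inE eqxx.
have X t : t \in B -> (#|A| + 2 * q ^ 2 * (q - 1) <= q * a t)%N.
  by move=> tB; apply: (hull_arith1 q19 nle); apply: card_active_points.
have M1 := incidence_moment1 A0.
have M2 := incidence_moment2 A0 (@activeZ c).
(* The sum of [(q a t - #|A|)^2] over all [t] is known from the two moments, and each active plane
   contributes at least the square of its excess. *)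
have step t : (2 * q * a t * #|A| + (if t \in B then (2 * q ^ 2 * (q - 1)) ^ 2 else 0)
     <= q ^ 2 * a t ^ 2 + #|A| ^ 2)%N.
  case: ifP => [/X /hull_arith2 //|_].
  by have := nat_Cauchy (q * a t) #|A|; rewrite addn0 expnMn !mulnA => -[].
have : (\sum_t (2 * q * a t * #|A| + (if t \in B then (2 * q ^ 2 * (q - 1)) ^ 2 else 0)) <=
   \sum_t (q ^ 2 * a t ^ 2 + #|A| ^ 2))%N by apply: leq_sum => t _.
rewrite !big_split /= -big_distrl -!big_distrr /= M1 M2 -big_mkcond !sum_nat_const.
rewrite (_ : #|{: 'rV[F]_4}| = q ^ 4)%N ?card_rV // => mom.
have cov : (#|A| * (2 * ((q - 1) * (q + 1) ^ 2)) <= 3 * (#|B| * (q ^ 3 - 1)))%N.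
  pose R u t := [&& u \in A, t \in B & dot u t == 0].
  apply: leq_trans (_ : 3 * \sum_u #|[set t | R u t]| <= _)%N.
    rewrite -sum_nat_const big_mkcond big_distrr; apply: leq_sum => u _ /=.
    case: ifP => // uA; apply: leq_trans (card_active_planes cw uA) _.
    rewrite leq_mul2l /=; apply/subset_leq_card/subsetP => t.
    by rewrite !inE /R uA !inE.
  rewrite leq_mul2l /= double_count -sum_nat_const [leqRHS]big_mkcond; apply: leq_sum => t _.
  case: ifP => tB; last by rewrite eq_card0 // => u; rewrite inE /R tB andbF.
  have tn0 : t != 0 by move: tB; rewrite inE => /andP[].
  rewrite -(card_orthogonal1 tn0) (cardsD1 0 [set x | dot x t == 0]) inE dot0l eqxx addKn.
  apply/subset_leq_card/subsetP => u; rewrite inE => /and3P[uA _ ut].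
  by rewrite !inE ut andbT; apply: contraNneq A0 => <-.
suff A00 : #|A| = 0%N.
  move=> l; apply/eqP; apply: contraT => cl.
  have [u [v [f ul vl]]] := line_free2 l.
  have : u \in A by rewrite inE (free2_neq0l f); apply/set0Pn; exists l; rewrite inE ul.
  by move/eqP: A00; rewrite cards_eq0 => /eqP ->; rewrite inE.
have q1 : (1 < q)%N by apply: leq_trans q19.
case: (posnP #|A|) => [//|]; rewrite card_gt0 => /set0Pn[u uA].
have {}mom := leq_trans mom (eq_leq (congr1 (addn _)
  (_ : #|A| * (q ^ 4 * #|A|) = q ^ 4 * #|A| ^ 2)%N)).
have pA : (q - 1 <= #|A|)%N; last by apply: (hull_arith3 q1 pA (mom _) cov); rewrite mulnCA mulnn.
have un0 : u != 0 by apply: contraNneq A0 => <-.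
rewrite -(card_multiples un0); apply/subset_leq_card/subsetP => _ /imsetP[k + ->].
by rewrite inE => kn0; rewrite activeZ.
Qed.

End Hull.

(** * Reconstruction of a null polarity *)

Section NullPolarity.
Variable F : finFieldType.
Implicit Types (u v w x y t : 'rV[F]_4) (l m : line F) (M : 'M[F]_4).
Variable c : line F -> F.

(** Around [u] the word looks like a null polarity that sends the point [u] to the plane [th]; in
    [pencil_in], dually, [f] is the pole of the plane [t]. *)
Definition pencil_at u th := [/\ th != 0, dot u th = 0 &
  forall l, u \in val l -> c l = (th \in val (dual l))%:R].
Definition pencil_in t f := [/\ f != 0, dot t f = 0 &
  forall l, t \in val (dual l) -> c l = (f \in val l)%:R].

(** The line from [u] to the pole [f] lies in the plane [t] and contains [f], so the word is one on
    it; seen from [u], it therefore lies in the plane [th]. *)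
Lemma pencil_reciprocity u th t f : pencil_at u th -> pencil_in t f -> u != 0 ->
  dot u t = 0 -> dot f th = 0.
Proof.
move=> [thn0 uth uE] [fn0 tf tE] un0 ut.
case: (boolP (free2 u f)) => [fr|/(free2PnE un0)[k ->]]; last by rewrite dotZl uth mulr0.
have [l [ul fl]] := line_of fr.
have tl : t \in val (dual l) by rewrite (dual_free2 t fr ul fl) !(dotC t) ut dotC tf eqxx.
have := uE l ul; rewrite (tE l tl) fl; case thl: (_ \in _) => /eqP; last by rewrite oner_eq0.
by move=> _; rewrite dotC; apply: (dualP _ _ thl).
Qed.

(** Both sides are read off from the value of the word on the line joining [u] and [v]. *)
Lemma pencil_symmetry u th v ph : pencil_at u th -> pencil_at v ph -> free2 u v ->
  (dot u ph == 0) = (dot v th == 0).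
Proof.
move=> [_ uth uE] [_ vph vE] f; have [l [ul vl]] := line_of f.
have := uE l ul; rewrite (vE l vl) !(dual_free2 _ f ul vl) !(dotC ph) !(dotC th) uth vph eqxx andbT /=.
by do 2 case: (_ == 0); move=> // /eqP; rewrite ?oner_eq0 // eq_sym oner_eq0.
Qed.

Definition coplanar u v w x := exists a b d, x = a *: u + b *: v + d *: w.

Definition hyperplane (G : line F -> bool) :=
  (exists m, G =1 meets m) \/ (exists M, [/\ alternating_mx M, M \in unitmx & G =1 isotropic M]).

Lemma dot_outer x y a b : dot (x *m (a^T *m b)) y = dot x a * dot b y.
Proof.
by rewrite /dot mulmxA -[_ *m b *m _]mulmxA [x *m a^T]mx11_scalar mul_scalar_mx mxE -mx11_scalar.
Qed.

Lemma dual_vector u v w x : (forall y, exists a b d e, y = a *: u + b *: v + d *: w + e *: x) ->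
  exists t, [/\ dot t u = 0, dot t v = 0, dot t w = 0 & dot t x = 1].
Proof.
move=> span; have [t tn0 /eqP] := @exists_orthogonal _ _ _ (col_mx (col_mx u v) w) (isT : 3 < 4)%N.
rewrite !tr_col_mx !mul_mx_row !row_mx_eq0 !mulmx_tr_eq0 => /andP[/andP[/eqP tu /eqP tv] /eqP tw].
have tx : dot t x != 0.
  apply: contra_neq tn0 => tx; apply: dot_eq0_all => y; have [a [b [d [e ->]]]] := span y.
  by rewrite !dot_lin tu tv tw tx !mulr0 !addr0.
exists ((dot t x)^-1 *: t); rewrite !dot_lin tu tv tw !mulr0.
by split=> //; rewrite mulVf.
Qed.

Section Frame.
Variables (P thP R0 th0 : 'rV[F]_4).
Hypotheses (Pn0 : P != 0) (pP : pencil_at P thP) (pR0 : pencil_at R0 th0).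
Hypothesis PR0 : dot R0 thP != 0.

Let fPR0 : free2 P R0.
Proof.
apply: contraT => /(free2PnE Pn0)[k E]; move: PR0; have [_ E' _] := pP.
by rewrite E dotZl E' mulr0 eqxx.
Qed.

Let P0 : dot P th0 != 0. Proof. by rewrite (pencil_symmetry pP pR0). Qed.
Let PthP : dot P thP = 0. Proof. by case: pP. Qed.
Let R0th0 : dot R0 th0 = 0. Proof. by case: pR0. Qed.

(** [<e3, e4>] is the line common to the planes of [P] and [R0], and [s, r, eta3, eta4] is the basis
    dual to [P, R0, e3, e4]. Its first two members are multiples of the equations of these
    planes. *)
Lemma frame_coordinates : exists e3 e4 s r eta3 eta4,
  [/\ forall x, x = dot x s *: P + dot x r *: R0 + dot x eta3 *: e3 + dot x eta4 *: e4,
      [/\ dot P s = 1, dot R0 s = 0, dot e3 s = 0 & dot e4 s = 0],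
      [/\ dot P r = 0, dot R0 r = 1, dot e3 r = 0 & dot e4 r = 0],
      [/\ dot P eta3 = 0, dot R0 eta3 = 0, dot e3 eta3 = 1 & dot e4 eta3 = 0] /\
      [/\ dot P eta4 = 0, dot R0 eta4 = 0, dot e3 eta4 = 0 & dot e4 eta4 = 1] &
      [/\ s = (dot P th0)^-1 *: th0, r = (dot R0 thP)^-1 *: thP,
        free2 e3 e4 & forall x, dot x thP = 0 -> dot x th0 = 0 ->
          x = dot x eta3 *: e3 + dot x eta4 *: e4]].
Proof.
have fth : free2 thP th0.
  have thPn0 : thP != 0 by case: pP.
  apply: contraT => /(free2PnE thPn0)[k E]; move: P0.
  by rewrite E dotZr PthP mulr0 eqxx.
have [l [l1 l2]] := line_of fth.
have [e3 [e4 [f m1 m2]]] := line_free2 (dual l).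
have mE x : dot x thP = 0 -> dot x th0 = 0 -> exists a b, x = a *: e3 + b *: e4.
  move=> x1 x2; apply/(mem_line x f m1 m2); rewrite (dual_free2 x fth l1 l2) x1 x2 eqxx //.
have e3P : dot e3 thP = 0 by apply: (dualP _ _ m1).
have e30 : dot e3 th0 = 0 by apply: (dualP _ _ m1).
have e4P : dot e4 thP = 0 by apply: (dualP _ _ m2).
have e40 : dot e4 th0 = 0 by apply: (dualP _ _ m2).
have [s sE] : exists s, s = (dot P th0)^-1 *: th0 by eexists.
have [r rE] : exists r, r = (dot R0 thP)^-1 *: thP by eexists.
have span x : exists a b d e, x = a *: P + b *: R0 + d *: e3 + e *: e4.
  have [||a [b E]] := mE (x - dot x s *: P - dot x r *: R0).
  - by rewrite rE !dot_lin PthP mulr0 subr0 mulrAC mulVf // mul1r subrr.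
  - by rewrite sE !dot_lin R0th0 mulr0 subr0 mulrAC mulVf // mul1r subrr.
  exists (dot x s), (dot x r), a, b; rewrite -addrA -E; row_ring.
have [eta3 [h1 h2 h3 h4]] : exists t, [/\ dot t P = 0, dot t R0 = 0, dot t e4 = 0 & dot t e3 = 1].
  apply: dual_vector => x; have [a [b [d [e ->]]]] := span x; exists a, b, e, d.
  by rewrite addrAC.
have [eta4 [k1 k2 k3 k4]] := dual_vector span.
rewrite dotC in h1; rewrite dotC in h2; rewrite dotC in h3; rewrite dotC in h4.
rewrite dotC in k1; rewrite dotC in k2; rewrite dotC in k3; rewrite dotC in k4.
have sP : dot P s = 1 by rewrite sE dotZr mulVf.
have rR : dot R0 r = 1 by rewrite rE dotZr mulVf.
have s1 : [/\ dot R0 s = 0, dot e3 s = 0 & dot e4 s = 0] by rewrite sE !dotZr R0th0 e30 e40 mulr0.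
have r1 : [/\ dot P r = 0, dot e3 r = 0 & dot e4 r = 0] by rewrite rE !dotZr PthP e3P e4P mulr0.
case: s1 => s1 s2 s3; case: r1 => r1 r2 r3.
exists e3, e4, s, r, eta3, eta4; split=> // [x|].
  have [a [b [d [e E]]]] := span x; rewrite {2 3 4 5}E !dot_lin.
  rewrite sP s1 s2 s3 r1 rR r2 r3 h1 h2 h3 h4 k1 k2 k3 k4 !mulr0 !mulr1 !addr0 !add0r.
  exact: E.
split=> // x x1 x2; have [a [b ->]] := mE x x1 x2.
by rewrite !dot_lin h3 h4 k3 k4 !mulr0 !mulr1 addr0 add0r.
Qed.

Definition good_plane u v w := exists t f,
  [/\ t != 0, [/\ dot u t = 0, dot v t = 0 & dot w t = 0] & pencil_in t f].

(* [P], [R0] and [R1] determine the alternating form: [P] and [R0] fix it up to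
   its value [mu] on the line [<e3, e4>], and [R1] fixes [mu]. *)
Lemma null_polarity R1 th1 : pencil_at R1 th1 -> dot R1 thP != 0 ->
  ~ (exists a b, R1 = a *: P + b *: R0) -> good_plane P R0 R1 ->
  exists2 G, hyperplane G & forall R th, pencil_at R th -> dot R thP != 0 ->
    ~ coplanar P R0 R1 R -> good_plane P R0 R -> good_plane P R R1 ->
    forall l, R \in val l -> c l = (G l)%:R.
Proof.
move=> pR1 R1P nR1 gp1.
have [e3 [e4 [s [r [eta3 [eta4 [coord [sP sR s3 s4] [rP rR r3 r4]
  [[xP xR x3 x4] [yP yR y3 y4]] [sE rE f34 inm]]]]]]]] := frame_coordinates.
have R0n0 := free2_neq0r fPR0.
have rn0 R : dot R thP != 0 -> dot R r != 0.
  by move=> RP; rewrite rE dotZr mulf_neq0 // invr_neq0.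
have fPR R : dot R thP != 0 -> free2 P R.
  move=> RP; apply: contraT => /(free2PnE Pn0)[k E]; move: RP.
  by rewrite E dotZl PthP mulr0 eqxx.
have Pth R th : pencil_at R th -> dot R thP != 0 -> dot P th != 0.
  by move=> pR RP; rewrite (pencil_symmetry pP pR) // fPR.
(* The pole of the plane [<P, R0, R>] is the point [u] where it meets [<e3, e4>]:
   this fixes the plane of [R] up to the one parameter [mu]. *)
have mu_ex R th : pencil_at R th -> dot R thP != 0 -> good_plane P R0 R ->
    (dot R eta3 != 0) || (dot R eta4 != 0) ->
    [/\ dot R s * dot P th + dot R r * dot R0 th = 0 & exists mu,
    dot R r * dot e3 th = mu * dot R eta4 * dot P th /\
    - dot R r * dot e4 th = mu * dot R eta3 * dot P th].
  move=> pR RP [t [f [tn0 [Pt R0t Rt] pt]]] un0.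
  have Rn0 : R != 0 by apply: contraNneq RP => ->; rewrite dot0l.
  have [u uE] : exists u, u = dot R eta3 *: e3 + dot R eta4 *: e4 by eexists.
  have RE : R = dot R s *: P + dot R r *: R0 + u by rewrite {1}(coord R) -addrA uE.
  have f1 := pencil_reciprocity pP pt Pn0 Pt.
  have f2 := pencil_reciprocity pR0 pt R0n0 R0t.
  have f3 := pencil_reciprocity pR pt Rn0 Rt.
  have ut : dot u t = 0.
    by move: Rt; rewrite {1}RE !dotDl !dotZl Pt R0t !mulr0 !add0r.
  have un : u != 0.
    apply: contraTneq un0; rewrite uE => /(free2P _ _ f34)[-> ->]; by rewrite eqxx.
  have tf : dot f t = 0 by case: pt => _ + _; rewrite dotC.
  (* The pole [f] is also on [<e3, e4>]. If it were not the point [u], the plane [t] would contain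
     [e3] and [e4] besides [P] and [R0]. *)
  have uth : dot u th = 0.
    case: (boolP (free2 u f)) => [fuf|/(free2PnE un)[k fE]]; last first.
      move: f3; rewrite fE dotZl => /eqP; rewrite mulf_eq0 => /orP[/eqP k0|/eqP //].
      by case: pt; rewrite fE k0 scale0r eqxx.
    case/eqP: tn0; apply: dot_eq0_all => x.
    have fm := inm f f1 f2.
    have [e3t e4t] : dot e3 t = 0 /\ dot e4 t = 0.
      have E1 : dot R eta3 * dot e3 t + dot R eta4 * dot e4 t = 0 by move: ut; rewrite uE !dot_lin.
      have E2 : dot f eta3 * dot e3 t + dot f eta4 * dot e4 t = 0 by move: tf; rewrite {1}fm !dot_lin.
      pose d := dot R eta3 * dot f eta4 - dot R eta4 * dot f eta3.
      have dn0 : d != 0.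
        apply: contraTneq fuf => d0; apply/negP => /free2P H.
        have [|E3 /eqP] := H (dot f eta3) (- dot R eta3).
          rewrite {2}fm uE; apply/eqP; rewrite -subr_eq0; apply/eqP.
          rewrite (_ : _ - 0 = (- d) *: e4); first by rewrite d0 oppr0 scale0r.
          rewrite /d; row_ring.
        rewrite oppr_eq0 => /eqP E4.
        have [|E5 /eqP] := H (dot f eta4) (- dot R eta4).
          rewrite {2}fm uE; apply/eqP; rewrite -subr_eq0; apply/eqP.
          rewrite (_ : _ - 0 = d *: e3); first by rewrite d0 scale0r.
          rewrite /d; row_ring.
        by rewrite oppr_eq0 => /eqP E6; move: un0; rewrite E4 E6 eqxx.
      split; apply: (mulfI dn0); rewrite mulr0.
        rewrite (_ : _ * _ = dot f eta4 * (dot R eta3 * dot e3 t + dot R eta4 * dot e4 t)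
          - dot R eta4 * (dot f eta3 * dot e3 t + dot f eta4 * dot e4 t)); first by rewrite E1 E2; ring.
        by rewrite /d; ring.
      rewrite (_ : _ * _ = dot R eta3 * (dot f eta3 * dot e3 t + dot f eta4 * dot e4 t)
          - dot f eta3 * (dot R eta3 * dot e3 t + dot R eta4 * dot e4 t)); first by rewrite E1 E2; ring.
      by rewrite /d; ring.
    by rewrite dotC (coord x) !dot_lin Pt R0t e3t e4t !mulr0 !addr0.
  have Rth : dot R th = 0 by case: pR.
  split; first by move: Rth; rewrite {1}RE !dotDl uth !dotZl addr0.
  have P1 := Pth _ _ pR RP; have r1 := rn0 _ RP.
  have {}uth : dot R eta3 * dot e3 th + dot R eta4 * dot e4 th = 0 by move: uth; rewrite uE !dot_lin.
  case: (eqVneq (dot R eta4) 0) un0 => [y0|yn0 _].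
    rewrite orbF => xn0; exists (- dot R r * dot e4 th / (dot R eta3 * dot P th)).
    move: uth; rewrite y0 mul0r addr0 => /eqP; rewrite mulf_eq0 (negPf xn0) => /eqP ->.
    by split; [ring | field; rewrite xn0 P1].
  exists (dot R r * dot e3 th / (dot R eta4 * dot P th)); split; first by field; rewrite yn0 P1.
  have -> : dot e4 th = - (dot R eta3 * dot e3 th / dot R eta4).
    by apply: (mulfI yn0); apply/eqP; rewrite -subr_eq0 -uth; apply/eqP; field.
  by field; rewrite yn0 P1.
have un1 : (dot R1 eta3 != 0) || (dot R1 eta4 != 0).
  apply: contraT; rewrite negb_or !negbK => /andP[/eqP a1 /eqP a2]; case: nR1.
  by exists (dot R1 s), (dot R1 r); rewrite {1}(coord R1) a1 a2 !scale0r !addr0.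
have [E1 [mu [m1 m2]]] := mu_ex _ _ pR1 R1P gp1 un1.
(* The sum of [s] wedge [r] and [mu] times [eta3] wedge [eta4]; by the relations found for [R1], the
   plane of [R1] is its polar plane. *)
pose form x y := dot x s * dot y r - dot x r * dot y s + mu * (dot x eta3 * dot y eta4 - dot x eta4 * dot y eta3).
have formE R th : pencil_at R th -> dot R thP != 0 ->
    ~ coplanar P R0 R1 R -> good_plane P R0 R -> good_plane P R R1 ->
    forall v, dot v th = - (dot P th / dot R r) * form R v.
  move=> pR RP nc gpR gp v.
  (* The determinant of the [<e3, e4>] parts of [R1] and [R]. *)
  pose D := dot R1 eta3 * dot R eta4 - dot R1 eta4 * dot R eta3.
  have Dn0 : D != 0.
    apply/eqP => D0; case: nc.
    have mk k : dot R eta3 = k * dot R1 eta3 -> dot R eta4 = k * dot R1 eta4 -> coplanar P R0 R1 R.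
      move=> k3 k4; exists (dot R s - k * dot R1 s), (dot R r - k * dot R1 r), k.
      rewrite {1}(coord R) k3 k4 {5}(coord R1); row_ring.
    case: (eqVneq (dot R1 eta3) 0) un1 => [z|z _] /=.
      move=> z'; apply: (mk (dot R eta4 / dot R1 eta4)); last by rewrite divfK.
      rewrite z mulr0; move/eqP: D0; rewrite /D z mul0r add0r oppr_eq0 mulf_eq0 (negPf z') => /eqP //.
    apply: (mk (dot R eta3 / dot R1 eta3)); first by rewrite divfK.
    apply: (mulfI z); apply/eqP; rewrite -subr_eq0 -D0; apply/eqP; rewrite /D; by field.
  have un : (dot R eta3 != 0) || (dot R eta4 != 0).
    by apply: contraNT Dn0; rewrite negb_or !negbK /D => /andP[/eqP -> /eqP ->]; rewrite !mulr0 subrr.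
  have [E2 [mu' [n1 n2]]] := mu_ex _ _ pR RP gpR un.
  have Rn0 : R != 0 by apply: contraNneq RP => ->; rewrite dot0l.
  have R1n0 : R1 != 0 by apply: contraNneq R1P => ->; rewrite dot0l.
  have P1 := Pth _ _ pR1 R1P; have PR := Pth _ _ pR RP.
  have rr := rn0 _ RP; have rr1 := rn0 _ R1P.
  have th1E z : dot z th1 = dot z s * dot P th1 + dot z r * dot R0 th1 + dot z eta3 * dot e3 th1 + dot z eta4 * dot e4 th1.
    by rewrite {1}(coord z) !dot_lin.
  have thE z : dot z th = dot z s * dot P th + dot z r * dot R0 th + dot z eta3 * dot e3 th + dot z eta4 * dot e4 th.
    by rewrite {1}(coord z) !dot_lin.
  (* The pole of [<P, R, R1>] lies in the planes of [P], [R] and [R1]. *)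
  have C2 : dot R r * dot R1 th * dot P th1 + dot R1 r * dot R th1 * dot P th = 0.
    have [t [f [tn0 [Pt Rt R1t] pt]]] := gp.
    have g1 := pencil_reciprocity pP pt Pn0 Pt.
    have g2 := pencil_reciprocity pR pt Rn0 Rt.
    have g3 := pencil_reciprocity pR1 pt R1n0 R1t.
    have [fn0 tf _] := pt.
    have f3 a b d : a *: P + b *: R + d *: R1 = 0 -> [/\ a = 0, b = 0 & d = 0].
      move=> E.
      have h3 : b * dot R eta3 + d * dot R1 eta3 = 0.
        by have /(congr1 (fun z => dot z eta3)) := E; rewrite !dot_lin xP mulr0 add0r.
      have h4 : b * dot R eta4 + d * dot R1 eta4 = 0.
        by have /(congr1 (fun z => dot z eta4)) := E; rewrite !dot_lin yP mulr0 add0r.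
      have b0 : b = 0.
        apply: (mulfI Dn0); rewrite mulr0 -[RHS](_ : dot R1 eta3 * (b * dot R eta4 + d * dot R1 eta4)
          - dot R1 eta4 * (b * dot R eta3 + d * dot R1 eta3) = _); last by rewrite h3 h4; ring.
        by rewrite /D; ring.
      have d0 : d = 0.
        apply: (mulfI Dn0); rewrite mulr0 -[RHS](_ : dot R eta4 * (b * dot R eta3 + d * dot R1 eta3)
          - dot R eta3 * (b * dot R eta4 + d * dot R1 eta4) = _); last by rewrite h3 h4; ring.
        by rewrite /D; ring.
      split=> //; move: E; rewrite b0 d0 !scale0r !addr0 => /eqP.
      by rewrite scaler_eq0 (negPf Pn0) orbF => /eqP.
    (* The combinations of [P], [R], [R1] are [q^3] vectors orthogonal to [t], hence all of them. *)
    have [a [b [d fE]]] : exists a b d, f = a *: P + b *: R + d *: R1.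
      pose T := [set z | dot z t == 0].
      pose h (k : F * F * F) := k.1.1 *: P + k.1.2 *: R + k.2 *: R1.
      have hinj : injective h.
        move=> [[a b] d] [[a' b'] d']; rewrite /h /= => E.
        case: (f3 (a - a') (b - b') (d - d')) => [|/eqP + /eqP + /eqP]; last first.
          by rewrite !subr_eq0 => /eqP-> /eqP-> /eqP->.
        by rewrite !scalerBl [X in X + _]addrACA -opprD addrACA -opprD E subrr.
      have /eqP hT : [set h k | k in [set: F * F * F]] == T.
        rewrite eqEcard card_imset // cardsT card_orthogonal1 // !card_prod.
        rewrite !expnS expn0 muln1 mulnA leqnn andbT.
        by apply/subsetP => _ /imsetP[k _ ->]; rewrite inE /h !dot_lin Pt Rt R1t !mulr0 !addr0.
      have : f \in T by rewrite inE dotC tf.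
      by rewrite -hT => /imsetP[[[a b] d] _ ->]; exists a, b, d.
    have rRP z : dot z r * dot R0 thP = dot z thP by rewrite rE dotZr mulrAC mulVf // mul1r.
    have h1 : b * dot R r + d * dot R1 r = 0.
      apply: (mulIf PR0); rewrite mul0r mulrDl -!mulrA !rRP.
      by move: g1; rewrite fE !dot_lin PthP mulr0 add0r.
    have h2 : a * dot P th + d * dot R1 th = 0.
      have Rth : dot R th = 0 by case: pR.
      by move: g2; rewrite fE !dot_lin Rth mulr0 addr0.
    have h3 : a * dot P th1 + b * dot R th1 = 0.
      have Rth : dot R1 th1 = 0 by case: pR1.
      by move: g3; rewrite fE !dot_lin Rth mulr0 addr0.
    have dn0 : d != 0.
      apply: contraNneq fn0 => d0; move: h1 h2; rewrite d0 !mul0r !addr0 => /eqP.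
      rewrite mulf_eq0 (negPf rr) orbF => /eqP b0 /eqP; rewrite mulf_eq0 (negPf PR) orbF => /eqP a0.
      by rewrite fE a0 b0 d0 !scale0r !addr0.
    apply: (mulfI dn0); rewrite mulr0.
    rewrite -[RHS](_ : dot R r * dot P th1 * (a * dot P th + d * dot R1 th)
       - dot R r * dot P th * (a * dot P th1 + b * dot R th1)
       + dot P th * dot R th1 * (b * dot R r + d * dot R1 r) = _); last by rewrite h1 h2 h3; ring.
    by ring.
  have muE : mu' = mu.
    have : dot P th * dot P th1 * D * (mu' - mu) = 0.
      rewrite -[RHS]C2 (thE R1) (th1E R).
      have -> : dot R r * (dot R1 s * dot P th + dot R1 r * dot R0 th
            + dot R1 eta3 * dot e3 th + dot R1 eta4 * dot e4 th) * dot P th1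
        = (dot R1 s * dot R r * dot P th + dot R1 r * (dot R r * dot R0 th)
            + dot R1 eta3 * (dot R r * dot e3 th)
            - dot R1 eta4 * (- dot R r * dot e4 th)) * dot P th1 by ring.
      have -> : dot R1 r * (dot R s * dot P th1 + dot R r * dot R0 th1
            + dot R eta3 * dot e3 th1 + dot R eta4 * dot e4 th1) * dot P th
        = (dot R s * dot R1 r * dot P th1 + dot R r * (dot R1 r * dot R0 th1)
            + dot R eta3 * (dot R1 r * dot e3 th1)
            - dot R eta4 * (- dot R1 r * dot e4 th1)) * dot P th by ring.
      rewrite m1 m2 n1 n2.
      have -> : dot R r * dot R0 th = - (dot R s * dot P th) by apply/eqP; rewrite -addr_eq0 addrC E2.
      have -> : dot R1 r * dot R0 th1 = - (dot R1 s * dot P th1) by apply/eqP; rewrite -addr_eq0 addrC E1.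
      by rewrite /D; ring.
    move=> /eqP; rewrite !mulf_eq0 (negPf PR) (negPf P1) (negPf Dn0) /= subr_eq0 => /eqP //.
  have e3E : dot e3 th = mu * dot R eta4 * dot P th / dot R r by rewrite -muE -n1; field.
  have e4E : dot e4 th = - (mu * dot R eta3 * dot P th / dot R r) by rewrite -muE -n2; field.
  have R0E : dot R0 th = - (dot R s * dot P th / dot R r).
    by apply: (mulfI rr); apply/eqP; rewrite -subr_eq0 -E2; apply/eqP; field.
  rewrite (thE v) e3E e4E R0E /form; by field.

have agree (G : line F -> bool) : (forall l u v, free2 u v -> u \in val l -> v \in val l -> G l = (form u v == 0)) ->
    forall R th, pencil_at R th -> dot R thP != 0 ->
    ~ coplanar P R0 R1 R -> good_plane P R0 R -> good_plane P R R1 ->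
    forall l, R \in val l -> c l = (G l)%:R.
  move=> GE R th pR RP nc g1 g2 l Rl.
  have Rn0 : R != 0 by apply: contraNneq RP => ->; rewrite dot0l.
  have [v f vl] := line_free2_with Rn0 Rl.
  have [_ Rth ->] // := pR; rewrite (GE l R v) // (dual_free2 th f Rl vl) dotC Rth eqxx /=.
  rewrite dotC (formE R th) // mulf_eq0 oppr_eq0 mulf_eq0 invr_eq0.
  by rewrite (negPf (Pth _ _ pR RP)) (negPf (rn0 _ RP)).
(* For [mu = 0] the form is [s] wedge [r], and its isotropic lines are those that meet its radical
   [<e3, e4>]. *)
case: (eqVneq mu 0) => [mu0|mun0].
  have [m [me3 me4]] := line_of f34.
  exists (meets m); first by left; exists m.
  apply: agree => l u v f ul vl.
  have fth : free2 s r.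
    apply/free2P => a b E; split.
      by have /(congr1 (dot P)) := E; rewrite !dot_lin sP rP mulr1 mulr0 addr0.
    by have /(congr1 (dot R0)) := E; rewrite !dot_lin sR rR mulr1 mulr0 add0r.
  rewrite (meets_det fth _ _ f ul vl) ?(dual_free2 _ f34 me3 me4) ?(dotC s) ?(dotC r) ?s3 ?s4 ?r3 ?r4 ?eqxx //.
  by rewrite /form mu0 mul0r addr0.
pose M := s^T *m r - r^T *m s + mu *: (eta3^T *m eta4 - eta4^T *m eta3).
have ME x y : dot (x *m M) y = form x y.
  rewrite /M mulmxDr -scalemxAr !mulmxBr !dot_lin !dot_outer /form.
  by rewrite (dotC r) (dotC s) (dotC eta3) (dotC eta4).
have alt : alternating_mx M by move=> x; rewrite ME /form; ring.
exists (isotropic M); last first.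
  by apply: agree => l u v f ul vl; rewrite (isotropic_det alt f ul vl) ME.
right; exists M; split=> //; rewrite -row_free_unit; apply/eqP/rank_ker0 => x E.
have E0 y : form x y = 0 by rewrite -ME E dot0l.
have b1 : dot x s = 0 by rewrite -[RHS](E0 R0) /form sR rR xR yR; ring.
have b2 : dot x r = 0 by rewrite -[RHS]oppr0 -(E0 P) /form sP rP xP yP; ring.
have b3 : dot x eta3 = 0.
  by apply: (mulfI mun0); rewrite mulr0 -[RHS](E0 e4) /form s4 r4 x4 y4; ring.
have b4 : dot x eta4 = 0.
  by apply: (mulfI mun0); rewrite mulr0 -[RHS]oppr0 -(E0 e3) /form s3 r3 x3 y3; ring.
by rewrite (coord x) b1 b2 b3 b4 !scale0r !addr0.
Qed.

End Frame.
End NullPolarity.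

(** * Words of coefficient sum one *)

Lemma powers_ge (p : nat) : (19 <= p)%N -> [/\ (19 * p <= p ^ 2)%N, (19 * p ^ 2 <= p ^ 3)%N,
  (19 * p ^ 3 <= p ^ 4)%N & (19 * p ^ 4 <= p ^ 5)%N].
Proof.
move=> p19; have H n : (19 * p ^ n <= p ^ n.+1)%N by rewrite expnS leq_mul2r p19 orbT.
by split; [have := H 1%N; rewrite expn1 | apply: H..].
Qed.

(** The bound is [p^2 (p + 3)], and [(p + 3)(p - 2)] is at least [p^2 - 1]. *)
Lemma few_bad (p b : nat) : (19 <= p)%N -> (b * (p - 2) <= p ^ 2 * (p ^ 2 - 1))%N ->
  (b <= p ^ 3 + 3 * p ^ 2)%N.
Proof.
move=> p19 le; have [k pE] : exists k, p = k.+2 by exists (p - 2)%N; lia.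
have k0 : (0 < k)%N by lia.
rewrite -(leq_pmul2r k0); rewrite (_ : p - 2 = k)%N in le; last by lia.
apply: leq_trans le _; apply: leq_trans (_ : p ^ 2 * (p ^ 2 - 1) <= p ^ 2 * ((p + 3) * k))%N _.
  by rewrite leq_mul2l pE; apply/orP; right; rewrite -mulnn; nia.
by rewrite leq_eqVlt; apply/orP; left; apply/eqP; ring.
Qed.

(** An average: a good point lies on about [p] bad planes, and [p + 8] leaves room for lower order
    terms. The factor [p - 1] counts the multiples of a vector. *)
Lemma good_point_arith (p g b b' : nat) : (19 <= p)%N -> (g + b = p ^ 4 - 1)%N ->
  (b <= p ^ 3 + 3 * p ^ 2)%N -> (b' <= p ^ 3 + 3 * p ^ 2)%N ->
  (b' * (p ^ 3 - 1) < g * ((p - 1) * (p + 8)))%N.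
Proof.
move=> p19 gE hb hb'; have [k pE] : exists k, p = k.+1 by exists p.-1; lia.
have -> : (p - 1 = k)%N by lia.
have -> : (p ^ 3 - 1 = k * (p ^ 2 + p + 1))%N.
  by rewrite pE (_ : k.+1 ^ 3 = k * (k.+1 ^ 2 + k.+1 + 1) + 1)%N ?addnK // -addn1; ring.
rewrite mulnCA [(g * _)%N]mulnCA ltn_mul2l; apply/andP; split; first by lia.
have [h2 h3 h4 h5] := powers_ge p19.
have gge : (p ^ 4 <= g + p ^ 3 + 3 * p ^ 2 + 1)%N by lia.
apply: leq_ltn_trans (leq_mul hb' (leqnn _)) _.
rewrite -(ltn_add2r ((p ^ 3 + 3 * p ^ 2 + 1) * (p + 8))).
apply: leq_trans (_ : p ^ 4 * (p + 8) <= _)%N; last first.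
  by rewrite -mulnDl leq_mul2r; apply/orP; right; lia.
rewrite (_ : (_ + _)%N = p ^ 5 + 5 * p ^ 4 + 15 * p ^ 3 + 27 * p ^ 2 + p + 8)%N; last by ring.
by rewrite (_ : p ^ 4 * (p + 8) = p ^ 5 + 8 * p ^ 4)%N; [lia | ring].
Qed.

(** [z] may reach [p^4 / 2 + 4 p^3], so this comes down to [8 p^3 + 4 p^2 < p^4 / 2], the narrowest
    of these estimates. *)
Lemma third_point_arith (p b z : nat) : (19 <= p)%N -> (b <= p ^ 3 + 3 * p ^ 2)%N ->
  (2 * z <= (p + 8) * p ^ 3)%N -> (b + z + 2 * p ^ 3 + p ^ 2 < p ^ 4 - p ^ 3)%N.
Proof.
move=> p19 hb; have [h2 h3 h4 h5] := powers_ge p19.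
by rewrite mulnDl -expnS => hz; lia.
Qed.

(** [6 p^3] stands for [p^3] from each of two planes and [2 p^3] from each of two covers by bad
    planes. The left side is of order [14 p^4], the right side of order [p^5]. *)
Lemma agreement_arith (p b n : nat) : (19 <= p)%N -> (b <= p ^ 3 + 3 * p ^ 2)%N ->
  (n <= b + 6 * p ^ 3)%N -> (n * (2 * p) <= (p ^ 2 - 1) * (p ^ 3 + 2 * p ^ 2 + p + 1))%N.
Proof.
move=> p19 hb hn; have [h2 h3 h4 h5] := powers_ge p19.
apply: leq_trans (_ : (7 * p ^ 3 + 3 * p ^ 2) * (2 * p) <= _)%N.
  by rewrite leq_mul2r; apply/orP; right; lia.
rewrite mulnBl mul1n leq_subRL; last by rewrite leq_pmull // expn_gt0; lia.
have -> : (p ^ 2 * (p ^ 3 + 2 * p ^ 2 + p + 1) = p ^ 5 + 2 * p ^ 4 + p ^ 3 + p ^ 2)%N by ring.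
have -> : ((7 * p ^ 3 + 3 * p ^ 2) * (2 * p) = 14 * p ^ 4 + 6 * p ^ 3)%N by ring.
lia.
Qed.

Lemma pencil_arith p : ((p + 1) * (p ^ 2 - p) = p ^ 3 - p)%N.
Proof.
have e1 : ((p + 1) * p ^ 2 = p ^ 3 + p ^ 2)%N by ring.
have e2 : ((p + 1) * p = p + p ^ 2)%N by ring.
by rewrite mulnBr e1 e2 subnDr.
Qed.

Lemma star_arith p : ((p ^ 2 + p + 1) * (p ^ 2 - p) = p ^ 4 - p)%N.
Proof.
have e1 : ((p ^ 2 + p + 1) * p ^ 2 = p ^ 4 + (p ^ 3 + p ^ 2))%N by ring.
have e2 : ((p ^ 2 + p + 1) * p = p + (p ^ 3 + p ^ 2))%N by ring.
by rewrite mulnBr e1 e2 subnDr.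
Qed.

Section SmallWeight.
Variable F : finFieldType.
Let q := #|F|.
Implicit Types (u v w x y t : 'rV[F]_4) (l m : line F) (c : line F -> F).

Lemma card_nonfree u : u != 0 -> #|[set v | ~~ free2 u v]| = q.
Proof.
move=> un0; have -> : [set v | ~~ free2 u v] = [set k *: u | k in [set: F]].
  apply/setP => v; rewrite inE; apply/idP/imsetP => [/(free2PnE un0)[k ->]|[k _ ->]].
    by exists k.
  apply/negP => /free2P/(_ k (-1)) [|_ /eqP]; first by rewrite scaleN1r subrr.
  by rewrite oppr_eq0 oner_eq0.
rewrite card_imset ?cardsT // => b b' /eqP.
by rewrite -subr_eq0 -scalerBl scaler_eq0 (negPf un0) orbF subr_eq0 => /eqP.
Qed.

Lemma card_line_free u l : u != 0 -> u \in val l ->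
  #|[set v | (v \in val l) && free2 u v]| = (q ^ 2 - q)%N.
Proof.
move=> un0 ul; rewrite -(card_line l) -(card_nonfree un0).
have -> : [set v | ~~ free2 u v] = [set x | x \in val l] :&: [set v | ~~ free2 u v].
  apply/setP => v; rewrite !inE; case f : (free2 u v); rewrite ?andbF //=.
  by move/negbT: f => /(free2PnE un0)[k ->]; rewrite memvZ.
rewrite -cardsD; apply: eq_card => v; rewrite !inE.
by case: (v \in val l); case: (free2 u v).
Qed.

(** Lines through [u] are counted by their [q^2 - q] vectors independent of [u], each of which
    determines its line. *)
Lemma card_star u (X : pred (line F)) (Y : pred 'rV[F]_4) : u != 0 ->
  (forall l v, free2 u v -> u \in val l -> v \in val l -> X l = Y v) ->
  (#|[set l : line F | (u \in val l) && X l]| * (q ^ 2 - q) = #|[set v | free2 u v && Y v]|)%N.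
Proof.
move=> un0 XY; pose R l v := [&& u \in val l, X l, v \in val l & free2 u v].
transitivity (\sum_l #|[set v | R l v]|)%N.
  rewrite -sum_nat_const big_mkcond; apply: eq_bigr => l _; rewrite inE /R.
  case: (boolP (u \in val l)) => ul; last by rewrite eq_card0 // => v; rewrite inE.
  case: (X l); last by rewrite eq_card0 // => v; rewrite inE.
  by rewrite -(card_line_free un0 ul).
rewrite double_count -sum1_card [RHS]big_mkcond; apply: eq_bigr => v _; rewrite inE.
case: (boolP (free2 u v)) => f /=; last first.
  by rewrite eq_card0 // => l; rewrite inE /R (negPf f) !andbF.
have [l [ul vl]] := line_of f; case: (boolP (Y v)) => Yv; last first.
  rewrite eq_card0 // => m; rewrite inE; apply/negP => /and4P[um Xm vm _].
  by case/negP: Yv; rewrite -(XY m).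
rewrite (_ : [set m : line F | _] = [set l]) ?cards1 //; apply/setP => m; rewrite !inE.
apply/and4P/eqP => [[um _ vm _]|->]; first exact: (line_uniq f um vm ul vl).
by rewrite ul vl f (XY l v).
Qed.

Lemma card_pencil u t : u != 0 -> t != 0 -> dot u t = 0 ->
  #|[set l : line F | (u \in val l) && (t \in val (dual l))]| = (q + 1)%N.
Proof.
move=> un0 tn0 ut; have q1 : (1 < q)%N := card_gt1 F.
have pos : (0 < q ^ 2 - q)%N by rewrite subn_gt0 -[ltnLHS]expn1 ltn_exp2l.
apply/eqP; rewrite -(eqn_pmul2r pos) (card_star (Y := fun v => dot t v == 0) un0); last first.
  by move=> l v f ul vl; rewrite (dual_free2 t f ul vl) dotC ut eqxx.
have -> : [set v | free2 u v && (dot t v == 0)] = [set v | dot v t == 0] :\: [set v | ~~ free2 u v].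
  by apply/setP => v; rewrite !inE negbK dotC.
rewrite cardsD (setIidPr _) ?card_orthogonal1 ?card_nonfree //.
  by rewrite pencil_arith.
apply/subsetP => v; rewrite !inE => /(free2PnE un0)[k ->].
by rewrite dotZl ut mulr0.
Qed.

Lemma card_all_through u : u != 0 -> #|[set l : line F | u \in val l]| = (q ^ 2 + q + 1)%N.
Proof.
move=> un0; have q1 : (1 < q)%N := card_gt1 F.
have pos : (0 < q ^ 2 - q)%N by rewrite subn_gt0 -[ltnLHS]expn1 ltn_exp2l.
have -> : [set l : line F | u \in val l] = [set l : line F | (u \in val l) && true].
  by apply/setP => l; rewrite !inE andbT.
apply/eqP; rewrite -(eqn_pmul2r pos) (card_star (X := xpredT) (Y := xpredT) un0) //.
have -> : [set v | free2 u v && true] = ~: [set v | ~~ free2 u v].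
  by apply/setP => v; rewrite !inE negbK andbT.
have E : (#|[set v | ~~ free2 u v]| + #|~: [set v | ~~ free2 u v]| = q ^ 4)%N.
  by rewrite cardsC card_rV.
by rewrite star_arith -E card_nonfree // addKn.
Qed.

Lemma card_nonzero : #|[set u : 'rV[F]_4 | u != 0]| = (q ^ 4 - 1)%N.
Proof.
have := cardsC1 (0 : 'rV[F]_4); rewrite card_rV subn1 => <-.
by apply: eq_card => u; rewrite !inE.
Qed.

Lemma sum_through (X : {set line F}) :
  (\sum_(u : 'rV[F]_4 | u != 0%R) #|[set l : line F | (u \in val l) && (l \in X)]| = #|X| * (q ^ 2 - 1))%N.
Proof.
rewrite big_mkcond /=.
transitivity (\sum_u #|[set l : line F | [&& u != 0%R, u \in val l & l \in X]]|)%N.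
  by apply: eq_bigr => u _; case: ifP => // _; rewrite eq_card0 // => l; rewrite inE.
rewrite double_count -sum_nat_const [RHS]big_mkcond; apply: eq_bigr => l _.
case: ifP => lX; last by rewrite eq_card0 // => u; rewrite inE !andbF.
by rewrite -(card_line_neq0 l); apply: eq_card => u; rewrite !inE andbT.
Qed.

Definition bad c := [set u | (u != 0) && (2 * q - 1 <= #|through c u|)%N].

Lemma good_pencil c u : is_word 1 c -> u != 0 -> u \notin bad c -> exists t, pencil_at c u t.
Proof.
move=> cw un0; rewrite inE un0 -ltnNge => lt.
have [|[t [tn0 tu tE]]] := card_through1 cw un0; first by rewrite leqNgt lt.
by exists t; split=> //; rewrite dotC.
Qed.

Lemma card_through_pencil c u t : u != 0 -> pencil_at c u t -> #|through c u| = (q + 1)%N.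
Proof.
move=> un0 [tn0 ut uE]; rewrite -(card_pencil un0 tn0 ut).
apply: eq_card => l; rewrite !inE; case ul : (u \in val l) => //=.
by rewrite uE //; case: (_ \in _); rewrite ?oner_eq0 ?eqxx.
Qed.

(** A good point carries [q + 1] lines of the support, a bad one at least [q - 2] more. As
    [q^3 + 2 q^2 + q + 1] exceeds [(q^2 + 1)(q + 1)] by [q^2], the total excess over all nonzero
    vectors is at most [q^2 (q^2 - 1)]. *)
Lemma card_bad c : is_word 1 c -> (19 <= q)%N ->
  (#|[set l | c l != 0%R]| <= q ^ 3 + 2 * q ^ 2 + q + 1)%N ->
  (#|bad c| <= q ^ 3 + 3 * q ^ 2)%N.
Proof.
move=> cw q19 wt; apply: few_bad => //.
have S := sum_through [set l | c l != 0].
have lower : ((q ^ 4 - 1) * (q + 1) + #|bad c| * (q - 2) <=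
   \sum_(u : 'rV[F]_4 | u != 0%R) #|[set l : line F | (u \in val l) && (l \in [set l | c l != 0%R])]|)%N.
  rewrite -card_nonzero -!sum_nat_const.
  rewrite big_mkcond [X in (_ + X)%N]big_mkcond -big_split [leqRHS]big_mkcond; apply: leq_sum => u _ /=.
  rewrite inE; case: (eqVneq u 0) => [->|un0]; first by rewrite inE eqxx.
  rewrite (_ : [set l | _] = through c u); last by apply/setP => l; rewrite !inE.
  case: ifP => [|/negbT ub]; first by rewrite inE un0 /=; lia.
  by have [t pt] := good_pencil cw un0 ub; rewrite (card_through_pencil un0 pt) addn0.
rewrite S in lower; move: lower wt; move: #|_| #|_| (q) q19 => b s p p19 H1 H2.
have {H2}H1 := leq_trans H1 (leq_mul H2 (leqnn _)).
have e4 : (p ^ 4 - 1 = (p ^ 2 - 1) * (p ^ 2 + 1))%N.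
  by rewrite mulnDr muln1 mulnBl mul1n -expnD addnBA ?subnK // ?leq_exp2l //; lia.
have eW : ((p ^ 3 + 2 * p ^ 2 + p + 1) * (p ^ 2 - 1) = (p ^ 4 - 1) * (p + 1) + p ^ 2 * (p ^ 2 - 1))%N.
  by rewrite e4; move: (p ^ 2 - 1)%N => a; ring.
by move: H1; rewrite eW leq_add2l.
Qed.

End SmallWeight.

Section Reconstruction.
Variable F : finFieldType.
Let q := #|F|.
Implicit Types (u v w x y t : 'rV[F]_4) (l m : line F).

Lemma generator_ext (G H : line F -> bool) : G =1 H -> generator H -> generator G.
Proof.
move=> GH [H1 H2]; split=> u un0.
  by have [w wu wE] := H1 u un0; exists w => // l v f ul vl; rewrite GH; apply: wE.
by have [w wu wE] := H2 u un0; exists w => // l v f ul vl; rewrite GH; apply: wE.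
Qed.

Lemma generator_hyperplane (G : line F -> bool) : hyperplane G -> generator G.
Proof.
move=> [[m GE]|[M [alt uM GE]]]; apply: generator_ext GE _; first exact: generator_meets.
exact: generator_isotropic.
Qed.

Lemma badZ (c : line F -> F) k u : k != 0 -> (k *: u \in bad c) = (u \in bad c).
Proof.
move=> kn0; rewrite !inE scaler_eq0 (negPf kn0) /=; congr (_ && (_ <= #|pred_of_set _|)%N).
apply/setP => l; rewrite !inE; congr (_ && _).
apply/idP/idP => [ul|]; last exact: memvZ.
by rewrite -[u]scale1r -(mulVf kn0) -scalerA memvZ.
Qed.

Lemma sum_orthogonal (A : {set 'rV[F]_4}) : 0 \notin A ->
  (\sum_u #|[set t | (t \in A) && (dot u t == 0%R)]| = #|A| * q ^ 3)%N.
Proof.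
move=> A0; rewrite -(incidence_moment1 A0); apply: eq_bigr => u _.
by apply: eq_card => t; rewrite !inE dotC.
Qed.

Section Word.
Variable c : line F -> F.
Hypotheses (cw : is_word 1 c) (q19 : (19 <= q)%N)
  (wt : (#|[set l | c l != 0%R]| <= q ^ 3 + 2 * q ^ 2 + q + 1)%N).

Let q1 : (1 < q)%N. Proof. by apply: leq_trans q19. Qed.

Let B := bad (fun l => c (dual l)).

Let cB : (#|B| <= q ^ 3 + 3 * q ^ 2)%N.
Proof.
apply: card_bad => //; first exact: is_word_dual.
have -> : [set l | c (dual l) != 0] = @dual F @^-1: [set l | c l != 0].
  by apply/setP => l; rewrite !inE.
by rewrite card_preimset //; apply: can_inj (@dualK F).
Qed.

Let B0 : 0 \notin B. Proof. by rewrite inE eqxx. Qed.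

Let plane_pencil t : t != 0 -> t \notin B -> exists f, pencil_in c t f.
Proof.
move=> tn0 tB; have [f [fn0 tf fE]] := good_pencil (is_word_dual cw) tn0 tB.
exists f; split=> // l tl; have := fE (dual l) tl; rewrite !dualK //.
Qed.

Definition bad_planes (X : {set 'rV[F]_4}) (u : 'rV[F]_4) :=
  [set t | (t \in X) && (dot u t == 0)].

Let mem_bad_planes X u t : (t \in bad_planes X u) = (t \in X) && (dot u t == 0).
Proof. by rewrite inE. Qed.

Let good_point_exists : exists u, [/\ u != 0, u \notin bad c &
  (#|bad_planes B u| <= (q - 1) * (q + 8))%N].
Proof.
pose Gd := [set u | (u != 0) && (u \notin bad c)].
case: (pickP [pred u | (u \in Gd) && (#|bad_planes B u| <= (q - 1) * (q + 8))%N]) => [u|none].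
  by rewrite /= inE => /andP[/andP[u0 ub] le]; exists u.
have gE : (#|Gd| + #|bad c| = q ^ 4 - 1)%N.
  rewrite -(card_nonzero F) -(cardsID (bad c) [set u | u != 0]) addnC; congr (_ + _)%N.
    by apply: eq_card => u; rewrite !inE; case: (u != 0).
  by apply: eq_card => u; rewrite !inE andbC.
have := good_point_arith q19 gE (card_bad cw q19 wt) cB; rewrite ltnNge => /negP[].
have -> : (#|B| * (q ^ 3 - 1) = \sum_(u : 'rV[F]_4 | u != 0%R) #|bad_planes B u|)%N.
  have := sum_orthogonal B0; rewrite (bigD1 0) //= mulnBr muln1 => <-.
  rewrite -/(bad_planes B 0) (_ : bad_planes B 0 = B) ?addKn //.
  by apply/setP => t; rewrite !inE dot0l eqxx andbT.
rewrite -sum_nat_const big_mkcond [leqRHS]big_mkcond; apply: leq_sum => u _.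
case: ifP => uG //; have := none u; rewrite /= uG /= leqNgt => /negbFE lt.
by move: uG; rewrite inE => /andP[-> _]; apply: ltnW.
Qed.

Let sum_bad_planes (X : {set 'rV[F]_4}) : X \subset B ->
  (\sum_u #|bad_planes X u| = #|X| * q ^ 3)%N.
Proof. by move=> XB; apply: sum_orthogonal; apply: contra B0; apply: (subsetP XB). Qed.

(** Some nonzero [t] is always orthogonal to three vectors; the assumption only has to exclude that
    it is bad. *)
Let good_planeP u v w :
  ~~ [exists t, (t \in bad_planes (bad_planes B u) v) && (dot w t == 0)] ->
  good_plane c u v w.
Proof.
rewrite negb_exists => /forallP H.
have [t tn0 /eqP] := @exists_orthogonal _ _ _ (col_mx (col_mx u v) w) (isT : 3 < 4)%N.
rewrite !tr_col_mx !mul_mx_row !row_mx_eq0 !mulmx_tr_eq0 !(dotC t) => /andP[/andP[tu tv] tw].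
have tB : t \notin B.
  by apply/negP => tB; have := H t; rewrite !mem_bad_planes tB tu tv tw.
have [f pf] := plane_pencil tn0 tB; exists t, f; split=> //.
by split; apply/eqP.
Qed.

(** A covered [w] is orthogonal to some [t] in [X] and to its [q - 1] nonzero multiples, so it takes
    part in at least [q - 1] of the [#|X| * q^3] incidences. *)
Let card_cover (X : {set 'rV[F]_4}) (k : nat) : X \subset B ->
  (forall a t, a != 0 -> (a *: t \in X) = (t \in X)) -> (#|X| <= 2 * (q - 1))%N ->
  (#|[set w | [exists t, (t \in X) && (dot w t == 0%R)]]| <= 2 * q ^ 3)%N.
Proof.
move=> XB XZ cX; have pos : (0 < q - 1)%N by rewrite subn_gt0.
rewrite -(leq_pmul2r pos); apply: leq_trans (_ : #|X| * q ^ 3 <= _)%N; last first.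
  by rewrite mulnAC leq_mul2r cX orbT.
rewrite -(sum_bad_planes XB) -sum_nat_const big_mkcond; apply: leq_sum => w _.
case: ifP => //; rewrite inE => /existsP[t /andP[tX wt0]].
have tn0 : t != 0 by apply: contraNneq B0 => <-; apply: (subsetP XB).
rewrite -(card_multiples tn0); apply/subset_leq_card/subsetP => _ /imsetP[k' + ->].
by rewrite inE => kn0; rewrite inE XZ // tX dotZr mulf_eq0 wt0 orbT.
Qed.

Let bad_planesZ (X : {set 'rV[F]_4}) u : (forall a t, a != 0 -> (a *: t \in X) = (t \in X)) ->
  forall a t, a != 0 -> (a *: t \in bad_planes X u) = (t \in bad_planes X u).
Proof.
by move=> XZ a t an0; rewrite !mem_bad_planes XZ // dotZr mulf_eq0 (negPf an0).
Qed.

Let bad_planes_sub (X : {set 'rV[F]_4}) u : bad_planes X u \subset X.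
Proof. by apply/subsetP => t; rewrite mem_bad_planes => /andP[]. Qed.

(** The vectors in a bad plane through [u] and [v]; for any other [w], [good_planeP] applies. *)
Let cover u v := [set w | [exists t, (t \in bad_planes (bad_planes B u) v) && (dot w t == 0)]].

Let card_cover2 u v : (#|bad_planes (bad_planes B u) v| <= 2 * (q - 1))%N ->
  (#|cover u v| <= 2 * q ^ 3)%N.
Proof.
move=> le; apply: card_cover => //.
  exact: subset_trans (bad_planes_sub _ _) (bad_planes_sub _ _).
by do 2 apply: bad_planesZ; apply: badZ.
Qed.

Lemma card_affine (t : 'rV[F]_4) : t != 0 -> #|[set u | dot u t != 0]| = (q ^ 4 - q ^ 3)%N.
Proof.
move=> tn0; have E : (#|[set u | dot u t == 0%R]| + #|[set u | dot u t != 0%R]| = q ^ 4)%N.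
  rewrite -[RHS](card_rV F 4) -(cardsC [set u | dot u t == 0]); congr (_ + _)%N.
  by apply: eq_card => u; rewrite !inE.
by rewrite -E card_orthogonal1 // addKn.
Qed.

Lemma word_hyperplane : exists2 G, hyperplane G & forall l, c l = (G l)%:R.
Proof.
have cbad := card_bad cw q19 wt; have c0 := cB.
have [P [Pn0 Pb BP]] := good_point_exists.
have [thP pP] := good_pencil cw Pn0 Pb.
have thn0 : thP != 0 by case: pP.
pose O := [set u | dot u thP != 0].
have cO : #|O| = (q ^ 4 - q ^ 3)%N := card_affine thn0.
(* For [u] in [Z] more than two bad planes pass through [P] and [u], and [cover P u] has no useful
   bound. This is the set that may take up half of the space. *)
pose Z := [set u | (2 * (q - 1) < #|bad_planes (bad_planes B P) u|)%N].
have cZ : (2 * #|Z| <= (q + 8) * q ^ 3)%N.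
  have pos : (0 < q - 1)%N by rewrite subn_gt0.
  rewrite -(leq_pmul2l pos); apply: leq_trans (_ : #|bad_planes B P| * q ^ 3 <= _)%N; last first.
    by rewrite mulnA leq_mul2r BP orbT.
  rewrite -(sum_bad_planes (bad_planes_sub B P)) mulnA mulnC -sum_nat_const big_mkcond.
  apply: leq_sum => u _; case: ifP => //; rewrite inE mulnC; exact: ltnW.
have On0 u : u \in O -> u != 0 by rewrite inE; apply: contraNneq => ->; rewrite dot0l.
have pick_out (X : {set 'rV[F]_4}) : (#|X| < #|O|)%N -> exists2 u, u \in O & u \notin X.
  move=> lt; apply/exists_inP; rewrite -negb_forall_in; apply/negP => /forall_inP H.
  by move: lt; rewrite ltnNge => /negP[]; apply/subset_leq_card/subsetP => u /H.
have third (X : {set 'rV[F]_4}) : (#|X| <= #|bad c| + #|Z| + 2 * q ^ 3 + q ^ 2)%N ->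
    exists2 u, u \in O & u \notin X.
  move=> le; apply: pick_out; rewrite cO; apply: leq_ltn_trans le _.
  exact: third_point_arith.
have [|R0 R0O] := third (bad c :|: Z).
  by apply: leq_trans (leq_card_setU _ _) _; rewrite -addnA leq_addr.
rewrite inE negb_or => /andP[R0b R0Z].
have R0n0 := On0 _ R0O; have [th0 pR0] := good_pencil cw R0n0 R0b.
have R0P : dot R0 thP != 0 by move: R0O; rewrite inE.
have cY0 : (#|cover P R0| <= 2 * q ^ 3)%N.
  by apply: card_cover2; rewrite leqNgt; move: R0Z; rewrite inE.
pose T := [set k.1 *: P + k.2 *: R0 | k in [set: F * F]].
have cT : (#|T| <= q ^ 2)%N.
  by apply: leq_trans (leq_imset_card _ _) _; rewrite cardsT card_prod mulnn.
have [|R1 R1O] := third (bad c :|: Z :|: cover P R0 :|: T).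
  do 3 (apply: leq_trans (leq_card_setU _ _) _; apply: leq_add => //).
rewrite !in_setU !negb_or => /andP[/andP[/andP[R1b R1Z] R1Y] R1T].
have R1n0 := On0 _ R1O; have [th1 pR1] := good_pencil cw R1n0 R1b.
have R1P : dot R1 thP != 0 by move: R1O; rewrite inE.
have cY1 : (#|cover P R1| <= 2 * q ^ 3)%N.
  by apply: card_cover2; rewrite leqNgt; move: R1Z; rewrite inE.
have nR1 : ~ (exists a b, R1 = a *: P + b *: R0).
  by move=> [a [b E]]; case/negP: R1T; apply/imsetP; exists (a, b); rewrite ?inE.
have gp1 : good_plane c P R0 R1 by apply: good_planeP; move: R1Y; rewrite inE.
have [G hG agree] := null_polarity Pn0 pP pR0 R0P pR1 R1P nR1 gp1.
exists G => //; have gG := generator_hyperplane hG.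
have dw := is_word_sub cw gG; rewrite subrr in dw.
pose C := [set k.1.1 *: P + k.1.2 *: R0 + k.2 *: R1 | k in [set: F * F * F]].
have cC : (#|C| <= q ^ 3)%N.
  apply: leq_trans (leq_imset_card _ _) _; rewrite cardsT !card_prod.
  by rewrite !expnS expn0 muln1 mulnA.
(* Outside these sets [null_polarity] applies to [u], so the difference vanishes on all lines
   through [u]. *)
have sub : active (fun l => c l - (G l)%:R) \subset bad c :|: ~: O :|: cover P R0 :|: cover P R1 :|: C.
  apply/subsetP => u; apply: contraLR; rewrite !in_setU !negb_or in_setC negbK.
  move=> /andP[/andP[/andP[/andP[ub uO] uY0] uY1] uC].
  have un0 := On0 _ uO; have [th pu] := good_pencil cw un0 ub.
  rewrite inE un0 /= negbK; apply/eqP/setP => l; rewrite !inE.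
  case: (boolP (u \in val l)) => //= ul.
  rewrite (agree u th) ?subrr ?eqxx //.
  - by move: uO; rewrite inE.
  - by move=> [a [b [d E]]]; case/negP: uC; apply/imsetP; exists (a, b, d); rewrite ?inE.
  - by apply: good_planeP; move: uY0; rewrite inE.
  suff [t [f [tn0 [t1 t2 t3] pt]]] : good_plane c P R1 u by exists t, f.
  by apply: good_planeP; move: uY1; rewrite inE.
have cOC : #|~: O| = (q ^ 3)%N.
  by rewrite -(card_orthogonal1 thn0); apply: eq_card => u; rewrite !inE negbK.
have cA : (#|active (fun l => c l - (G l)%:R)%R| <= #|bad c| + 6 * q ^ 3)%N.
  apply: leq_trans (subset_leq_card sub) _.
  have -> : (#|bad c| + 6 * q ^ 3 = #|bad c| + q ^ 3 + 2 * q ^ 3 + 2 * q ^ 3 + q ^ 3)%N by ring.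
  do 4 (apply: leq_trans (leq_card_setU _ _) _; apply: leq_add => //).
  by rewrite cOC.
have hz := hull_zero dw q19 (agreement_arith q19 cbad cA).
by move=> l; apply/eqP; rewrite -subr_eq0 hz.
Qed.

End Word.
End Reconstruction.

(** * Weights of hyperplanes, and reguli *)

Section HyperplaneWeights.
Variable F : finFieldType.
Let q := #|F|.
Implicit Types (u v w x y t : 'rV[F]_4) (l m : line F) (M : 'M[F]_4).

Let q1 : (1 < q)%N. Proof. exact: card_gt1. Qed.
Let q2 : (0 < q ^ 2 - 1)%N.
Proof. by rewrite subn_gt0 -{1}(exp1n 2) ltn_sqr. Qed.

Lemma q4_factor : (q ^ 4 - 1 = (q ^ 2 + 1) * (q ^ 2 - 1))%N.
Proof.
by rewrite mulnBr muln1 mulnDl mul1n -expnD [(q ^ 2 + 1)%N]addnC subnDr.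
Qed.

(** The isotropic lines through [u] form the pencil in the plane [u *m M]. *)
Lemma card_isotropic M : alternating_mx M -> M \in unitmx ->
  #|[set l | isotropic M l]| = (q ^ 3 + q ^ 2 + q + 1)%N.
Proof.
move=> alt uM; apply/eqP; rewrite -(eqn_pmul2r q2) -sum_through.
rewrite (eq_bigr (fun _ => (q + 1)%N)) => [|u un0].
  rewrite sum_nat_const (_ : #|_| = (q ^ 4 - 1)%N); last first.
    by rewrite -(card_nonzero F); apply: eq_card => u; rewrite !inE.
  rewrite q4_factor; apply/eqP; move: (q ^ 2 - 1)%N => a; ring.
have uMn0 : u *m M != 0.
  by apply: contraNneq un0 => E; rewrite -[u](mulmxK uM) E mul0mx.
rewrite -(card_pencil un0 uMn0); last by rewrite dotC.
apply: eq_card => l; rewrite !inE; case: (boolP (u \in val l)) => //= ul.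
have [v f vl] := line_free2_with un0 ul.
by rewrite (isotropic_det alt f ul vl) (dual_free2 _ f ul vl) alt eqxx.
Qed.

(** Every line through a point of [m] meets [m]; through a point off [m], those that do form the
    pencil in the plane joining it to [m]. *)
Lemma card_meets m : #|[set l | meets m l]| = (q ^ 3 + 2 * q ^ 2 + q + 1)%N.
Proof.
apply/eqP; rewrite -(eqn_pmul2r q2) -sum_through (bigID [in val m]) /=.
rewrite (eq_bigr (fun _ => (q ^ 2 + q + 1)%N)) => [|u /andP[un0 um]]; last first.
  rewrite -(card_all_through un0); apply: eq_card => l; rewrite !inE andb_idr // => ul.
  by apply/meetsP; exists u.
rewrite [X in (_ + X)%N](eq_bigr (fun _ => (q + 1)%N)) => [|u /andP[un0 um]]; last first.
  have [t1 [t2 [f t1m t2m]]] := line_free2 (dual m).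
  (* The plane through [m] that contains [u]. *)
  pose w := dot u t1 *: t2 - dot u t2 *: t1.
  have uw : dot u w = 0 by rewrite /w !dot_lin; ring.
  have wn0 : w != 0.
    apply: contraNneq um => w0; rewrite -[m]dualK (dual_free2 u f t1m t2m).
    have /free2P/(_ (- dot u t2) (dot u t1)) := f; rewrite addrC scaleNr => /(_ w0)[/eqP + ->].
    by rewrite oppr_eq0 => ->; rewrite eqxx.
  rewrite -(card_pencil un0 wn0 uw); apply: eq_card => l; rewrite !inE.
  case: (boolP (u \in val l)) => //= ul; have [v g vl] := line_free2_with un0 ul.
  rewrite (meets_det f t1m t2m g ul vl) (dual_free2 w g ul vl) (dotC w u) uw eqxx /w /= !dot_lin.
  by rewrite !(dotC _ v); congr (_ == 0); ring.
rewrite !sum_nat_const.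
rewrite (_ : #|_| = (q ^ 2 - 1)%N); last first.
  by rewrite -(card_line_neq0 m); apply: eq_card => u; rewrite !inE.
rewrite (_ : #|_| = ((q ^ 2) * (q ^ 2 - 1))%N).
  by apply/eqP; move: (q ^ 2 - 1)%N => a; ring.
apply/eqP; rewrite -(eqn_add2l (q ^ 2 - 1)) -{2}[(q ^ 2 - 1)%N]mul1n -mulnDl addnC [(1 + _)%N]addnC -q4_factor.
rewrite -(card_nonzero F) -(card_line_neq0 m) addnC
  -(cardsID [set u | (u != 0) && (u \in val m)] [set u | u != 0]).
apply/eqP; congr (_ + _)%N; apply: eq_card => u; first by rewrite !inE; case: (u != 0).
by rewrite [LHS]unfold_in !inE; case: (u != 0) => //=; rewrite andbT.
Qed.

End HyperplaneWeights.

(** * Roots of quadratics, counted on the projective line *)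

Section Quadratics.
Variable F : finFieldType.
Implicit Types A B C : F.

Let sum_one (P : pred F) (x : F) : (forall t, P t = (t == x)) -> \sum_t ((P t)%:R : F) = 1.
Proof.
move=> PE; rewrite (bigD1 x) //= PE eqxx big1 ?addr0 // => t; rewrite PE.
by move=> /negPf ->.
Qed.

Let sum_linear B C : B != 0 -> \sum_t ((0 * t ^+ 2 + B * t + C == 0)%:R : F) = 1.
Proof.
move=> B0; apply: (sum_one (x := - (C / B))) => t; rewrite mul0r add0r -[RHS](inj_eq (mulfI B0)).
by rewrite mulrN mulrCA mulfV // mulr1 addr_eq0.
Qed.

Let sum_const B C : B = 0 -> \sum_t ((0 * t ^+ 2 + B * t + C == 0)%:R : F) + 1 = 1.
Proof.
move=> ->; rewrite (eq_bigr (fun _ => (C == 0)%:R)) ?sum_cst ?add0r // => t _.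
by rewrite !mul0r !add0r.
Qed.

(** The summand [A == 0] is the root at infinity. If [A != 0], the bijection [t |-> 2 A t + B] turns
    roots into square roots of the discriminant. The count thus depends on the discriminant
    alone. *)
Lemma quadratic_count A B C : 2%:R != 0 :> F ->
  \sum_t ((A * t ^+ 2 + B * t + C == 0)%:R : F) + (A == 0)%:R =
  \sum_s ((s ^+ 2 == B ^+ 2 - 4%:R * A * C)%:R : F).
Proof.
move=> two; case: (eqVneq A 0) => [->|A0]; last first.
  have inj : injective (fun t => 2%:R * A * t + B).
    by move=> t t' /addIr /(mulfI (mulf_neq0 two A0)).
  rewrite addr0 [RHS](reindex_inj inj) /=; apply: eq_bigr => t _; congr ((nat_of_bool _)%:R).
  have n0 : 4%:R * A != 0 by rewrite mulf_neq0 // (natrM _ 2 2) mulf_neq0.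
  rewrite -(inj_eq (mulfI n0)) mulr0 -[RHS]subr_eq0; congr (_ == 0); ring.
rewrite mulr0 mul0r subr0; case: (eqVneq B 0) => [B0|B0].
  rewrite sum_const // B0 expr0n /= (sum_one (x := 0)) // => s.
  by rewrite expf_eq0.
rewrite sum_linear // (bigD1 B) //= eqxx (bigD1 (- B)) /=; last first.
  by rewrite -subr_eq0 -opprD oppr_eq0 -mulr2n -mulr_natl mulf_neq0.
rewrite sqrrN eqxx big1 ?addr0 // => s /andP[s1 s2].
by rewrite eqf_sqr (negPf s1) (negPf s2).
Qed.

(** If [B != 0], roots come in pairs [t], [t + B / A], or one is finite and one infinite. If only
    [B] vanishes, bijectivity of squaring gives a single root. If [A = B = 0], there are [0] or [q]
    finite roots besides infinity. *)
Lemma quadratic_count2 A B C : 2%:R = 0 :> F ->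
  \sum_t ((A * t ^+ 2 + B * t + C == 0)%:R : F) + (A == 0)%:R = (B == 0)%:R.
Proof.
move=> two; have dbl (x : F) : x + x = 0 by rewrite -mulr2n -mulr_natl two mul0r.
case: (eqVneq A 0) => [->|A0].
  by case: (eqVneq B 0) => [B0|B0]; [apply: sum_const | rewrite sum_linear].
rewrite addr0; case: (eqVneq B 0) => [->|B0].
  have sqr_inj : injective (fun t : F => t ^+ 2).
    move=> x y /eqP; rewrite eqf_sqr => /orP[/eqP //|/eqP ->].
    by apply/eqP; rewrite -subr_eq0 -opprD dbl oppr0.
  have [g _ gK] : bijective (fun t : F => t ^+ 2) := injF_bij sqr_inj.
  apply: (sum_one (x := g (- (C / A)))) => t; rewrite mul0r addr0 -[RHS](inj_eq sqr_inj) gK.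
  by rewrite /= -[RHS](inj_eq (mulfI A0)) mulrN [A * (C / A)]mulrC divfK // addr_eq0.
case: (pickP [pred t | A * t ^+ 2 + B * t + C == 0]) => [t0 /= /eqP E|none]; last first.
  by rewrite big1 // => t _; have /= -> := none t.
rewrite (bigD1 t0) //= E eqxx (bigD1 (t0 + B / A)) /=; last first.
  by rewrite -subr_eq0 addrAC subrr add0r mulf_neq0 // invr_neq0.
rewrite (_ : _ + _ + C = (A * t0 ^+ 2 + B * t0 + C) + (B * t0 + B * t0) + (B ^+ 2 / A + B ^+ 2 / A)); last by field.
rewrite E !dbl ?addr0 eqxx big1 ?addr0 ?dbl // => t /andP[t1 t2].
case: eqP => // E'; have : (t - t0) * (A * (t - (t0 + B / A)) ) = 0.
  rewrite -[RHS](_ : (A * t ^+ 2 + B * t + C) - (A * t0 ^+ 2 + B * t0 + C)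
    - (A * t0 * (t - t0) + A * t0 * (t - t0)) - (B * (t - t0) + B * (t - t0)) = _); last by rewrite E E' !dbl ?subr0.
  by field.
by move=> /eqP; rewrite !mulf_eq0 !subr_eq0 (negPf t1) (negPf t2) (negPf A0).
Qed.

End Quadratics.

(** * Symplectic bases and reguli *)

Section Regulus.
Variable F : finFieldType.
Implicit Types (u v w x y : 'rV[F]_4) (l : line F) (M : 'M[F]_4).

Definition symplectic_basis M e1 e2 e3 e4 :=
  [/\ dot (e1 *m M) e4 = 1, dot (e2 *m M) e3 = 1,
      dot (e1 *m M) e2 = 0 /\ dot (e1 *m M) e3 = 0 &
      dot (e2 *m M) e4 = 0 /\ dot (e3 *m M) e4 = 0].

Lemma nondegenerate_unit M : (forall x, (forall y, dot (x *m M) y = 0) -> x = 0) -> M \in unitmx.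
Proof.
move=> H; rewrite -row_free_unit; apply/eqP/rank_ker0 => x E; apply: H => y.
by rewrite E dot0l.
Qed.

Lemma unit_pairing M x : M \in unitmx -> x != 0 -> exists y, dot (x *m M) y = 1.
Proof.
move=> uM xn0; have [y yn0] : exists y, dot (x *m M) y != 0.
  apply/existsP; apply: contraNT xn0; rewrite negb_exists => /forallP H.
  have E : x *m M = 0 by apply: dot_eq0_all => y; apply/eqP; have := H y; rewrite negbK.
  by rewrite -[x](mulmxK uM) E mul0mx.
by exists ((dot (x *m M) y)^-1 *: y); rewrite dotZr mulVf.
Qed.

Lemma exists_symplectic_basis M : alternating_mx M -> M \in unitmx ->
  exists e1 e2 e3 e4, symplectic_basis M e1 e2 e3 e4.
Proof.
move=> alt uM; pose b x y := dot (x *m M) y.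
have bDr x y z : b x (y + z) = b x y + b x z by rewrite /b dotDr.
have bZr k x y : b x (k *: y) = k * b x y by rewrite /b dotZr.
have bDl x y z : b (x + y) z = b x z + b y z by rewrite /b mulmxDl dotDl.
have bZl k x y : b (k *: x) y = k * b x y by rewrite /b -scalemxAl dotZl.
have bb x : b x x = 0 by apply: alt.
have bC x y : b x y = - b y x by apply: alternating_skew.
have [e1 e1n0] : exists e1 : 'rV[F]_4, e1 != 0.
  exists (delta_mx 0 0); apply/eqP => /rowP/(_ 0); rewrite !mxE => /eqP.
  by rewrite oner_eq0.
have [e4 e14] := unit_pairing uM e1n0; rewrite -/(b e1 e4) in e14.
have e41 : b e4 e1 = -1 by rewrite bC e14.
(* The orthogonal projection onto the complement of the hyperbolic plane [<e1, e4>]. *)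
pose pr x := x + (- b e1 x) *: e4 + b e4 x *: e1.
have pr1 x : b e1 (pr x) = 0 by rewrite /pr !bDr !bZr e14 bb; ring.
have pr4 x : b e4 (pr x) = 0 by rewrite /pr !bDr !bZr e41 bb; ring.
have [x xout] := exists_notin_image (fun k : F * F => k.1 *: e1 + k.2 *: e4) (ltn_card_rV2 F (isT : 2 < 4)%N).
have prx : pr x != 0.
  apply/eqP => E; have /eqP[] := xout (- b e4 x, b e1 x).
  by apply/eqP; rewrite -subr_eq0 -[X in _ == X]E /pr /=; apply/eqP; row_ring.
have [y bxy] := unit_pairing uM prx; rewrite -/(b (pr x) y) in bxy.
exists e1, (pr x), (pr y), e4; split=> //; last 1 first.
- by split; rewrite -/(b _ _) bC pr4 oppr0.
- rewrite -/(b _ _) {2}/pr !bDr !bZr bxy [b (pr x) e4]bC [b (pr x) e1]bC pr4 pr1; ring.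
- by split; apply: pr1.
Qed.

Lemma free2_form M x y z w : dot (x *m M) z != 0 -> dot (y *m M) z = 0 ->
  dot (y *m M) w != 0 -> free2 x y.
Proof.
move=> xz yz yw; apply/free2P => a b E.
have a0 : a = 0.
  apply: (mulIf xz); rewrite mul0r -[RHS](dot0l z) -[0 in RHS](mul0mx _ M) -E.
  by rewrite mulmxDl -!scalemxAl !dot_lin yz mulr0 addr0.
split=> //; apply: (mulIf yw); rewrite mul0r -[RHS](dot0l w) -[0 in RHS](mul0mx _ M) -E.
by rewrite mulmxDl -!scalemxAl !dot_lin a0 mul0r add0r.
Qed.

Lemma line_family (f g : F -> 'rV[F]_4) : (forall t, free2 (f t) (g t)) ->
  exists L : F -> line F, forall t, f t \in val (L t) /\ g t \in val (L t).
Proof. by move=> H; apply: (fin_all_exists (fun t => line_of (H t))). Qed.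

(* The lines [<e1 + t e3, e2 + t e4>], [<e3, e4>] and the lines
   [<e1 + s e2, e3 + s e4>], [<e2, e4>] are the reguli of a hyperbolic quadric. *)
Lemma regulus_lines M e1 e2 e3 e4 : alternating_mx M -> symplectic_basis M e1 e2 e3 e4 ->
  [/\ forall t, free2 (e1 + t *: e3) (e2 + t *: e4), free2 e3 e4,
      forall s, free2 (e1 + s *: e2) (e3 + s *: e4) & free2 e2 e4].
Proof.
move=> alt [b14 b23 [b12 b13] [b24 b34]].
have bC := alternating_skew alt.
have b32 : dot (e3 *m M) e2 = -1 by rewrite bC b23.
have b42 : dot (e4 *m M) e2 = 0 by rewrite bC b24 oppr0.
have b43 : dot (e4 *m M) e3 = 0 by rewrite bC b34 oppr0.
have b41 : dot (e4 *m M) e1 = -1 by rewrite bC b14.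
have n1 : (-1 : F) != 0 by rewrite oppr_eq0 oner_eq0.
split=> [t||s|].
- apply: (@free2_form M _ _ e4 e3); rewrite mulmxDl -scalemxAl !dot_lin ?b14 ?b34 ?b24 ?b23 ?b43 ?alt
    ?mulr0 ?addr0 ?oner_eq0 //.
- by apply: (@free2_form M _ _ e2 e1); rewrite ?b32 ?b42 ?b41.
- apply: (@free2_form M _ _ e4 e2); rewrite mulmxDl -scalemxAl !dot_lin ?b14 ?b24 ?b34 ?b32 ?b42 ?alt
    ?mulr0 ?addr0 ?oner_eq0 //.
- by apply: (@free2_form M _ _ e3 e1); rewrite ?b23 ?b43 ?b41 ?oner_eq0.
Qed.

(* The intersection numbers of a line with the two reguli of a hyperbolic
   quadric are numbers of roots of quadratics with the same discriminant. *)
Lemma isotropic_not_sum_meets M (I : finType) (a : I -> F) (m : I -> line F) (s : F) :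
  2%:R != 0 :> F -> alternating_mx M -> M \in unitmx ->
  (forall l, s * (isotropic M l)%:R = \sum_i a i * (meets (m i) l)%:R) -> s = 0.
Proof.
move=> two alt uM E.
have [e1 [e2 [e3 [e4 sb]]]] := exists_symplectic_basis alt uM.
have [f1 f2 f3 f4] := regulus_lines alt sb.
have [L LE] := line_family f1; have [Lo [Lo3 Lo4]] := line_of f2.
have [K KE] := line_family f3; have [Ko [Ko2 Ko4]] := line_of f4.
pose Lam (c : line F -> F) := (\sum_t c (L t) + c Lo) - (\sum_t c (K t) + c Ko).
have Lmeets l : Lam (fun k : line F => (meets l k)%:R) = 0.
  have [t1 [t2 [g t1l t2l]]] := line_free2 (dual l).
  pose om x y := dot x t1 * dot y t2 - dot x t2 * dot y t1.
  have mE (k : line F) x y : free2 x y -> x \in val k -> y \in val k -> meets l k = (om x y == 0).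
    by move=> h xk yk; rewrite (meets_det g t1l t2l h xk yk).
  apply/eqP; rewrite subr_eq0; apply/eqP.
  rewrite (mE Lo _ _ f2 Lo3 Lo4) (mE Ko _ _ f4 Ko2 Ko4).
  transitivity (\sum_t ((om e3 e4 * t ^+ 2 + (om e1 e4 + om e3 e2) * t + om e1 e2 == 0)%:R : F)
    + (om e3 e4 == 0)%:R).
    congr (_ + _); apply: eq_bigr => t _; have [Lt1 Lt2] := LE t.
    rewrite (mE _ _ _ (f1 t) Lt1 Lt2); congr ((nat_of_bool (_ == 0))%:R).
    by rewrite /om !dot_lin; ring.
  transitivity (\sum_t ((om e2 e4 * t ^+ 2 + (om e1 e4 + om e2 e3) * t + om e1 e3 == 0)%:R : F)
    + (om e2 e4 == 0)%:R).
    rewrite !quadratic_count //; apply: eq_bigr => t _; congr ((nat_of_bool (_ == _))%:R).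
    by rewrite /om; ring.
  congr (_ + _); apply: eq_bigr => t _; have [Kt1 Kt2] := KE t.
  rewrite (mE _ _ _ (f3 t) Kt1 Kt2); congr ((nat_of_bool (_ == 0))%:R).
  by rewrite /om !dot_lin; ring.
have [b14 b23 [b12 b13] [b24 b34]] := sb; have bC := alternating_skew alt.
have b32 : dot (e3 *m M) e2 = -1 by rewrite bC b23.
(* The first regulus is isotropic and counts [q + 1 = 1]. In the opposite one the form takes the
   value [2 s], so only [s = 0] and the line at infinity are isotropic; this gives [1 - 2]. *)
have Liso : Lam (fun k : line F => (isotropic M k)%:R) = -1.
  rewrite /Lam (isotropic_det alt f2 Lo3 Lo4) (isotropic_det alt f4 Ko2 Ko4) b34 b24 eqxx.
  rewrite (eq_bigr (fun _ => 1)) => [|t _]; last first.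
    have [Lt1 Lt2] := LE t; rewrite (isotropic_det alt (f1 t) Lt1 Lt2).
    rewrite (_ : dot _ _ = 0) ?eqxx // mulmxDl -scalemxAl !dot_lin b12 b14 b32 b34; ring.
  rewrite sum_cst (bigD1 0) //= big1 => [|t tn0]; last first.
    have [Kt1 Kt2] := KE t; rewrite (isotropic_det alt (f3 t) Kt1 Kt2).
    rewrite (_ : dot _ _ = 2%:R * t).
      by rewrite mulf_eq0 (negPf two) (negPf tn0).
    rewrite mulmxDl -scalemxAl !dot_lin b13 b14 b23 b24; ring.
  have [Kt1 Kt2] := KE 0; rewrite (isotropic_det alt (f3 0) Kt1 Kt2).
  by rewrite !scale0r !addr0 b13 eqxx /= add0r opprD addrA subrr add0r.
have : Lam (fun k : line F => s * (isotropic M k)%:R) = 0.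
  have -> : Lam (fun k : line F => s * (isotropic M k)%:R) = Lam (fun k : line F => \sum_i a i * (meets (m i) k)%:R).
    by rewrite /Lam; congr (_ + _ - (_ + _)); rewrite ?E //; apply: eq_bigr => t _; rewrite E.
  rewrite [LHS](_ : _ = \sum_i a i * Lam (fun k : line F => (meets (m i) k)%:R)).
    by rewrite big1 // => i _; rewrite Lmeets mulr0.
  rewrite /Lam; under [RHS]eq_bigr => i _ do rewrite mulrBr !mulrDr !mulr_sumr.
  by rewrite sumrB !big_split /=; congr (_ + _ - (_ + _)); apply: exchange_big.
have -> : Lam (fun k : line F => s * (isotropic M k)%:R) = s * Lam (fun k : line F => (isotropic M k)%:R).
  by rewrite /Lam -!mulr_sumr -!mulrDr -mulrBr.
by rewrite Liso mulrN1 => /eqP; rewrite oppr_eq0 => /eqP.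
Qed.

(** Modulo two, the number of lines of a regulus that meet [l] depends only on whether the middle
    coefficient of a quadratic vanishes. In characteristic two this coefficient is the form [J]
    evaluated on a basis of [dual l], hence the witness [invmx J] on [l] itself. *)
Lemma isotropic_sum_meets : 2%:R = 0 :> F -> exists M (L : F -> line F) Lo,
  [/\ alternating_mx M, M \in unitmx & forall l,
  \sum_t ((meets (L t) l)%:R : F) + (meets Lo l)%:R = (isotropic M l)%:R].
Proof.
move=> two; pose e (i : 'I_4) : 'rV[F]_4 := delta_mx 0 i.
have ee i j : dot (e i) (e j) = (i == j)%:R.
  rewrite dotE (bigD1 i) //= big1 ?addr0 => [|k ki].
    by rewrite !mxE !eqxx mul1r.
  by rewrite !mxE (negPf ki) andbF mul0r.
have coord x : x = dot x (e 0) *: e 0 + dot x (e 1) *: e 1 + dot x (e 2) *: e 2 + dot x (e 3) *: e 3.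
  have xe i : dot x (e i) = x 0 i.
    rewrite dotE (bigD1 i) //= big1 ?addr0 => [|k ki]; first by rewrite !mxE !eqxx mulr1.
    by rewrite !mxE (negPf ki) andbF mulr0.
  rewrite {1}[x]row_sum_delta !big_ord_recl big_ord0 addr0 !addrA !xe.
  congr (_ + _ + _ + _); congr (x 0 _ *: delta_mx 0 _); exact: val_inj.
pose J : 'M[F]_4 := (e 0)^T *m e 3 - (e 3)^T *m e 0 + ((e 1)^T *m e 2 - (e 2)^T *m e 1).
have JE x y : dot (x *m J) y = dot x (e 0) * dot y (e 3) - dot x (e 3) * dot y (e 0)
    + (dot x (e 1) * dot y (e 2) - dot x (e 2) * dot y (e 1)).
  by rewrite /J mulmxDr !mulmxBr !dot_lin !dot_outer !(dotC _ y).
have alt : alternating_mx J by move=> x; rewrite JE; ring.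
have uJ : J \in unitmx.
  apply: nondegenerate_unit => x H; rewrite (coord x).
  have := H (e 0); have := H (e 1); have := H (e 2); have := H (e 3).
  rewrite !JE !ee /= !mulr0 !mulr1 !subr0 !sub0r !addr0 !add0r => -> -> /eqP.
  rewrite oppr_eq0 => /eqP -> /eqP; rewrite oppr_eq0 => /eqP ->.
  by rewrite !scale0r !addr0.
have sb : symplectic_basis J (e 0) (e 1) (e 2) (e 3).
  by split; [| |split|split]; rewrite JE !ee /=; ring.
have [f1 f2 _ _] := regulus_lines alt sb.
have [L LE] := line_family f1; have [Lo [Lo3 Lo4]] := line_of f2.
exists (invmx J), L, Lo; split=> [||l].
- exact: alternating_inv.
- by rewrite unitmx_inv.
have [t1 [t2 [g t1l t2l]]] := line_free2 (dual l).
pose om x y := dot x t1 * dot y t2 - dot x t2 * dot y t1.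
have mE (k : line F) x y : free2 x y -> x \in val k -> y \in val k -> meets k l = (om x y == 0).
  by move=> h xk yk; rewrite meetsC (meets_det g t1l t2l h xk yk).
rewrite -isotropic_dualE // (isotropic_det alt g t1l t2l) (mE Lo _ _ f2 Lo3 Lo4).
transitivity (\sum_t ((om (e 2) (e 3) * t ^+ 2
    + (om (e 0) (e 3) + om (e 2) (e 1)) * t + om (e 0) (e 1) == 0)%:R : F)
    + (om (e 2) (e 3) == 0)%:R).
  congr (_ + _); apply: eq_bigr => t _; have [Lt1 Lt2] := LE t.
  rewrite (mE _ _ _ (f1 t) Lt1 Lt2); congr ((nat_of_bool (_ == 0))%:R).
  by rewrite /om !dot_lin; ring.
rewrite quadratic_count2 // JE; congr ((nat_of_bool (_ == 0))%:R).
rewrite /om !(dotC _ t1) !(dotC _ t2).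
set X := dot t1 (e 1) * dot t2 (e 2); set Y := dot t1 (e 2) * dot t2 (e 1).
have dbl (x : F) : x + x = 0 by rewrite -mulr2n -mulr_natl two mul0r.
have -> : dot t1 (e 0) * dot t2 (e 3) - dot t1 (e 3) * dot t2 (e 0) + (X - Y) =
  dot t1 (e 0) * dot t2 (e 3) - dot t1 (e 3) * dot t2 (e 0) + (Y - X) + (X + X) - (Y + Y) by ring.
rewrite !dbl subr0 addr0 /X /Y; ring.
Qed.

End Regulus.

(** * The code over the prime field *)

Section PrimeFieldEmbedding.
Variables (p : nat) (F : finFieldType).
Hypotheses (p_prime : prime p) (chF : p \in [pchar F]).

(** The embedding of the prime field, a ring morphism because [p] vanishes in [F]. *)
Definition Fp_embed (a : 'F_p) : F := (a : nat)%:R.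

Lemma Fp_embed_nat n : Fp_embed n%:R = n%:R.
Proof. by rewrite /Fp_embed val_Fp_nat // GRing.natr_mod_pchar. Qed.

Lemma Fp_natrE (a : 'F_p) : a = (a : nat)%:R.
Proof. by rewrite natr_Zp. Qed.

Lemma Fp_embedD a b : Fp_embed (a + b) = Fp_embed a + Fp_embed b.
Proof. by rewrite (Fp_natrE a) (Fp_natrE b) -natrD !Fp_embed_nat natrD. Qed.

Lemma Fp_embedM a b : Fp_embed (a * b) = Fp_embed a * Fp_embed b.
Proof. by rewrite (Fp_natrE a) (Fp_natrE b) -natrM !Fp_embed_nat natrM. Qed.

Lemma Fp_embed_sum I (r : seq I) (f : I -> 'F_p) :
  Fp_embed (\sum_(i <- r) f i) = \sum_(i <- r) Fp_embed (f i).
Proof. by apply: (big_morph _ Fp_embedD); apply: (Fp_embed_nat 0). Qed.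

Lemma Fp_embed_eq0 a : (Fp_embed a == 0) = (a == 0).
Proof.
rewrite [in RHS](Fp_natrE a) /Fp_embed -(dvdn_pcharf chF).
by rewrite (dvdn_pcharf (pchar_Fp p_prime)).
Qed.

Lemma Fp_embed_inj : injective Fp_embed.
Proof.
move=> a b E; apply/eqP; rewrite -subr_eq0 -Fp_embed_eq0.
by rewrite -(addrK (Fp_embed b) (Fp_embed _)) -Fp_embedD subrK E subrr.
Qed.
End PrimeFieldEmbedding.

Section BilinearForms.
Variable F : finFieldType.
Implicit Types (x y : 'rV[F]_4) (l : line F) (M : 'M[F]_4).

(** Named so that it can carry a bilinear structure and serve as the form of a
    [symplectic_polar_space]. *)
Definition mx_form M x y : F := dot (x *m M) y.

Lemma mx_form_bilinear M : bilinear_for *%R *%R (mx_form M).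
Proof.
split=> [y|x] k u v; first by rewrite /mx_form mulmxDl -scalemxAl dotDl dotZl.
by rewrite /mx_form dotDr dotZr.
Qed.

HB.instance Definition _ M := bilinear_isBilinear.Build F 'rV[F]_4 'rV[F]_4 F
  *%R *%R (mx_form M) (mx_form_bilinear M).

Lemma biscalar_mx (b : {biscalar 'rV[F]_4}) : exists M, forall x y, b x y = dot (x *m M) y.
Proof.
exists (\matrix_(i, j) b (delta_mx 0 i) (delta_mx 0 j)) => x y.
rewrite {1}(row_sum_delta x) linear_sumlz dotE.
under [RHS]eq_bigr => j _ do rewrite mxE mulr_suml.
rewrite exchange_big; apply: eq_bigr => i _.
rewrite linearZl_LR {1}(row_sum_delta y) linear_sumr mulr_sumr.
by apply: eq_bigr => j _; rewrite linearZr_LR mxE /=; ring.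
Qed.

Lemma lines_of_polar (b : {biscalar 'rV[F]_4}) M : (forall x y, b x y = dot (x *m M) y) ->
  forall l, (l \in lines_of (polar_space b)) = isotropic M l.
Proof.
move=> bE l; rewrite !inE; apply/forall_inP/forall_inP => H x xl.
  apply/forall_inP => y yl; have := H y yl; rewrite inE => /forall_inP/(_ x xl).
  by rewrite bE.
rewrite inE; apply/forall_inP => y yl.
by have /forall_inP/(_ x xl) := H y yl; rewrite bE.
Qed.
End BilinearForms.

Section Code.
Variables (p : nat) (F : finFieldType).
Hypotheses (p_prime : prime p) (chF : p \in [pchar F]).
Let q := #|F|.
Local Notation iota := (@Fp_embed p F).

Lemma code11_sum (c : word p F) : c \in code11 p F ->
  exists (I : finType) (a : I -> 'F_p) (m : I -> line F),
    forall l, c l = \sum_i a i * (meets (m i) l)%:R.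
Proof.
rewrite /code11; set s := [seq _ | _ : _]; move=> /(coord_span (X := in_tuple s)) cE.
have H (i : 'I_(size s)) : exists m, (in_tuple s)`_i = line_charvec p m.
  have /imageP[m _ mE] : nth 0 s i \in s by rewrite mem_nth.
  by exists m.
have [m mE] := fin_all_exists H.
exists 'I_(size s), (fun i => coord (in_tuple s) i c), m => l.
rewrite {1}cE sum_ffunE; apply: eq_bigr => i _.
by rewrite ffunE mE ffunE inE.
Qed.

Lemma is_word_code (I : finType) (a : I -> 'F_p) (m : I -> line F) (c : word p F) :
  (forall l, c l = \sum_i a i * (meets (m i) l)%:R) ->
  is_word (iota (\sum_i a i)) (fun l => iota (c l)).
Proof.
move=> cE; exists I, (fun i => iota (a i)), (fun i => meets (m i)); split=> [i||l].
- exact: generator_meets.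
- by rewrite Fp_embed_sum.
rewrite cE Fp_embed_sum //; apply: eq_bigr => i _.
by rewrite Fp_embedM // Fp_embed_nat.
Qed.

(** Each active vector is on at least [2 q] lines of the support, and each line has [q^2 - 1]
    nonzero vectors; this turns the weight bound into the one that [hull_zero] expects. *)
Lemma zero_sum_word (c : line F -> F) : is_word 0 c -> (19 <= q)%N ->
  (#|[set l | c l != 0%R]| <= q ^ 3 + 2 * q ^ 2 + q + 1)%N -> forall l, c l = 0.
Proof.
move=> cw q19 wt; apply: hull_zero => //.
apply: leq_trans (_ : #|[set l | c l != 0%R]| * (q ^ 2 - 1) <= _)%N; last first.
  by rewrite mulnC leq_mul2l wt orbT.
rewrite -sum_through -sum_nat_const big_mkcond [leqRHS]big_mkcond; apply: leq_sum => u _.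
case: ifP => //; rewrite inE => /andP[un0 /set0Pn[l]]; rewrite un0 inE => /andP[ul cl].
apply: leq_trans (card_through0 cw un0 ul cl) _.
by apply/subset_leq_card/subsetP => k; rewrite !inE.
Qed.

Lemma code11_classification (c : word p F) : c \in code11 p F -> c != 0 -> (19 <= q)%N ->
  (weight c <= q ^ 3 + 2 * q ^ 2 + q + 1)%N ->
  exists (a : 'F_p) (G : line F -> bool), [/\ a != 0, hyperplane G & forall l, c l = a * (G l)%:R].
Proof.
move=> /code11_sum[I [a [m cE]]] cn0 q19 wt; have cw := is_word_code cE.
have wtE : [set l | iota (c l) != 0] = [set l | c l != 0].
  by apply/setP => l; rewrite !inE Fp_embed_eq0.
set s := \sum_i a i in cw; case: (eqVneq s 0) => [s0|sn0].
  have i0 : iota 0 = 0 := Fp_embed_nat p_prime chF 0; rewrite s0 i0 in cw.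
  case/eqP: cn0; apply/ffunP => l; rewrite ffunE.
  apply/eqP; rewrite -(Fp_embed_eq0 p_prime chF); apply/eqP.
  by apply: (zero_sum_word cw) => //; rewrite wtE.
have in0 : iota s != 0 by rewrite Fp_embed_eq0.
(* Division by the sum reduces to sum one; the scalar that comes back is [s], which lies in
   ['F_p]. *)
have := is_word_scale (iota s)^-1 cw; rewrite mulVf // => cw1.
have [|G hG GE] := word_hyperplane cw1 q19.
  rewrite (_ : [set l | _] = [set l | c l != 0]) // -wtE; apply/setP => l.
  by rewrite !inE mulf_eq0 invr_eq0 (negPf in0).
exists s, G; split=> // l; apply: (Fp_embed_inj p_prime chF).
by rewrite Fp_embedM // Fp_embed_nat // -GE mulrA divff // mul1r.
Qed.

End Code.

Theorem theorem1p2 (p h q : nat) (F : finFieldType)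
  (p_prime : prime p) (h_ge1 : (1 <= h)%N) (qE : q = (p ^ h)%N)
  (q_ge19 : (19 <= q)%N) (cardF : #|F| = q) :
  (forall c : word p F,
     c \in code11 p F -> c != 0 ->
     (weight c <= q ^ 3 + 2 * q ^ 2 + q + 1)%N ->
     symplectic_word c \/ line_word c) /\
  ((exists c : word p F, c \in code11 p F /\ symplectic_word c) <->
   ~~ odd q).
Proof.
have chF : p \in [pchar F] by apply: (card_finPcharP _ p_prime); rewrite cardF qE.
have F19 : (19 <= #|F|)%N by rewrite cardF.
have odd_q : odd q = (p != 2).
  rewrite qE oddX -[RHS](_ : odd p = _); last by case: (even_prime p_prime) => [->|] //; case: eqP => // ->.
  by rewrite eqn0Ngt h_ge1.
have two_odd : p != 2 -> 2%:R != 0 :> F.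
  by move=> p2; rewrite -(dvdn_pcharf chF) dvdn_prime2.
have noniso (c : word p F) M a : p != 2 -> c \in code11 p F -> alternating_mx M -> M \in unitmx ->
    (forall l, c l = a * (isotropic M l)%:R) -> a = 0.
  move=> p2 /code11_sum[I [b [m cE]]] alt uM E; apply/eqP; rewrite -(Fp_embed_eq0 p_prime chF).
  apply/eqP; apply: (@isotropic_not_sum_meets _ M I (fun i => Fp_embed F (b i)) m) => // [|l].
    exact: two_odd.
  have := congr1 (@Fp_embed p F) (cE l); rewrite E Fp_embedM // Fp_embed_nat // => ->.
  rewrite Fp_embed_sum //; apply: eq_bigr => i _.
  by rewrite Fp_embedM // Fp_embed_nat.
have iso_symplectic (c : word p F) M : alternating_mx M -> M \in unitmx ->
    (forall l, c l = (isotropic M l)%:R) -> symplectic_word c.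
  move=> alt uM cE; split.
    rewrite -(card_isotropic alt uM) /weight; apply: eq_card => l; rewrite !inE cE.
    by case: (isotropic M l); rewrite ?oner_eq0 ?eqxx.
  exists (polar_space (mx_form M)); split.
    exists (mx_form M); split=> // x H; have E : x *m M = 0 by apply: dot_eq0_all.
    by rewrite -[x](mulmxK uM) E mul0mx.
  apply/ffunP => l; rewrite ffunE cE; congr ((nat_of_bool _)%:R).
  exact/esym/lines_of_polar.
(* For [q] even the only nonzero scalar is one, so the word is itself a characteristic vector. *)
have p2E : p = 2 -> forall a : 'F_p, a != 0 -> a = 1.
  by move=> p2; subst p; case=> [[|[|]]] //= ? _; apply: val_inj.
split.
  move=> c cC cn0 wt; rewrite -cardF in wt.
  have [a [G [an0 [[m GE]|[M [alt uM GE]]] cE]]] := code11_classification p_prime chF cC cn0 F19 wt.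
    right; split; last first.
      by exists a, m; apply/ffunP => l; rewrite cE GE !ffunE inE.
    rewrite -(card_meets m) /weight; apply: eq_card => l; rewrite !inE cE GE.
    by case: (meets m l); rewrite ?mulr1 ?mulr0 ?eqxx.
  left; case: (eqVneq p 2) => [p2|p2]; last first.
    case/eqP: an0; apply: (noniso c M) => // l; by rewrite cE GE.
  apply: (iso_symplectic c M) => // l; by rewrite cE GE (p2E p2 a an0) mul1r.
rewrite odd_q negbK; split=> [[c [cC [_ [W [[b [balt bnd ->]] cE]]]]]|/eqP p2].
  have [M bM] := biscalar_mx b; apply: contraT => p2.
  have alt : alternating_mx M by move=> x; rewrite -bM balt.
  have uM : M \in unitmx.
    by apply: nondegenerate_unit => x H; apply: bnd => y; rewrite bM.
  suff /eqP : 1 = 0 :> 'F_p by rewrite oner_eq0.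
  apply: (noniso c M) => // l; rewrite mul1r cE ffunE; congr ((nat_of_bool _)%:R).
  exact: lines_of_polar.
have two : 2%:R = 0 :> F by apply/eqP; rewrite -(dvdn_pcharf chF) p2.
have [M [L [Lo [alt uM LE]]]] := isotropic_sum_meets two.
exists (\sum_t line_charvec p (L t) + line_charvec p Lo); split.
  have inC l : line_charvec p l \in code11 p F by apply/memv_span/image_f.
  by rewrite memvD ?memv_suml.
apply: (iso_symplectic _ M) => // l; apply: (Fp_embed_inj p_prime chF).
rewrite Fp_embed_nat // -LE ffunE sum_ffunE Fp_embedD // Fp_embed_sum //.
congr (_ + _); last by rewrite !ffunE inE Fp_embed_nat.
by apply: eq_bigr => t _; rewrite !ffunE inE Fp_embed_nat.
Qed.
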